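(* Let $\vec\Lambda\in\mathbb C^n[2\mathfrak m]$, and let $x\in\mathbb C$ be generic. Then for every $\vec m'\in\mathcal Z^n[\mathfrak m]$ the vector-valued function $\lambda\mapsto\mathcal F^{\vec m'}(\lambda,x;\vec\Lambda)=\sum_{\vec m\in\mathcal Z^n[\mathfrak m]}\mathcal F_{\vec m}^{\vec m'}(\lambda,x;\vec\Lambda)\,v^{(\vec m)}_{\vec\Lambda}$ satisfies the $n$-point resonance relations with respect to $\vec\Lambda$.
   Context: Fix $\eta\in\mathbb C$ with $\operatorname{Im}\eta>0$; $q^x=e^{\pi i\eta x}$, $[x]=\frac{q^x-q^{-x}}{q-q^{-1}}$, $[x]_k=[x][x+1]\cdots[x+k-1]$, $[k]!=[1]\cdots[k]$. Fix integers $\mathfrak m\ge0$, $n\ge1$. $\mathcal Z^n=(\mathbb Z_{\ge0})^n$, $\mathcal Z^n[\mathfrak m]=\{\vec m\in\mathcal Z^n:\sum m_i=\mathfrak m\}$, $\mathbb C^n[2\mathfrak m]=\{\vec\Lambda\in\mathbb C^n:\sum\Lambda_i=2\mathfrak m\}$. ''Generic'' means outside a countable union of zero loci of holomorphic functions that are not identically zero. $\mathcal U_q(\mathfrak{sl}_2)$ is the unital algebra generated by $\mathbf E,\mathbf F,q^{x\mathbf h}$ ($x\in\mathbb C$) with $q^{x\mathbf h}q^{y\mathbf h}=q^{(x+y)\mathbf h}$, $q^{x\mathbf h}\mathbf E=q^{2x}\mathbf Eq^{x\mathbf h}$, $q^{x\mathbf h}\mathbf F=q^{-2x}\mathbf Fq^{x\mathbf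 h}$, $\mathbf{EF}-\mathbf{FE}=\frac{q^{\mathbf h}-q^{-\mathbf h}}{q-q^{-1}}$, and comultiplication $\Delta\mathbf E=\mathbf E\otimes1+q^{\mathbf h}\otimes\mathbf E$, $\Delta\mathbf F=\mathbf F\otimes q^{-\mathbf h}+1\otimes\mathbf F$, $\Delta q^{x\mathbf h}=q^{x\mathbf h}\otimes q^{x\mathbf h}$. $M_\lambda$ is the Verma module with highest weight vector $v_\lambda$ of weight $\lambda$ and basis $v_\lambda^{(k)}=\mathbf F^kv_\lambda/[k]!$, $k\ge0$. $M_\Lambda^\star$ has basis $\{u_m^\Lambda\}_{m\ge0}$ with $\mathbf Eu_m^\Lambda=[m]u_{m-1}^\Lambda$, $q^{x\mathbf h}u_m^\Lambda=q^{(\Lambda-2m)x}u_m^\Lambda$, $\mathbf Fu_m^\Lambda=[\Lambda-m]u_{m+1}^\Lambda$. Put $M_{\vec\Lambda}=M_{\Lambda_1}\otimes\dots\otimes M_{\Lambda_n}$, $v_{\vec\Lambda}^{(\vec m)}=v_{\Lambda_1}^{(m_1)}\otimes\dots\otimes v_{\Lambda_n}^{(m_n)}$, $u_{\vec m}^{\vec\Lambda}=u_{m_1}^{\Lambda_1}\otimes\dots\otimes u_{m_n}^{\Lambda_n}$. For $\vec\Lambda\in\mathbb C^n[2\mathfrak m]$ the zero weight space $M_{\vec\Lambda}[0]$ has basis $\{v^{(\vec m)}_{\vec\Lambda}\}_{\vec m\in\mathcal Z^n[\mathfrak m]}$. Holomorphic intertwining operators: $\Phi_m^\Lambda(\lambda):M_{\lambda-1}\to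 M_{\lambda-\Lambda+2m-1}\otimes M_\Lambda^\star$ is the module map determined by $\Phi_m^\Lambda(\lambda)v_{\lambda-1}=\sum_{i=0}^mq^{i(\lambda-\Lambda+2m-i)}[-\lambda+\Lambda-2m+i+1]_{m-i}\,v^{(i)}_{\lambda-\Lambda+2m-1}\otimes\mathbf E^iu_m^\Lambda$, and $\Phi_{\vec m}^{\vec\Lambda}(\lambda)=\big(\Phi_{m_1}^{\Lambda_1}(\lambda-\sum_{i=2}^n(\Lambda_i-2m_i))\otimes1^{n-1}\big)\cdots\big(\Phi_{m_{n-1}}^{\Lambda_{n-1}}(\lambda-\Lambda_n+2m_n)\otimes1\big)\Phi_{m_n}^{\Lambda_n}(\lambda)$. For $\vec\Lambda\in\mathbb C^n[2\mathfrak m]$, $\vec m\in\mathcal Z^n[\mathfrak m]$ it maps $M_{\lambda-1}\to M_{\lambda-1}\otimes M_{\Lambda_1}^\star\otimes\dots\otimes M_{\Lambda_n}^\star$. Trace functions: $$\mathcal F_{\vec m}(\lambda,x;\vec\Lambda)=q^{-\mathfrak m(\mathfrak m+1)/2}(q-q^{-1})^{\mathfrak m}(q^x-q^{-x})\operatorname{Tr}\big|_{M_{\lambda-1}}\big(\Phi_{\vec m}^{\vec\Lambda}(\lambda)q^{x\mathbf h}\big)=\sum_{\vec m'\in\mathcal Z^n[\mathfrak m]}\mathcal F_{\vec m}^{\vec m'}(\lambda,x;\vec\Lambda)\,u_{\vec m'}^{\vec\Lambda},$$ where the trace is over $M_{\lambda-1}$ (taking values in $M_{\Lambda_1}^\star\otimes\dots\otimes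 M_{\Lambda_n}^\star$); it converges for $|q^{2x}|\gg1$ and is continued meromorphically in $x$. Resonance relations: a holomorphic function $\varphi(\lambda)=\sum_{\vec m\in\mathcal Z^n[\mathfrak m]}\varphi_{\vec m}(\lambda)v_{\vec\Lambda}^{(\vec m)}$ satisfies the $n$-point resonance relations with respect to $\vec\Lambda$ if for all $\vec m\in\mathcal Z^n[\mathfrak m]$: (1) for $j=1,\dots,n-1$, $\delta\in\{1,\dots,m_j\}$: $\varphi_{\vec m}\big(-\delta+\sum_{i=j+1}^n(\Lambda_i-2m_i)\big)=\varphi_{\tau_j^\delta(\vec m)}\big(-\delta+\sum_{i=j+1}^n(\Lambda_i-2m_i)\big)$, where $\tau_j^\delta(\vec m)=(m_1,\dots,m_{j-1},m_j-\delta,m_{j+1}+\delta,m_{j+2},\dots,m_n)$; (2) for $\delta\in\{1,\dots,m_n\}$: $\varphi_{\vec m}(-\delta)=\varphi_{\tau_n^\delta(\vec m)}(\delta)$, where $\tau_n^\delta(\vec m)=(m_1+\delta,m_2,\dots,m_{n-1},m_n-\delta)$ (and $\tau_1^\delta(\vec m)=\vec m$ if $n=1$). *)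

(* Defs.v *)
From HB Require Import structures.
From mathcomp Require Import all_boot all_order all_algebra.
From mathcomp Require Import finmap.
From mathcomp Require Import monalg.
From mathcomp Require Import complex.
From mathcomp Require Import all_classical all_reals all_analysis.
From mathcomp Require Import ring.

Set Implicit Arguments.
Unset Strict Implicit.
Unset Printing Implicit Defensive.

Import Order.TTheory GRing.Theory Num.Theory numFieldNormedType.Exports.

Local Open Scope classical_set_scope.
Local Open Scope ring_scope.

(* [R[i]], packaged so that the topology mathcomp-analysis puts on every
   [numClosedFieldType] is found. *)
Definition Cx (R : realType) : numClosedFieldType := R[i]%C.

Section ComplexAnalysis.
Variable R : realType.
Local Notation C := (Cx R).

Definition cexp (z : C) : C :=
  ((expR (complex.Re z) * cos (complex.Im z))
     +i* (expR (complex.Re z) * sin (complex.Im z)))%C.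

Definition cpi : C := (pi : R)%:C%C.

Definition holomorphic (f : C -> C) : Prop := forall z, derivable f z 1.

(* At every point, f is the sum of a Laurent series with finite principal part.
   The formula is also required at z = z0, where every term but the constant
   one vanishes (0 ^ n = 0 for n != 0, n < 0 included): at a removable
   singularity f thus has its natural value, and at a pole its (irrelevant)
   value is the constant Laurent coefficient.  This makes the meromorphic
   continuation of a function unique as a total function. *)
Definition meromorphic (f : C -> C) : Prop :=
  forall z0 : C, exists (N : nat) (a : nat -> C), \forall z \near z0,
    series (fun k => a k * ((z : C) - z0) ^ (k%:Z - N%:Z)) @ \oo --> f z.

(* P x for all x outside a countable union of zero loci of holomorphic
   functions that are not identically zero. *)
Definition generic (P : C -> Prop) : Prop :=
  exists g : nat -> C -> C,
    (forall k, holomorphic (g k) /\ exists z, g k z != 0) /\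
    forall x, (forall k, g k x != 0) -> P x.

End ComplexAnalysis.

Section FreeModules.
Variable R : realType.
Local Notation C := (Cx R).

Definition bas {I : choiceType} (i : I) : {malg C[I]} := mkmalgU i 1.

Definition lin_ext {I : choiceType} {V : lmodType C} (f : I -> V)
    (u : {malg C[I]}) : V :=
  \sum_(i <- msupp u) u@_i *: f i.

(* The tensor product of the free modules on I and J is the one on I * J. *)
Definition tens {I J : choiceType} (u : {malg C[I]}) (v : {malg C[J]}) :
    {malg C[(I * J)%type]} :=
  lin_ext (fun i => lin_ext (fun j => bas (i, j)) v) u.

Definition tens_map {I J I' J' : choiceType}
    (A : {malg C[I]} -> {malg C[I']}) (B : {malg C[J]} -> {malg C[J']}) :
    {malg C[(I * J)%type]} -> {malg C[(I' * J')%type]} :=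
  lin_ext (fun ij => tens (A (bas ij.1)) (B (bas ij.2))).

End FreeModules.

(* The operators of E, F and q^{x h}. *)
Record Uq_action (R : realType) (V : lmodType (Cx R)) := UqAction {
  actE : V -> V;
  actF : V -> V;
  actK : Cx R -> V -> V }.

Section QuantumGroup.
Variables (R : realType) (eta : Cx R).
Local Notation C := (Cx R).

Definition qpow (x : C) : C := cexp (cpi R * 'i * eta * x).

Definition qnum (x : C) : C := (qpow x - qpow (- x)) / (qpow 1 - qpow (- 1)).

Definition qpoch (x : C) (k : nat) : C := \prod_(i < k) qnum (x + i%:R).

Definition qfact (k : nat) : C := \prod_(i < k) qnum i.+1%:R.

Definition Uq_module (V : lmodType C) (A : Uq_action V) : Prop :=
  [/\ linear (actE A), linear (actF A) & forall x, linear (actK A x)] /\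
  [/\ forall v, actK A 0 v = v,
      forall x y v, actK A (x + y) v = actK A x (actK A y v),
      forall x v, actK A x (actE A v) = qpow (2 * x) *: actE A (actK A x v),
      forall x v, actK A x (actF A v) = qpow (- (2 * x)) *: actF A (actK A x v)
    & forall v, actE A (actF A v) - actF A (actE A v) =
        (qpow 1 - qpow (- 1))^-1 *: (actK A 1 v - actK A (- 1) v)].

Definition module_map (V W : lmodType C) (A : Uq_action V) (B : Uq_action W)
    (f : V -> W) : Prop :=
  [/\ linear f, forall v, f (actE A v) = actE B (f v),
      forall v, f (actF A v) = actF B (f v)
    & forall x v, f (actK A x v) = actK B x (f v)].

(* M_lambda; [bas k] is v_lambda^{(k)} = F^k v_lambda / [k]!. *)
Definition verma (lam : C) : Uq_action {malg C[nat]} := UqAction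
  (lin_ext (fun k => if k is k'.+1 then qnum (lam - k'%:R) *: bas R k' else 0))
  (lin_ext (fun k => qnum k.+1%:R *: bas R k.+1))
  (fun x => lin_ext (fun k => qpow ((lam - (2 * k)%:R) * x) *: bas R k)).

(* M_Lambda^*; [bas m] is u_m^Lambda (note that [0] = 0). *)
Definition dverma (L : C) : Uq_action {malg C[nat]} := UqAction
  (lin_ext (fun m => qnum m%:R *: bas R m.-1))
  (lin_ext (fun m => qnum (L - m%:R) *: bas R m.+1))
  (fun x => lin_ext (fun m => qpow ((L - (2 * m)%:R) * x) *: bas R m)).

(* The action on a tensor product through the comultiplication. *)
Definition tens_action (I J : choiceType) (A : Uq_action {malg C[I]})
    (B : Uq_action {malg C[J]}) : Uq_action {malg C[(I * J)%type]} := UqAction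
  (fun u => tens_map (actE A) id u + tens_map (actK A 1) (actE B) u)
  (fun u => tens_map (actF A) (actK B (- 1)) u + tens_map id (actF B) u)
  (fun x => tens_map (actK A x) (actK B x)).

(* The image Phi_m^L(lam) v_{lam-1} of the highest weight vector. *)
Definition Phi_hw (L : C) (m : nat) (lam : C) : {malg C[(nat * nat)%type]} :=
  \sum_(i < m.+1)
    (qpow (i%:R * (lam - L + (2 * m)%:R - i%:R))
       * qpoch (- lam + L - (2 * m)%:R + i%:R + 1) (m - i))
      *: tens (bas R (i : nat)) (iter i (actE (dverma L)) (bas R m)).

(* The module map M_{lam-1} -> M_{lam-L+2m-1} (x) M_L^* sending v_{lam-1} to
   [Phi_hw L m lam], see [Phi_module_map] and [Phi_unique]. *)
Definition Phi (L : C) (m : nat) (lam : C) :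
    {malg C[nat]} -> {malg C[(nat * nat)%type]} :=
  lin_ext (fun k => (qfact k)^-1 *:
    iter k (actF (tens_action (verma (lam - L + (2 * m)%:R - 1)) (dverma L)))
      (Phi_hw L m lam)).

Definition tinit (T : Type) (n : nat) (t : n.+1.-tuple T) : n.-tuple T :=
  [tuple tnth t (widen_ord (leqnSn n) i) | i < n].

(* M_mu (x) M_{L_1}^* (x) ... (x) M_{L_n}^* has basis v^{(k)} (x) u_s, indexed by
   k and the n-tuple s.  The factor of the n-th module acts first, then the
   first n - 1 ones with spectral parameter lam - L_n + 2 m_n. *)
Fixpoint mPhi (n : nat) :
    n.-tuple C -> n.-tuple nat -> C ->
    {malg C[nat]} -> {malg C[(nat * n.-tuple nat)%type]} :=
  match n return n.-tuple C -> n.-tuple nat -> C ->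
    {malg C[nat]} -> {malg C[(nat * n.-tuple nat)%type]} with
  | 0 => fun _ _ _ => lin_ext (fun k => bas R (k, [tuple]))
  | n'.+1 => fun L m lam v =>
      let Ln := tnth L ord_max in
      let mn := tnth m ord_max in
      lin_ext (fun p : (nat * n'.-tuple nat) * nat =>
          bas R (p.1.1, [tuple of rcons p.1.2 p.2]))
        (tens_map (mPhi (tinit L) (tinit m) (lam - Ln + (2 * mn)%:R)) id
          (Phi Ln mn lam v))
  end.

(* The u_w-coordinate of the trace over M, with basis (v^{(k)}), of
   A : M -> M (x) W is t. *)
Definition has_trace (I : choiceType)
    (A : {malg C[nat]} -> {malg C[(nat * I)%type]}) (w : I) (t : C) : Prop :=
  series (fun k => (A (bas R k))@_(k, w)) @ \oo --> t.

(* F_m^{m'}(lam, x; L): [trace_fun L M m m' lam] is the meromorphic function of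
   x which for |q^{2x}| large enough is given by the trace. *)
Definition is_trace_fun (n : nat) (L : n.-tuple C) (M : nat)
    (m m' : n.-tuple nat) (lam : C) (f : C -> C) : Prop :=
  meromorphic f /\
  exists r : R, forall x : C, r%:C%C < `|qpow (2 * x)| ->
    exists2 t, has_trace (mPhi L m lam \o actK (verma (lam - 1)) x) m' t &
      f x = qpow (- ((M * M.+1)%:R / 2)) * (qpow 1 - qpow (- 1)) ^+ M
              * (qpow x - qpow (- x)) * t.

Definition trace_fun (n : nat) (L : n.-tuple C) (M : nat)
    (m m' : n.-tuple nat) (lam : C) : C -> C :=
  xget (fun=> 0) [set f | is_trace_fun L M m m' lam f].

(* F^{m'}(lam, x; L), with values in the Verma module product M_L, free on the
   v^{(m)}.  The sum is over all n-tuples m of sum M. *)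
Definition trace_vec (n : nat) (L : n.-tuple C) (M : nat) (m' : n.-tuple nat)
    (lam x : C) : {malg C[n.-tuple nat]} :=
  \sum_(t : n.-tuple 'I_M.+1 | sumn (map val t) == M)
    trace_fun L M [tuple of map val t] m' lam x *: bas R [tuple of map val t].

End QuantumGroup.

(* tau_j^delta; [ordS] is the cyclic successor, so that for j = n the index
   j + 1 is 1, and tau_1^delta is the identity if n = 1 and delta <= m_1. *)
Definition tau (n : nat) (j : 'I_n) (delta : nat) (m : n.-tuple nat) :
    n.-tuple nat :=
  [tuple (tnth m i - delta * (i == j) + delta * (i == ordS j))%N | i < n].

(* phi is a holomorphic function with values in the zero weight space of M_L,
   which has basis v^{(m)}, sum m_i = M, and satisfies the n-point resonance
   relations with respect to L. *)
Definition resonance (R : realType) (n : nat) (L : n.-tuple (Cx R)) (M : nat)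
    (phi : Cx R -> {malg (Cx R)[n.-tuple nat]}) : Prop :=
  [/\ forall m : n.-tuple nat, holomorphic (fun lam => (phi lam)@_m),
      forall (lam : Cx R) (m : n.-tuple nat), sumn m <> M -> (phi lam)@_m = 0,
      forall m : n.-tuple nat, sumn m = M ->
      forall j : 'I_n, (j.+1 < n)%N ->
      forall delta : nat, (1 <= delta <= tnth m j)%N ->
        let lam : Cx R := - delta%:R
          + \sum_(i < n | (j < i)%N) (tnth L i - (2 * tnth m i)%:R) in
        (phi lam)@_m = (phi lam)@_(tau j delta m)
    & forall m : n.-tuple nat, sumn m = M ->
      forall j : 'I_n, j.+1 = n ->
      forall delta : nat, (1 <= delta <= tnth m j)%N ->
        (phi (- delta%:R))@_m = (phi delta%:R)@_(tau j delta m)].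

(* Main.v *)
Require Import Defs.
From mathcomp Require Import all_boot all_order all_algebra.
From mathcomp Require Import finmap.
From mathcomp Require Import monalg.
From mathcomp Require Import complex.
From mathcomp Require Import all_classical all_reals all_analysis.
From mathcomp Require Import ring lra zify.

(** Both resonance relations come from the reducible Verma modules.  For a
    natural number d > 0, M_{d-1} contains a copy of M_{-d-1}, embedded by
    v^{(k)} |-> F^d v^{(k)}.  Two facts about one intertwiner follow.

    - If the target parameter lam - L + 2m equals d <= m, then Phi_m^L takes its
      values in the submodule M_{-d-1} (x) M_L^*, where it is Phi_{m-d}^L
      ([phic_shift]).
    - If the source parameter lam equals d <= m, then the restriction of
      Phi_{m-d}^L to the submodule M_{-d-1} is Phi_m^L ([phic_lower]): F^d maps the
      singular vector defining Phi_{m-d}^L(d) to a singular vector with the same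
      leading coefficient as the one defining Phi_m^L(-d).

    In relation (1) the module between the factors j and j + 1 is such a pair
    M_{-d-1} in M_{d-1}.  Moving d units of m_j to m_{j+1} changes the module that
    the composition goes through, but the two facts, applied to both factors, show
    that the composed operators are equal ([cPhi_exchange]), hence so are their
    traces.  In relation (2) the pair occurs at the two ends of the composition.
    The operator for tau_n^d(m) at lam = d is iota C, with C from M_{d-1} to
    M_{-d-1} (x) W and iota the inclusion, while the operator for m at lam = -d is
    C iota, so that the traces agree by cyclicity ([trace_fun_reflect]); on matrix
    elements, the first d diagonal entries of iota C vanish and the others are
    those of C iota.

    The trace functions must also be shown to exist and to be entire in lam.  F acts
    on M (x) M_L^* by an operator independent of the highest weight of M, and its
    powers are explicit ([iter_cF_delta]).  It follows that the k-th diagonal matrix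
    element of the composed intertwiner is entire in lam and, for large k, a finite
    sum of terms a_i(lam) q^{be_i k} with a_i entire and exponents be_i
    independent of lam ([exp_poly_diag]).  The trace is thus a finite sum of geometric
    series, and its continuation is, for fixed x, entire in lam, with denominators
    1 - q^{be_i - 2x} ([trace_fun_norm_trace_val]).  Generic means here that
    none of these countably many denominators vanishes.  That the continuation is
    the only one rests on the identity theorem for meromorphic functions
    ([identity_theorem]). *)

Set Implicit Arguments.
Unset Strict Implicit.
Unset Printing Implicit Defensive.
Import Order.TTheory GRing.Theory Num.Theory numFieldNormedType.Exports.
Local Open Scope classical_set_scope.
Local Open Scope ring_scope.

(** * Coefficients in free modules *)

Section Coefficients.
Variable R : realType.
Local Notation C := (Cx R).
Implicit Types I J : choiceType.

Fact lcoef_key : unit. Proof. exact: tt. Qed.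
(** Locked, so that conversion never compares the finite maps underlying two
    elements of a free module. *)
Definition lcoef I (u : {malg C[I]}) (i : I) : C := locked_with lcoef_key u@_i.

Lemma lcoefE I (u : {malg C[I]}) i : u@_i = lcoef u i.
Proof. by rewrite /lcoef unlock. Qed.

Lemma lcoefD I (u v : {malg C[I]}) i : lcoef (u + v) i = lcoef u i + lcoef v i.
Proof. by rewrite -!lcoefE mcoeffD. Qed.

Lemma lcoefZ I (c : C) (u : {malg C[I]}) i : lcoef (c *: u) i = c * lcoef u i.
Proof. by rewrite -!lcoefE mcoeffZ. Qed.

Lemma lcoef_bas I (i j : I) : lcoef (bas R i) j = (i == j)%:R.
Proof. by rewrite -lcoefE mcoeffU. Qed.

Lemma msum_single I (u : {malg C[I]}) (g : I -> C) (i0 : I) :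
  (forall i, i != i0 -> lcoef u i * g i = 0) ->
  \sum_(i <- msupp u) lcoef u i * g i = lcoef u i0 * g i0.
Proof.
move=> g0; case: (boolP (i0 \in msupp u)) => i0u.
  by rewrite (big_fsetD1 i0) //= big1_fset ?addr0 // => i; rewrite in_fsetD1 => /andP[/g0].
rewrite -lcoefE (mcoeff_outdom i0u) mul0r big1_fset // => i iu _.
by apply: g0; apply: contraNneq i0u => <-.
Qed.

Lemma lcoef_lin_ext I J (f : I -> {malg C[J]}) u j :
  lcoef (lin_ext f u) j = \sum_(i <- msupp u) lcoef u i * lcoef (f i) j.
Proof. by rewrite /lin_ext -lcoefE raddf_sum /=; apply: eq_bigr => i _; rewrite mcoeffZ !lcoefE. Qed.

Lemma lcoef_lin_extZ I J (f : I -> {malg C[J]}) (c : C) i j :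
  lcoef (lin_ext f (c *: bas R i)) j = c * lcoef (f i) j.
Proof.
rewrite lcoef_lin_ext (msum_single (i0 := i)) => [|i' i'i].
  by rewrite lcoefZ lcoef_bas eqxx mulr1.
by rewrite lcoefZ lcoef_bas eq_sym (negbTE i'i) mulr0 mul0r.
Qed.

Lemma lcoef_lin_ext_bas I J (f : I -> {malg C[J]}) i j :
  lcoef (lin_ext f (bas R i)) j = lcoef (f i) j.
Proof. by rewrite -[bas R i]scale1r lcoef_lin_extZ mul1r. Qed.

Lemma lcoef_tens I J (u : {malg C[I]}) (v : {malg C[J]}) i j :
  lcoef (tens u v) (i, j) = lcoef u i * lcoef v j.
Proof.
rewrite /tens lcoef_lin_ext (msum_single (i0 := i)) => [|i' i'i]; last first.
  rewrite lcoef_lin_ext big1 ?mulr0 // => j' _.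
  by rewrite lcoef_bas xpair_eqE (negbTE i'i) mulr0.
rewrite lcoef_lin_ext (msum_single (i0 := j)) => [|j' j'j].
  by rewrite lcoef_bas eqxx mulr1.
by rewrite lcoef_bas xpair_eqE (negbTE j'j) andbF mulr0.
Qed.

Lemma lcoef_tens_map I J I' J' (A : {malg C[I]} -> {malg C[I']})
  (B : {malg C[J]} -> {malg C[J']}) u i j :
  lcoef (tens_map A B u) (i, j) =
    \sum_(s <- msupp u) lcoef u s * (lcoef (A (bas R s.1)) i * lcoef (B (bas R s.2)) j).
Proof. by rewrite lcoef_lin_ext; apply: eq_bigr => s _; rewrite lcoef_tens. Qed.

End Coefficients.

(** * Quantum numbers *)

Section QuantumNumbers.
Variables (R : realType) (eta : Cx R).
Hypothesis eta_gt0 : 0 < 'Im eta.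
Local Notation C := (Cx R).
Local Notation qpow := (qpow eta).
Local Notation qnum := (qnum eta).
Local Notation qpoch := (qpoch eta).
Local Notation qfact := (qfact eta).

Lemma cexpD (z w : C) : cexp (z + w) = cexp z * cexp w.
Proof.
case: z w => [a b] [c d]; rewrite /cexp /= expRD cosD sinD.
by apply/eqP; rewrite eq_complex /=; apply/andP; split; apply/eqP; ring.
Qed.

Lemma cexp0 : cexp (0 : C) = 1.
Proof. by rewrite /cexp /= expR0 cos0 sin0 mul1r mulr0. Qed.

Lemma norm_cexp (z : C) : `|cexp z| = (expR (complex.Re z))%:C%C.
Proof.
rewrite normc_def /cexp /= !exprMn -mulrDr cos2Dsin2 mulr1 sqrtr_sqr.
by rewrite ger0_norm // expR_ge0.
Qed.

Lemma cexp_neq0 (z : C) : cexp z != 0.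
Proof. by rewrite -normr_gt0 norm_cexp ltcR expR_gt0. Qed.

Lemma qpowD x y : qpow (x + y) = qpow x * qpow y.
Proof. by rewrite /Defs.qpow mulrDr cexpD. Qed.
Lemma qpow0 : qpow 0 = 1.
Proof. by rewrite /Defs.qpow mulr0 cexp0. Qed.
Lemma qpow_neq0 x : qpow x != 0.
Proof. exact: cexp_neq0. Qed.
Lemma qpowN x : qpow (- x) = (qpow x)^-1.
Proof. by apply: (mulIf (qpow_neq0 x)); rewrite -qpowD addNr qpow0 mulVf // qpow_neq0. Qed.
Lemma qpowB x y : qpow (x - y) = qpow x / qpow y.
Proof. by rewrite qpowD qpowN. Qed.

Lemma norm_qpow_nat n : `|qpow n%:R| = (expR (- (pi * n%:R * complex.Im eta)))%:C%C.
Proof.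
rewrite norm_cexp; congr ((expR _)%:C%C).
rewrite -[n%:R](rmorph_nat (real_complex R)) -complexiE /cpi.
by case: eta => a b /=; ring.
Qed.

Lemma Im_eta_gt0 : 0 < complex.Im eta.
Proof. by move: eta_gt0; rewrite -complexIm ltcR. Qed.

Lemma qpow_nat_neq1 n : (0 < n)%N -> qpow n%:R != 1.
Proof.
move=> n0; apply/eqP => /(congr1 Num.norm); rewrite norm_qpow_nat normr1.
move/complexI => E; have := expR_lt1 (- (pi * n%:R * complex.Im eta)).
by rewrite E ltxx oppr_lt0 !mulr_gt0 ?pi_gt0 ?ltr0n // Im_eta_gt0.
Qed.

Lemma qpow_nat_subN_neq0 n : (0 < n)%N -> qpow n%:R - qpow (- n%:R) != 0.
Proof.
move=> n0; rewrite subr_eq0 qpowN; apply/eqP => E.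
have /eqP[] := @qpow_nat_neq1 (n + n) ltac:(by rewrite addn_gt0 n0).
by rewrite natrD qpowD {2}E divff // qpow_neq0.
Qed.

Lemma q_subN_neq0 : qpow 1 - qpow (- 1) != 0.
Proof. exact: (@qpow_nat_subN_neq0 1). Qed.

Lemma qnum_nat_neq0 n : qnum n.+1%:R != 0.
Proof. by rewrite mulf_neq0 ?invr_eq0 ?q_subN_neq0 // qpow_nat_subN_neq0. Qed.

Lemma qnum0 : qnum 0 = 0.
Proof. by rewrite /Defs.qnum oppr0 subrr mul0r. Qed.

Lemma qnumN x : qnum (- x) = - qnum x.
Proof. by rewrite /Defs.qnum opprK -mulNr opprB. Qed.

Lemma qfact_neq0 k : qfact k != 0.
Proof. by apply/prodf_neq0 => i _; exact: qnum_nat_neq0. Qed.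

Lemma qfactS k : qfact k.+1 = qfact k * qnum k.+1%:R.
Proof. by rewrite /Defs.qfact big_ord_recr. Qed.

Lemma qpochS x k : qpoch x k.+1 = qnum x * qpoch (x + 1) k.
Proof.
rewrite /Defs.qpoch big_ord_recl addr0; congr (_ * _).
by apply: eq_bigr => i _; rewrite lift0 -natr1 addrA addrAC.
Qed.

Lemma qpochD x k l : qpoch x (k + l) = qpoch x k * qpoch (x + k%:R) l.
Proof.
rewrite /Defs.qpoch big_split_ord /=; congr (_ * _).
by apply: eq_bigr => i _; rewrite natrD addrA.
Qed.

(** This is the identity behind [E, F] acting diagonally, on both M_lam and M_L^*. *)
Lemma qnum_shift a b :
  qnum (a + 1) * qnum (b - a) - qnum a * qnum (b - a + 1) = qnum (b - 2 * a).
Proof.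
rewrite /Defs.qnum !(opprD, opprK, mulNr) mulr_natl mulr2n !(opprD, opprK).
rewrite !qpowD !qpowN; have := q_subN_neq0; rewrite qpowN.
have := qpow_neq0 1; have := qpow_neq0 a; have := qpow_neq0 b.
set A := qpow a; set B := qpow b; set Q := qpow 1 => A0 B0 Q0 Q1.
have Q2 : Q ^+ 2 - 1 != 0.
  by apply: contraNneq Q1 => E; rewrite -[Q - _](mulfK Q0) mulrBl mulVf // -expr2 E mul0r.
by field; rewrite ?A0 ?B0 ?Q0 ?Q2.
Qed.

(** The diagonal action of a comultiplied [E, F] is the sum of the two actions,
    twisted by powers of q. *)
Lemma qnum_split a b :
  qpow (- b) * qnum a + qpow a * qnum b = qnum (a + b).
Proof.
rewrite /Defs.qnum !(opprD, opprK).
by rewrite !qpowD; ring.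
Qed.
End QuantumNumbers.

(** * Matrix elements of one intertwiner *)

Section Intertwiners.
Variables (R : realType) (eta : Cx R).
Hypothesis eta_gt0 : 0 < 'Im eta.
Local Notation C := (Cx R).
Local Notation qpow := (qpow eta).
Local Notation qnum := (qnum eta).
Local Notation qpoch := (qpoch eta).
Local Notation qfact := (qfact eta).

(** The action of F on a tensor product M (x) M_L^* with M a Verma module, on the
    family t of coefficients of v^{(i)} (x) u_p.  In the basis v^{(i)} the action of F
    on M does not depend on the highest weight, hence neither does this operator:
    this is what makes modules of different highest weights comparable below. *)
Definition tensF_coef (L : C) (t : nat -> nat -> C) (i p : nat) : C :=
  (if i is i'.+1 then qnum i%:R * qpow (- (L - (2 * p)%:R)) * t i' p else 0)
  + (if p is p'.+1 then qnum (L - p'%:R) * t i p' else 0).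

Lemma lcoef_tens_map_cF L (A K G : {malg C[nat]} -> {malg C[nat]}) u (i p : nat) :
  (forall k i, lcoef (A (bas R k)) i = qnum k.+1%:R * (k.+1 == i)%:R) ->
  (forall k i, lcoef (K (bas R k)) i = qpow (- (L - (2 * k)%:R)) * (k == i)%:R) ->
  (forall k i, lcoef (G (bas R k)) i = qnum (L - k%:R) * (k.+1 == i)%:R) ->
  lcoef (tens_map A K u + tens_map id G u) (i, p) = tensF_coef L (fun i p => lcoef u (i, p)) i p.
Proof.
move=> opFE opKE opGE.
apply: etrans (lcoefD _ _ _) _.
apply: etrans (congr2 _ (lcoef_tens_map A K u i p) (lcoef_tens_map id G u i p)) _.
rewrite /tensF_coef; congr (_ + _).
  case: i => [|i].
    by apply: big1 => -[i' p'] _; rewrite opFE mulr0 mul0r mulr0.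
  rewrite (msum_single (i0 := (i, p))) => [|[i' p'] ne] /=.
    by rewrite opFE opKE !eqxx !mulr1 mulrC.
  rewrite opFE opKE /= eqSS.
  move: ne; rewrite xpair_eqE; case: eqP => //= _; last by rewrite mulr0 mul0r mulr0.
  by case: eqP => //= _; rewrite !mulr0.
case: p => [|p].
  by apply: big1 => -[i' p'] _; rewrite opGE /= !mulr0.
rewrite (msum_single (i0 := (i, p))) => [|[i' p'] ne] /=.
  by rewrite opGE lcoef_bas !eqxx mulr1 mul1r mulrC.
rewrite opGE lcoef_bas /= eqSS.
move: ne; rewrite xpair_eqE; case: eqP => //= _; last by rewrite mul0r mulr0.
by case: eqP => //= _; rewrite !mulr0.
Qed.

Lemma lcoef_tensF lam L u (i p : nat) :
  lcoef (actF (tens_action (verma eta lam) (dverma eta L)) u) (i, p) =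
  tensF_coef L (fun i p => lcoef u (i, p)) i p.
Proof.
apply: lcoef_tens_map_cF => k j; rewrite lcoef_lin_ext_bas lcoefZ lcoef_bas //.
by rewrite mulrN1.
Qed.

Lemma lcoef_iter_dvermaE L m i (p : nat) :
  lcoef (iter i (actE (dverma eta L)) (bas R m)) p =
    (p + i == m)%N%:R * \prod_(t < i) qnum (m%:R - t%:R).
Proof.
elim: i p => [|i IH] p.
  by rewrite big_ord0 mulr1 addn0 lcoef_bas eq_sym.
rewrite iterS; set u := iter i _ _.
have -> : lcoef (actE (dverma eta L) u) p = lcoef u p.+1 * qnum p.+1%:R.
  rewrite [LHS](@lcoef_lin_ext R nat nat) (msum_single (i0 := p.+1)) => [|p' ne].
    by rewrite lcoefZ lcoef_bas /= eqxx mulr1.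
  rewrite lcoefZ lcoef_bas; case: p' ne => [|p'] ne /=.
    by rewrite qnum0 mul0r mulr0.
  by rewrite (negbTE (contraNneq _ ne)) ?mulr0 // => ->.
rewrite IH addSnnS big_ord_recr /= mulrA.
case: eqP => [<-|_]; last by rewrite !mul0r.
by congr (_ * qnum _); rewrite -addSnnS natrD addrK.
Qed.

(** Coefficients of [Phi_hw].  They depend on lam and L only through the target
    parameter kap = lam - L + 2m. *)
Definition hw_coef (kap : C) (m i p : nat) : C :=
  (i + p == m)%N%:R * (qpow (i%:R * (kap - i%:R)) * qpoch (- kap + i%:R + 1) p
    * \prod_(t < i) qnum (m%:R - t%:R)).

Lemma lcoef_Phi_hw L m lam (i p : nat) :
  lcoef (Phi_hw eta L m lam) (i, p) = hw_coef (lam - L + (2 * m)%:R) m i p.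
Proof.
rewrite /Phi_hw -lcoefE raddf_sum /=.
transitivity (\sum_(j < m.+1)
    (qpow (j%:R * (lam - L + (2 * m)%:R - j%:R))
       * qpoch (- lam + L - (2 * m)%:R + j%:R + 1) (m - j)) *
     ((j == i :> nat)%:R * ((p + j == m)%N%:R * \prod_(t < j) qnum (m%:R - t%:R)))).
  apply: eq_bigr => j _; rewrite lcoefE lcoefZ; congr (_ * _).
  by rewrite (@lcoef_tens R nat nat) lcoef_bas lcoef_iter_dvermaE.
rewrite /hw_coef; case: (ltnP m i) => [mi|im].
  rewrite big1 => [|j _]; first by rewrite gtn_eqF ?mul0r // ltn_addr.
  have /ltn_eqF -> : (j < i)%N by apply: leq_ltn_trans mi; rewrite -ltnS.
  by rewrite mul0r mulr0.
rewrite (bigD1 (Ordinal (im : (i < m.+1)%N))) //= [X in _ + X]big1 => [|j /eqP ji]; last first.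
  rewrite (_ : (j == i :> nat) = false) ?mul0r ?mulr0 //.
  by apply/negbTE/eqP => ij; apply: ji; apply: val_inj.
rewrite addr0 eqxx mul1r [(p + i)%N]addnC; case: eqP => [<-|_]; last by rewrite !mul0r mulr0.
rewrite !mul1r addKn; congr (_ * qpoch _ _ * _); ring.
Qed.

(** The coefficient of v^{(i)} (x) u_p in Phi_m^L(lam) v^{(k)}, with
    kap = lam - L + 2m. *)
Definition Phi_coef (L kap : C) (m k i p : nat) : C :=
  (qfact k)^-1 * iter k (tensF_coef L) (hw_coef kap m) i p.

Lemma eq_cF L t t' : (forall i p, t i p = t' i p) -> forall i p, tensF_coef L t i p = tensF_coef L t' i p.
Proof. by move=> tt' [|i] [|p]; rewrite /tensF_coef ?tt'. Qed.

Lemma lcoef_PhiZ L m lam (c : C) (k i p : nat) :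
  lcoef (Phi eta L m lam (c *: bas R k)) (i, p) = c * Phi_coef L (lam - L + (2 * m)%:R) m k i p.
Proof.
rewrite (@lcoef_lin_extZ R nat) lcoefZ; congr (_ * (_ * _)).
elim: k i p => [|k IH] i p; first exact: lcoef_Phi_hw.
by rewrite !iterS; apply: etrans (lcoef_tensF _ _ _ _ _) _; exact: eq_cF.
Qed.

End Intertwiners.

(** * Singular vectors and the reducible Verma modules *)

Section SingularVectors.
Variables (R : realType) (eta : Cx R).
Hypothesis eta_gt0 : 0 < 'Im eta.
Local Notation C := (Cx R).
Local Notation qpow := (qpow eta).
Local Notation qnum := (qnum eta).
Local Notation qpoch := (qpoch eta).
Local Notation qfact := (qfact eta).
Local Notation cF := (tensF_coef eta).
Local Notation hwc := (hw_coef eta).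

Lemma qpoch0 x : qpoch x 0 = 1.
Proof. exact: big_ord0. Qed.
Lemma qpoch1 x : qpoch x 1 = qnum x.
Proof. by rewrite /Defs.qpoch big_ord_recl big_ord0 mulr1 addr0. Qed.

(** The action of E on M_{kap-1} (x) M_L^*, on coefficients. *)
Definition cE (kap : C) (t : nat -> nat -> C) (i p : nat) : C :=
  qnum (kap - 1 - i%:R) * t i.+1 p
  + qpow (kap - 1 - (2 * i)%:R) * qnum p.+1%:R * t i p.+1.

(** The relation for [E, F], where kap - 1 + L - 2(i + p) is the weight of
    v^{(i)} (x) u_p. *)
Lemma cE_cF (kap L : C) t (i p : nat) :
  cE kap (cF L t) i p = cF L (cE kap t) i p + qnum (kap - 1 + L - (2 * (i + p))%:R) * t i p.
Proof.
have q2 k : (2 * k)%:R = 2 * k%:R :> C by rewrite natrM.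
have -> : qnum (kap - 1 + L - (2 * (i + p))%:R) =
  qpow (- (L - (2 * p)%:R)) * (qnum i.+1%:R * qnum (kap - 1 - i%:R) - qnum i%:R * qnum (kap - i%:R))
  + qpow (kap - 1 - (2 * i)%:R) * (qnum p.+1%:R * qnum (L - p%:R) - qnum p%:R * qnum (L - p%:R + 1)).
  have -> : kap - 1 + L - (2 * (i + p))%:R = kap - 1 - (2 * i)%:R + (L - (2 * p)%:R).
    by rewrite mulnDr natrD; ring.
  rewrite -qnum_split; congr (_ * _ + _ * _).
    rewrite natrM -(qnum_shift eta_gt0 i%:R (kap - 1)) natr1.
    by congr (_ - _ * qnum _); ring.
  by rewrite natrM -(qnum_shift eta_gt0) natr1.
(* the two orders of applying q^h (x) E and F (x) q^{-h} give the same power of q *)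
have key i' p' : qpow (kap - 1 - (2 * i'.+1)%:R) * qpow (- (L - (2 * p'.+1)%:R)) =
    qpow (kap - 1 - (2 * i')%:R) * qpow (- (L - (2 * p')%:R)).
  by rewrite -!qpowD; congr qpow; rewrite !mulnS !natrD; ring.
have eL p' : L - p'.+1%:R + 1 = L - p'%:R by rewrite -natr1; ring.
have ek i' : kap - i'.+1%:R = kap - 1 - i'%:R by rewrite -natr1; ring.
rewrite /cE /tensF_coef; case: i => [|i]; case: p => [|p]; rewrite ?qnum0 ?eL ?ek.
- by move: (Defs.qnum eta) (Defs.qpow eta) => qn qp; ring.
- by move: (Defs.qnum eta) (Defs.qpow eta) => qn qp; ring.
- have {}key := key i 0%N; move: (Defs.qnum eta) (Defs.qpow eta) key => qn qp key.
  apply/eqP; rewrite -subr_eq0; apply/eqP.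
  transitivity ((qp (kap - 1 - (2 * i.+1)%:R) * qp (- (L - (2 * 1)%:R)) -
    qp (kap - 1 - (2 * i)%:R) * qp (- (L - (2 * 0)%:R))) * (qn 1 * qn i.+1%:R * t i 1%N)).
    by ring.
  by rewrite key subrr mul0r.
have {}key := key i p.+1; move: (Defs.qnum eta) (Defs.qpow eta) key => qn qp key.
apply/eqP; rewrite -subr_eq0; apply/eqP.
transitivity ((qp (kap - 1 - (2 * i.+1)%:R) * qp (- (L - (2 * p.+2)%:R)) -
    qp (kap - 1 - (2 * i)%:R) * qp (- (L - (2 * p.+1)%:R))) * (qn p.+2%:R * qn i.+1%:R * t i p.+2)).
  by ring.
by rewrite key subrr mul0r.
Qed.

Lemma cFZ (L c : C) t i p : cF L (fun i p => c * t i p) i p = c * cF L t i p.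
Proof. by rewrite /tensF_coef; case: i => [|i]; case: p => [|p]; ring. Qed.

Lemma cF_wt (N : nat) L t : (forall i p, (i + p)%N != N -> t i p = 0) ->
  forall i p, (i + p)%N != N.+1 -> cF L t i p = 0.
Proof.
move=> t0 i p ne; rewrite /tensF_coef.
have tz i' p' : (i' + p').+1 = (i + p)%N -> t i' p' = 0.
  by move=> e; apply: t0; apply: contraNneq ne => <-; rewrite e.
case: i p {ne} tz => [|i] [|p] tz; rewrite ?addr0 ?add0r // !tz ?mulr0 ?addr0 //; lia.
Qed.

(** The commutator of E with a power of F on a singular vector of weight mu:
    each of the k + 1 factors F contributes [mu - 2j]. *)
Lemma cE_iter_cF (N : nat) (mu kap L : C) t :
  (forall i p, (i + p)%N != N -> t i p = 0) ->
  (forall i p, cE kap t i p = 0) -> mu = kap - 1 + L - (2 * N)%:R ->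
  forall k i p, cE kap (iter k.+1 (cF L) t) i p =
    (\sum_(j < k.+1) qnum (mu - (2 * j)%:R)) * iter k (cF L) t i p.
Proof.
move=> tN t0 mE.
have wt k : forall i p, (i + p)%N != (N + k)%N -> iter k (cF L) t i p = 0.
  by elim: k => [|k IH]; rewrite ?addn0 // addnS => i p; exact: cF_wt.
have H k i p : qnum (kap - 1 + L - (2 * (i + p))%:R) * iter k (cF L) t i p
  = qnum (mu - (2 * k)%:R) * iter k (cF L) t i p.
  case: (eqVneq (i + p)%N (N + k)%N) => [->|/wt ->]; last by rewrite !mulr0.
  by congr (qnum _ * _); rewrite mE mulnDr natrD; ring.
elim=> [|k IH] i p.
  rewrite iterS cE_cF H big_ord_recr big_ord0 /= add0r.
  rewrite (@eq_cF _ _ _ _ (fun _ _ => 0 * 0)) => [|i' p']; last by rewrite t0 mul0r.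
  by rewrite cFZ mul0r add0r.
rewrite iterS cE_cF H [in RHS]big_ord_recr /= mulrDl; congr (_ + _).
by rewrite (eq_cF eta L IH) cFZ.
Qed.

(** The reversal j -> d - 1 - j changes the sign of every term.  By
    [cE_iter_cF] this makes F^d t singular for t singular of weight d - 1. *)
Lemma sum_qnum_antisym d : \sum_(j < d) qnum (d%:R - 1 - (2 * j)%:R) = 0.
Proof.
set S := \sum_(j < d) _.
have SN : S = - S.
  rewrite {1}/S (reindex_inj rev_ord_inj) /= /S -sumrN; apply: eq_bigr => j _.
  rewrite -qnumN; congr qnum.
  by rewrite natrM natrB ?ltn_ord // -natr1 natrM; ring.
have /eqP : S *+ 2 = 0 by rewrite mulr2n {1}SN addNr.
by rewrite mulrn_eq0 => /eqP.
Qed.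

(** The equation E t = 0 expresses the coefficient of v^{(i)} (x) u_{p+1} through the
    one of v^{(i+1)} (x) u_p, so that a singular vector is determined by its
    leading coefficient, the one with p = 0. *)
Lemma cE_inj kap (N : nat) t :
  (forall i p, (i + p)%N != N -> t i p = 0) -> (forall i p, cE kap t i p = 0) ->
  t N 0%N = 0 -> forall i p, t i p = 0.
Proof.
move=> tN tE t0.
have H p : forall i, (i + p)%N = N -> t i p = 0.
  elim: p => [|p IH] i; first by rewrite addn0 => ->.
  move=> ipN; have := tE i p; rewrite /cE IH ?addSnnS // mulr0 add0r => /eqP.
  by rewrite 2!mulf_eq0 (negbTE (qpow_neq0 _ _)) (negbTE (qnum_nat_neq0 eta_gt0 _)) => /eqP.
by move=> i p; case: (eqVneq (i + p)%N N) => [/H|/tN].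
Qed.

Lemma hwc_wt kap m i p : (i + p)%N != m -> hwc kap m i p = 0.
Proof. by rewrite /hw_coef => /negbTE ->; rewrite mul0r. Qed.

Lemma cE_hwc kap m i p : cE kap (hwc kap m) i p = 0.
Proof.
rewrite /cE /hw_coef addnS addSn; case: eqP => [<-|_]; last by rewrite !mul0r !mulr0 addr0.
rewrite !mul1r big_ord_recr /=.
have -> : qnum ((i + p).+1%:R - i%:R) = qnum p.+1%:R.
  by congr qnum; rewrite -addSn -natr1 natrD -natr1; ring.
have -> : qpoch (- kap + i%:R + 1) p.+1 = - qnum (kap - 1 - i%:R) * qpoch (- kap + i.+1%:R + 1) p.
  rewrite qpochS -qnumN -natr1 addrA; congr (qnum _ * _); ring.
have -> : qpow (i.+1%:R * (kap - i.+1%:R)) = qpow (kap - 1 - (2 * i)%:R) * qpow (i%:R * (kap - i%:R)).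
  by rewrite -qpowD; congr qpow; rewrite natrM -natr1; ring.
by ring.
Qed.

Lemma falling_qnum (a d : nat) :
  \prod_(t < d) qnum ((a + d)%:R - t%:R) = qpoch (a%:R + 1) d.
Proof.
rewrite /Defs.qpoch (reindex_inj rev_ord_inj) /=; apply: eq_bigr => t _; congr qnum.
by rewrite natrB ?ltn_ord // natrD -natr1; ring.
Qed.

Lemma falling_qnumD (a d : nat) :
  \prod_(t < a + d) qnum ((a + d)%:R - t%:R) =
    qpoch (a%:R + 1) d * \prod_(t < a) qnum (a%:R - t%:R).
Proof.
rewrite -falling_qnum addnC big_split_ord /=; congr (_ * _); apply: eq_bigr => t _ //.
by congr qnum; rewrite !natrD; ring.
Qed.

(** Only F (x) q^{-h} contributes to the leading coefficient. *)
Lemma iter_cF_edge (L : C) t (i k : nat) :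
  iter k (cF L) t (i + k)%N 0%N = qpoch (i%:R + 1) k * qpow (- (L * k%:R)) * t i 0%N.
Proof.
elim: k => [|k IH]; first by rewrite addn0 mulr0 oppr0 qpow0 qpoch0 !mul1r.
have -> : qpow (- (L * k.+1%:R)) = qpow (- (L * k%:R)) * qpow (- L).
  by rewrite -qpowD -natr1; congr qpow; ring.
rewrite addnS iterS /tensF_coef addr0 IH muln0 subr0 -[in RHS]addn1 qpochD.
rewrite qpoch1.
have -> : qnum (i + k).+1%:R = qnum (i%:R + 1 + k%:R) by congr qnum; rewrite -natr1 natrD; ring.
ring.
Qed.

(** The condition on L says that the vector on the right has weight -d - 1 and the
    one defining Phi_{m-d} weight d - 1.  Both sides are then singular, and their
    leading coefficients agree. *)
Lemma iter_cF_hwc (L kap : C) (d m i p : nat) : (d <= m)%N -> L = (2 * m)%:R - d%:R - kap ->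
  iter d (cF L) (hwc kap (m - d)) i p = hwc kap m i p.
Proof.
move=> dm LE; apply/eqP; rewrite -subr_eq0; apply/eqP.
have [a mE] : exists a, m = (a + d)%N by exists (m - d)%N; rewrite subnK.
rewrite {}mE addnK in LE *.
(* the difference of the two sides is singular with leading coefficient 0 *)
pose t i p := iter d (cF L) (hwc kap a) i p - hwc kap (a + d) i p.
apply: (@cE_inj kap (a + d)%N t) => {i p} [i p ne|i p|]; rewrite /t.
- rewrite hwc_wt // subr0.
  elim: d i p ne {t dm LE} => [|d IH] i p ne; first by apply: hwc_wt; rewrite -(addn0 a).
  by apply: (cF_wt (N := (a + d)%N)); rewrite // -addnS.
- have -> : cE kap (fun i p => iter d (cF L) (hwc kap a) i p - hwc kap (a + d) i p) i p
    = cE kap (iter d (cF L) (hwc kap a)) i p - cE kap (hwc kap (a + d)) i p.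
    by rewrite /cE; ring.
  rewrite cE_hwc subr0; case: d LE {dm t} => [|d] LE; first exact: cE_hwc.
  rewrite (@cE_iter_cF a (d.+1%:R - 1)) ?sum_qnum_antisym ?mul0r //.
  - exact: hwc_wt.
  - exact: cE_hwc.
  by rewrite LE !natrM natrD; ring.
rewrite iter_cF_edge /hw_coef !addn0 !eqxx !mul1r falling_qnumD.
rewrite !qpoch0.
have -> : qpow ((a + d)%:R * (kap - (a + d)%:R)) =
  qpow (- (L * d%:R)) * qpow (a%:R * (kap - a%:R)).
  by rewrite -qpowD; congr qpow; rewrite LE !natrM !natrD; ring.
by ring.
Qed.

(** The inclusion of M_{-d-1} in M_{d-1} that maps v^{(k)} to F^d v^{(k)}, that is to
    [k+1]_d v^{(k+d)}, applied to the first tensor factor. *)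
Definition shiftF (d : nat) (t : nat -> nat -> C) (i p : nat) : C :=
  if (i < d)%N then 0 else qpoch ((i - d)%:R + 1) d * t (i - d)%N p.

(** For i < d the factor [-d+i+1]_p contains [0], since d - i - 1 < p. *)
Lemma hwc_shift (d m i p : nat) : (d <= m)%N ->
  hwc d%:R m i p = shiftF d (hwc (- d%:R) (m - d)) i p.
Proof.
move=> dm; rewrite /shiftF; case: ltnP => [id|di].
  rewrite /hw_coef; case: eqP => [ipm|]; last by rewrite mul0r.
  (* the factor of [-d+i+1]_p at d - i - 1 is [0] *)
  have lp : (d - i.+1 < p)%N by lia.
  rewrite [qpoch _ p](bigD1 (Ordinal lp)) //= natrB //.
  have -> : - d%:R + i%:R + 1 + (d%:R - i.+1%:R) = 0 :> C by rewrite -natr1; ring.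
  by rewrite qnum0 !(mul0r, mulr0).
have [j ->] : exists j, i = (j + d)%N by exists (i - d)%N; rewrite subnK.
rewrite addnK /hw_coef.
have -> : (j + p == m - d)%N = (j + d + p == m)%N by apply/eqP/eqP; lia.
case: eqP => [jdpm|_]; last by rewrite !mul0r mulr0.
rewrite !mul1r -jdpm.
have -> : (j + d + p - d)%N = (j + p)%N by lia.
have -> : qpow ((j + d)%:R * (d%:R - (j + d)%:R)) = qpow (j%:R * (- d%:R - j%:R)).
  by congr qpow; rewrite natrD; ring.
have -> : \prod_(t < j + d) qnum ((j + d + p)%:R - t%:R) =
    qpoch ((j + p)%:R + 1) d * \prod_(t < j) qnum ((j + p)%:R - t%:R).
  rewrite -falling_qnum addnC big_split_ord /=; congr (_ * _).
    by have -> : (d + j + p = j + p + d)%N by lia.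
  by apply: eq_bigr => t _; congr qnum; rewrite !natrD; ring.
have -> : - d%:R + (j + d)%:R + 1 = j%:R + 1 :> C by rewrite natrD; ring.
have -> : - - d%:R + j%:R + 1 = j%:R + 1 + d%:R :> C by ring.
have E : qpoch (j%:R + 1) p * qpoch ((j + p)%:R + 1) d = qpoch (j%:R + 1) d * qpoch (j%:R + 1 + d%:R) p.
  have -> : (j + p)%:R + 1 = j%:R + 1 + p%:R :> C by rewrite natrD; ring.
  by rewrite -2!qpochD addnC.
transitivity (qpow (j%:R * (- d%:R - j%:R)) * (qpoch (j%:R + 1) p * qpoch ((j + p)%:R + 1) d)
  * \prod_(t < j) qnum ((j + p)%:R - t%:R)); first by ring.
by rewrite E; ring.
Qed.

Lemma cF_shiftF (L : C) (d : nat) t (i p : nat) : cF L (shiftF d t) i p = shiftF d (cF L t) i p.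
Proof.
rewrite /shiftF /tensF_coef; case: ltnP => [id|di].
  case: i id => [|i] id; last rewrite (ltnW id) mulr0.
    by case: p => [|p]; rewrite ?mulr0 add0r.
  by case: p => [|p]; rewrite ?mulr0 addr0.
have [j ->] : exists j, i = (j + d)%N by exists (i - d)%N; rewrite subnK.
rewrite addnK mulrDr; congr (_ + _); last by case: p => [|p]; rewrite ?mulr0 //; ring.
case: j => [|j]; first by case: d {di} => [|d]; rewrite ?add0n ?leqnn ?mulr0.
rewrite addSn ltnNge leq_addl /= addnK.
have E : qpoch (j%:R + 1) d * qnum (j + d).+1%:R = qnum j.+1%:R * qpoch (j.+1%:R + 1) d.
  have := qpochD eta (j%:R + 1) d 1; rewrite addn1 qpochS natr1.
  rewrite qpoch1 => ->.
  by congr (_ * qnum _); rewrite -!natr1 natrD; ring.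
transitivity (qpoch (j%:R + 1) d * qnum (j + d).+1%:R * (qpow (- (L - (2 * p)%:R)) * t j p)).
  by ring.
by rewrite E; ring.
Qed.

(** An intertwiner with target M_{d-1} takes its values in the submodule M_{-d-1}. *)
Lemma phic_shift (L : C) (d m k i p : nat) : (d <= m)%N ->
  Phi_coef eta L d%:R m k i p = shiftF d (Phi_coef eta L (- d%:R) (m - d) k) i p.
Proof.
move=> dm; rewrite /Phi_coef.
have -> : iter k (cF L) (hwc d%:R m) i p = shiftF d (iter k (cF L) (hwc (- d%:R) (m - d))) i p.
  elim: k i p => [|k IH] i p; first exact: hwc_shift.
  by rewrite !iterS -cF_shiftF; exact: eq_cF.
by rewrite /shiftF; case: ifP => _; rewrite ?mulr0 //; ring.
Qed.

Lemma qfactD k d : qfact (k + d) = qfact k * qpoch (k%:R + 1) d.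
Proof.
elim: d => [|d IH]; first by rewrite addn0 qpoch0 mulr1.
rewrite addnS qfactS IH -[in RHS]addn1 qpochD mulrA; congr (_ * _).
rewrite qpoch1; congr qnum.
by rewrite -natr1 natrD; ring.
Qed.

Lemma qpoch_nat_neq0 (k d : nat) : qpoch (k%:R + 1) d != 0.
Proof.
apply/prodf_neq0 => i _; rewrite natr1 -natrD addSn; exact: qnum_nat_neq0.
Qed.

(** The restriction of an intertwiner from M_{d-1} to the submodule M_{-d-1}: here
    lam = d for the index m - d and lam = -d for the index m, with the same kap. *)
Lemma phic_lower (L kap : C) (d m k i p : nat) : (d <= m)%N -> L = (2 * m)%:R - d%:R - kap ->
  qpoch (k%:R + 1) d * Phi_coef eta L kap (m - d) (k + d) i p = Phi_coef eta L kap m k i p.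
Proof.
move=> dm LE; rewrite /Phi_coef iterD qfactD invfM mulrA mulrCA.
rewrite mulfV ?qpoch_nat_neq0 // mulr1; congr (_ * _).
elim: k i p => [|k IH] i p; first exact: iter_cF_hwc.
by rewrite !iterS; exact: eq_cF.
Qed.

End SingularVectors.

(** * Matrix elements of composed intertwiners *)

Section ComposedIntertwiners.
Variables (R : realType) (eta : Cx R).
Hypothesis eta_gt0 : 0 < 'Im eta.
Local Notation C := (Cx R).
Local Notation phic := (Phi_coef eta).

(** An intertwiner preserves weights; in particular the sum over the intermediate
    basis in a composition has at most one nonzero term. *)
Lemma phic_wt (L kap : C) (m k i p : nat) : (i + p)%N != (k + m)%N -> phic L kap m k i p = 0.
Proof.
move=> ne; rewrite /Phi_coef; apply/eqP; rewrite mulf_eq0; apply/orP; right; apply/eqP.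
elim: k i p ne => [|k IH] i p ne; first exact: hwc_wt.
by rewrite iterS; apply: (@cF_wt _ _ eta_gt0 (k + m)%N).
Qed.

(** The coefficient of v^{(k')} (x) u_w in the image of v^{(k)}.  By conservation of
    weights, after the last factor the index of the Verma module is k + m_n - w_n. *)
Fixpoint mPhi_coef (n : nat) :
    n.-tuple C -> n.-tuple nat -> C -> nat -> nat -> n.-tuple nat -> C :=
  match n return n.-tuple C -> n.-tuple nat -> C -> nat -> nat -> n.-tuple nat -> C with
  | 0 => fun _ _ _ k k' _ => (k == k')%:R
  | n'.+1 => fun L m lam k k' w =>
      let mn := tnth m ord_max in
      let p := tnth w ord_max in
      let kap := lam - tnth L ord_max + (2 * mn)%:R in
      if (p <= k + mn)%N then
        phic (tnth L ord_max) kap mn k (k + mn - p)%N p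
        * mPhi_coef (tinit L) (tinit m) kap (k + mn - p)%N k' (tinit w)
      else 0
  end.

Lemma cPhiS n (L : n.+1.-tuple C) (m : n.+1.-tuple nat) (lam : C) k k' w :
  mPhi_coef L m lam k k' w =
  let mn := tnth m ord_max in
  let kap := lam - tnth L ord_max + (2 * mn)%:R in
  if (tnth w ord_max <= k + mn)%N then
    phic (tnth L ord_max) kap mn k (k + mn - tnth w ord_max)%N (tnth w ord_max)
    * mPhi_coef (tinit L) (tinit m) kap (k + mn - tnth w ord_max)%N k' (tinit w)
  else 0.
Proof. by []. Qed.

Lemma cPhi0 (L : 0.-tuple C) m (lam : C) k k' w : mPhi_coef L m lam k k' w = (k == k')%:R.
Proof. by []. Qed.

Lemma tnth_tinit (T : Type) n (t : n.+1.-tuple T) i :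
  tnth (tinit t) i = tnth t (widen_ord (leqnSn n) i).
Proof. by rewrite tnth_mktuple. Qed.

Lemma tnth_rcons n (w : n.-tuple nat) p (i : 'I_n.+1) :
  tnth [tuple of rcons w p] i = if (i < n)%N then nth 0%N w i else p.
Proof.
rewrite (tnth_nth 0%N) /= nth_rcons size_tuple; case: ltnP => // ni.
by rewrite eqn_leq ni -ltnS ltn_ord.
Qed.

Lemma rcons_tinit n (w : n.+1.-tuple nat) :
  [tuple of rcons (tinit w) (tnth w ord_max)] = w.
Proof.
apply: eq_from_tnth => i; rewrite tnth_rcons; case: ltnP => [lt|ge].
  rewrite -(tnth_nth 0%N (tinit w) (Ordinal lt)) tnth_tinit.
  by congr tnth; apply: val_inj.
congr tnth; apply: val_inj; apply/eqP.
by rewrite eqn_leq ge -ltnS ltn_ord.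
Qed.

Lemma tinit_rcons n (w : n.-tuple nat) p : tinit [tuple of rcons w p] = w.
Proof.
apply: eq_from_tnth => i; rewrite tnth_tinit !(tnth_nth 0%N) /= nth_rcons size_tuple.
by rewrite ltn_ord.
Qed.

Lemma last_rcons n (w : n.-tuple nat) p : tnth [tuple of rcons w p] ord_max = p.
Proof. by rewrite (tnth_nth 0%N) /= nth_rcons size_tuple ltnn eqxx. Qed.

Lemma lcoef_append n (T : {malg C[((nat * n.-tuple nat) * nat)%type]}) (k : nat) (w : n.+1.-tuple nat) :
  lcoef (lin_ext (fun p : (nat * n.-tuple nat) * nat =>
          bas R (p.1.1, [tuple of rcons p.1.2 p.2])) T) (k, w)
  = lcoef T ((k, tinit w), tnth w ord_max).
Proof.
apply: etrans (lcoef_lin_ext _ _ _) _.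
rewrite (msum_single (i0 := ((k, tinit w), tnth w ord_max))) => [|[[k1 w1] p1] ne].
  by rewrite lcoef_bas /= rcons_tinit eqxx mulr1.
rewrite lcoef_bas; case: eqP => [[kE wE]|]; last by rewrite mulr0.
case/eqP: ne; rewrite -kE; congr (_, _, _).
  by rewrite -wE tinit_rcons.
by rewrite -wE last_rcons.
Qed.

Lemma lcoef_mPhiZ n (L : n.-tuple C) m lam (c : C) (k k' : nat) (w : n.-tuple nat) :
  lcoef (mPhi eta L m lam (c *: bas R k)) (k', w) = c * mPhi_coef L m lam k k' w.
Proof.
elim: n L m lam c k k' w => [|n IH] L m lam c k k' w.
  apply: etrans (lcoef_lin_extZ _ _ _ _) _; rewrite lcoef_bas /= xpair_eqE.
  have -> : [tuple] == w by apply/eqP; rewrite [RHS]tuple0.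
  by rewrite andbT.
apply: etrans (lcoef_append _ _ _) _.
apply: etrans (lcoef_tens_map _ _ _ _ _) _.
rewrite cPhiS /=; set mn := tnth m ord_max; set p := tnth w ord_max.
have bas1 (i : nat) : lcoef (mPhi eta (tinit L) (tinit m)
     (lam - tnth L ord_max + (2 * mn)%:R) (bas R i)) (k', tinit w) =
   mPhi_coef (tinit L) (tinit m) (lam - tnth L ord_max + (2 * mn)%:R) i k' (tinit w).
  by rewrite -[bas R i]scale1r IH mul1r.
case: leqP => kp.
  rewrite (msum_single (i0 := ((k + mn - p)%N, p))) => [|[i q] ne].
    by rewrite lcoef_PhiZ bas1 lcoef_bas eqxx mulr1 mulrA.
  rewrite lcoef_PhiZ lcoef_bas /=; case: (eqVneq q p) ne => [->|_ _]; last by rewrite !mulr0.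
  rewrite xpair_eqE eqxx andbT => ne; rewrite phic_wt ?mulr0 ?mul0r //.
  by apply: contraNneq ne; lia.
rewrite mulr0; apply: big1 => -[i q] _.
rewrite lcoef_PhiZ lcoef_bas /=; case: (eqVneq q p) => [->|_]; last by rewrite !mulr0.
by rewrite phic_wt ?mulr0 ?mul0r //; apply/eqP; lia.
Qed.

End ComposedIntertwiners.

Arguments mPhi_coef : simpl never.

(** * Composed intertwiners at the resonances *)

Section Resonance.
Variables (R : realType) (eta : Cx R).
Hypothesis eta_gt0 : 0 < 'Im eta.
Local Notation C := (Cx R).
Local Notation qpoch := (qpoch eta).
Local Notation cPhi := (mPhi_coef eta).

(** [phic_lower] for the factor that acts first, the last one. *)
Lemma cPhi_lower n (L : n.+1.-tuple C) (m m1 : n.+1.-tuple nat) (d k k' : nat) w :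
  (d <= tnth m ord_max)%N -> tnth m1 ord_max = (tnth m ord_max - d)%N -> tinit m1 = tinit m ->
  qpoch (k%:R + 1) d * cPhi L m1 d%:R (k + d) k' w = cPhi L m (- d%:R) k k' w.
Proof.
move=> dm m1E tE; rewrite !cPhiS /= m1E tE.
set mn := tnth m ord_max in dm *; set p := tnth w ord_max; set Ln := tnth L ord_max.
have -> : (k + d + (mn - d) = k + mn)%N by lia.
have -> : d%:R - Ln + (2 * (mn - d))%:R = - d%:R - Ln + (2 * mn)%:R.
  by rewrite !natrM natrB //; ring.
case: leqP => _; last by rewrite mulr0.
rewrite mulrA phic_lower //; ring.
Qed.

(** [phic_shift] for the factor that acts last, the first one; the hypothesis on lam
    says that the target of the whole composition is M_{d-1}. *)
Lemma cPhi_shift n (L : n.+1.-tuple C) (m m1 : n.+1.-tuple nat) (d : nat) (lam : C) (k k' : nat) w :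
  (forall i, tnth m1 i = (tnth m i + d * (i == ord0))%N) ->
  lam - \sum_(i < n.+1) (tnth L i - (2 * tnth m i)%:R) = - d%:R ->
  cPhi L m1 lam k k' w =
  if (k' < d)%N then 0 else qpoch ((k' - d)%:R + 1) d * cPhi L m lam k (k' - d) w.
Proof.
elim: n L m m1 lam k k' w => [|n IH] L m m1 lam k k' w m1E lamE.
  move: lamE; rewrite big_ord_recl big_ord0 addr0 => lamE.
  rewrite !cPhiS /= !cPhi0 m1E.
  rewrite (_ : ord_max = ord0 :> 'I_1) ?eqxx ?muln1; last by apply: val_inj.
  set mn := tnth m ord0 in lamE *; set Ln := tnth L ord0 in lamE *; set p := tnth w ord0.
  have -> : lam - Ln + (2 * (mn + d))%:R = d%:R.
    transitivity (lam - (Ln - (2 * mn)%:R) + (2 * d)%:R); first by rewrite !natrM natrD; ring.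
    by rewrite lamE natrM; ring.
  have -> : lam - Ln + (2 * mn)%:R = - d%:R by rewrite -lamE; ring.
  case: (leqP p (k + mn)) => pk.
    rewrite (_ : (p <= k + (mn + d))%N); last by lia.
    rewrite phic_shift ?leq_addl // addnK /shiftF.
    have -> : (k + (mn + d) - p < d)%N = false by lia.
    have -> : (k + (mn + d) - p - d = k + mn - p)%N by lia.
    case: ltnP => k'd.
      have -> : (k + (mn + d) - p == k')%N = false by lia.
      by rewrite mulr0.
    have -> : (k + (mn + d) - p == k')%N = (k + mn - p == k' - d)%N by lia.
    case: eqP => [->|_]; last by rewrite !mulr0.
    by rewrite mulrA.
  rewrite mulr0 if_same; case: ifP => // pk'.
  rewrite phic_shift ?leq_addl // /shiftF.
  have -> : (k + (mn + d) - p < d)%N by lia.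
  by rewrite mul0r.
have m1n : tnth m1 ord_max = tnth m ord_max by rewrite m1E muln0 addn0.
rewrite [LHS]cPhiS [cPhi L m lam k (k' - d) w]cPhiS /= m1n.
case: (leqP (tnth w ord_max)) => pk; last by rewrite mulr0 if_same.
rewrite (IH _ (tinit m)); first by case: ifP => _; rewrite ?mulr0 // mulrCA.
  by move=> i; rewrite !tnth_tinit m1E.
rewrite -lamE [in RHS]big_ord_recr /=.
have -> : \sum_(i < n.+1) (tnth (tinit L) i - (2 * tnth (tinit m) i)%:R) =
    \sum_(i < n.+1) (tnth L (widen_ord (leqnSn n.+1) i)
      - (2 * tnth m (widen_ord (leqnSn n.+1) i))%:R).
  by apply: eq_bigr => i _; rewrite !tnth_tinit.
by ring.
Qed.

(** Peeling off the last factors reduces this to the case where j + 1 is the last one.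
    Then [phic_shift] for the factor j + 1, which acts first, inserts the
    inclusion of M_{-d-1} in M_{d-1}, and [phic_lower] for the factor j removes it. *)
Lemma cPhi_exchange n (L : n.-tuple C) (m m1 : n.-tuple nat) (j d : nat) (lam : C) (k k' : nat) w :
  (j.+1 < n)%N -> 
  (forall i : 'I_n, tnth m1 i = (tnth m i - d * (i == j :> nat) + d * (i == j.+1 :> nat))%N) ->
  (forall i : 'I_n, i = j :> nat -> (d <= tnth m i)%N) ->
  lam = - d%:R + \sum_(i < n | (j < i)%N) (tnth L i - (2 * tnth m i)%:R) ->
  cPhi L m1 lam k k' w = cPhi L m lam k k' w.
Proof.
elim: n L m m1 lam k k' w => [|n IH] L m m1 lam k k' w // jn m1E dm lamE.
have jn2 : (j < n)%N by [].
have {}lamE : lam = - d%:R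
    + (\sum_(i < n | (j < i)%N) (tnth (tinit L) i - (2 * tnth (tinit m) i)%:R)
      + (tnth L ord_max - (2 * tnth m ord_max)%:R)).
  rewrite lamE; congr (_ + _); rewrite big_mkcond big_ord_recr /= jn2 -big_mkcond.
  by congr (_ + _); apply: eq_bigr => i _; rewrite !tnth_tinit.
case: (ltnP j.+1 n) => jn'.
  have m1n : tnth m1 ord_max = tnth m ord_max.
    by rewrite m1E /= !gtn_eqF ?muln0 ?subn0 ?addn0 // ltnW.
  rewrite [LHS]cPhiS [RHS]cPhiS /= m1n; case: leqP => pk //; congr (_ * _); apply: IH => //.
  - by move=> i; rewrite !tnth_tinit m1E.
  - by move=> i ij; rewrite tnth_tinit; apply: dm.
  by rewrite lamE; ring.
have jE : n = j.+1 by apply/eqP; rewrite eqn_leq jn' -ltnS jn.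
subst n.
rewrite big1 ?addr0 in lamE; last first.
  by move=> i; rewrite ltnNge -ltnS ltn_ord.
have m1n : tnth m1 ord_max = (tnth m ord_max + d)%N.
  by rewrite m1E /= eqxx gtn_eqF // muln0 subn0 muln1.
rewrite [LHS]cPhiS [RHS]cPhiS /= m1n; set mn := tnth m ord_max in lamE *; set Ln := tnth L ord_max in lamE *.
have -> : lam - Ln + (2 * (mn + d))%:R = d%:R by rewrite lamE !natrM natrD; ring.
have -> : lam - Ln + (2 * mn)%:R = - d%:R by rewrite lamE; ring.
set p := tnth w ord_max.
case: (leqP p (k + mn)) => pk; last first.
  case: ifP => // pk'; rewrite phic_shift ?leq_addl // /shiftF.
  have -> : (k + (mn + d) - p < d)%N by lia.
  by rewrite mul0r.
rewrite (_ : (p <= k + (mn + d))%N); last by lia.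
rewrite phic_shift ?leq_addl // addnK /shiftF.
have -> : (k + (mn + d) - p < d)%N = false by lia.
have -> : (k + (mn + d) - p - d = k + mn - p)%N by lia.
have -> : (k + (mn + d) - p = k + mn - p + d)%N by lia.
rewrite -(@cPhi_lower _ _ (tinit m) (tinit m1) d); first by rewrite mulrAC mulrA mulrC mulrA.
- by rewrite tnth_tinit; apply: dm.
- by rewrite !tnth_tinit m1E /= eqxx ltn_eqF // muln1 muln0 addn0.
apply: eq_from_tnth => i; rewrite !tnth_tinit m1E /= !ltn_eqF ?muln0 ?subn0 ?addn0 //.
by rewrite ltnW // ltnS ltn_ord.
Qed.

End Resonance.
(** * Limits of complex sequences *)

Import Normc.

Section ComplexConvergence.
Variable R : realType.
Local Notation C := (Cx R).

(** The modulus as an element of R; the norm on C has its values in C. *)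
Definition nm (z : C) : R := normc z.

Arguments nm : simpl never.

Lemma normE (z : C) : `|z| = (nm z)%:C%C.
Proof. by []. Qed.
Lemma nmM (x y : C) : nm (x * y) = nm x * nm y. Proof. exact: normcM. Qed.
Lemma nm_ge0 (x : C) : 0 <= nm x.
Proof. by rewrite -lecR -normE normr_ge0. Qed.
Lemma nm0 : nm 0 = 0. Proof. exact: normc0. Qed.
Lemma nm1 : nm 1 = 1. Proof. exact: normc1. Qed.
Lemma nmN (x : C) : nm (- x) = nm x. Proof. exact: normcN. Qed.
Lemma nmD (x y : C) : nm (x + y) <= nm x + nm y. Proof. exact: le_normcD. Qed.
Lemma nm_eq0 (x : C) : (nm x == 0) = (x == 0).
Proof. by apply/eqP/eqP => [/eq0_normc|->] //; rewrite nm0. Qed.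
Lemma nm_gt0 (x : C) : (0 < nm x) = (x != 0).
Proof. by rewrite lt_def nm_ge0 andbT nm_eq0. Qed.
Lemma nmX (x : C) n : nm (x ^+ n) = nm x ^+ n.
Proof. by elim: n => [|n IH]; rewrite ?expr0 ?nm1 // !exprS nmM IH. Qed.
Lemma nmV (x : C) : nm x^-1 = (nm x)^-1. Proof. exact: normcV. Qed.
Lemma nm_sum (I : Type) (r : seq I) (P : pred I) (F : I -> C) :
  nm (\sum_(i <- r | P i) F i) <= \sum_(i <- r | P i) nm (F i).
Proof.
elim/big_ind2: _ => //; first by rewrite nm0.
by move=> x1 x2 y1 y2 h1 h2; apply: le_trans (nmD _ _) _; apply: lerD.
Qed.
Lemma nm_nat n : nm n%:R = n%:R.
Proof. by apply: complexI; rewrite -normE normr_nat rmorph_nat. Qed.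
Lemma nmB (x y : C) : nm (x - y) = nm (y - x).
Proof. by rewrite -nmN opprB. Qed.
Lemma nm_real (x : R) : nm (x%:C%C : C) = `|x|.
Proof. by rewrite /nm /normc /= expr0n addr0 sqrtr_sqr. Qed.

Lemma Cx_pos (e : C) : 0 < e -> exists2 r : R, 0 < r & e = r%:C%C.
Proof.
move=> e0; exists (complex.Re e).
  by move: e0; rewrite ltcE /= => /andP[].
by rewrite [LHS]complexE ger0_Im ?ltW //; rewrite rmorph0 mulr0 addr0.
Qed.

Lemma cvgCP (u : nat -> C) (l : C) : u @ \oo --> l <->
  (forall e : R, 0 < e -> exists N, forall n, (N <= n)%N -> nm (u n - l) < e).
Proof.
split=> [/cvgrPdist_lt ul e e0|H].
  have e0' : 0 < (e%:C%C : C) by rewrite ltcR.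
  have [N _ HN] := ul _ e0'; exists N => n Nn; have := HN n Nn.
  by rewrite /= distrC normE ltcR.
apply/cvgrPdist_lt => e /Cx_pos[r r0 ->].
by have [N HN] := H r r0; exists N => // n /HN; rewrite distrC normE ltcR.
Qed.

Lemma nearCP (z0 : C) (P : C -> Prop) : (\forall z \near z0, P z) <->
  (exists2 r : R, 0 < r & forall z, nm (z - z0) < r -> P z).
Proof.
split=> [/nbhs_ballP[e /Cx_pos[r r0 ->] H]|[r r0 H]].
  by exists r => // z zr; apply: H; rewrite -ball_normE /= distrC normE ltcR.
apply/nbhs_ballP; exists (r%:C%C : C); first by rewrite /= ltcR.
by move=> z; rewrite -ball_normE /= distrC normE ltcR; exact: H.
Qed.

Lemma cvgC_real (u : nat -> R) (l : R) : u @ \oo --> l ->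
  (fun n => (u n)%:C%C : C) @ \oo --> (l%:C%C : C).
Proof.
move=> /cvgrPdist_lt ul; apply/cvgCP => e e0.
have [N _ HN] := ul e e0; exists N => n /HN; rewrite -(rmorphB (real_complex R)) nm_real distrC.
exact.
Qed.

Lemma cvgC_small (u : nat -> C) (v : nat -> R) :
  (forall n, nm (u n) <= v n) -> v @ \oo --> (0 : R) -> u @ \oo --> (0 : C).
Proof.
move=> uv /cvgrPdist_lt v0; apply/cvgCP => e e0.
have [N _ HN] := v0 e e0; exists N => n /HN /=; rewrite sub0r normrN subr0 => vn.
by apply: le_lt_trans (uv n) _; apply: le_lt_trans vn; exact: ler_norm.
Qed.

Lemma cvgC_unique (u : nat -> C) (l l' : C) : u @ \oo --> l -> u @ \oo --> l' -> l = l'.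
Proof. by move=> ul ul'; apply: (cvg_unique _ ul ul'). Qed.

Lemma cvgC_near (u v : nat -> C) (l : C) (N : nat) :
  (forall n, (N <= n)%N -> u n = v n) -> u @ \oo --> l -> v @ \oo --> l.
Proof.
move=> uv /cvgCP ul; apply/cvgCP => e e0; have [N' HN] := ul e e0.
exists (maxn N N') => n; rewrite geq_max => /andP[Nn N'n].
by rewrite -uv //; exact: HN.
Qed.

Lemma cvgC_shift (u : nat -> C) (l : C) (d : nat) :
  (fun n => u (n + d)%N) @ \oo --> l <-> u @ \oo --> l.
Proof.
split=> /cvgCP ul; apply/cvgCP => e e0; have [N HN] := ul e e0.
  exists (N + d)%N => n nd; have -> : n = (n - d + d)%N by lia.
  by apply: HN; lia.
by exists N => n Nn; apply: HN; lia.
Qed.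

Lemma cvgC_le (u : nat -> C) (l : C) (M : R) (N : nat) :
  (forall n, (N <= n)%N -> nm (u n) <= M) -> u @ \oo --> l -> nm l <= M.
Proof.
move=> uM /cvgCP ul; rewrite leNgt; apply/negP => Ml.
have [N' HN] := ul (nm l - M) ltac:(by rewrite subr_gt0).
have := HN (maxn N N') (leq_maxr _ _); have := uM _ (leq_maxl N N').
set x := u _ => xM xl.
have := nmD (l - x) x; rewrite subrK nmB => h; lra.
Qed.

Lemma cvgC_add (u v : nat -> C) (l l' : C) : u @ \oo --> l -> v @ \oo --> l' ->
  (fun n => u n + v n) @ \oo --> l + l'.
Proof. by move=> ul vl; exact: (@cvgD C C nat \oo _ u v l l' ul vl). Qed.

Lemma cvgC_cst (c : C) : (fun _ : nat => c) @ \oo --> c.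
Proof. exact: cvg_cst. Qed.

Lemma cvgC_sub (u v : nat -> C) (l l' : C) : u @ \oo --> l -> v @ \oo --> l' ->
  (fun n => u n - v n) @ \oo --> l - l'.
Proof. by move=> ul vl; exact: (@cvgB C C nat \oo _ u v l l' ul vl). Qed.

Lemma cvgC_mul (u v : nat -> C) (l l' : C) : u @ \oo --> l -> v @ \oo --> l' ->
  (fun n => u n * v n) @ \oo --> l * l'.
Proof. by move=> ul vl; exact: (@cvgM C nat \oo _ u v l l' ul vl). Qed.

Lemma cvgC_inv (u : nat -> C) (l : C) : l != 0 -> u @ \oo --> l ->
  (fun n => (u n)^-1) @ \oo --> l^-1.
Proof. by move=> l0 ul; exact: (@cvgV C nat \oo _ u l l0 ul). Qed.

Lemma cvgC_Zl (c : C) (u : nat -> C) (l : C) : u @ \oo --> l ->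
  (fun n => c * u n) @ \oo --> c * l.
Proof. by move=> ul; exact: (cvgC_mul (@cvgC_cst c) ul). Qed.

End ComplexConvergence.

Arguments cvgC_Zl {R} c [u l] _.
Arguments cvgC_cst {R} c.

(** * Power series *)

Section PowerSeries.
Variable R : realType.
Local Notation C := (Cx R).
Implicit Types (a b : nat -> C) (z w : C).

Definition psum a z (N : nat) : C := \sum_(k < N) a k * z ^+ k.
(** Cauchy estimates: a coefficient bound on the circle of radius rho.  All estimates
    on power series below are stated in this form, with unspecified smaller radii,
    since only germs matter. *)
Definition bnd a (rho M : R) := forall n, nm (a n) * rho ^+ n <= M.

Lemma psumS a z N : psum a z N.+1 = psum a z N + a N * z ^+ N.
Proof. exact: big_ord_recr. Qed.

Lemma bnd_ge0 a (rho M : R) : 0 < rho -> bnd a rho M -> 0 <= M.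
Proof. by move=> r0 /(_ 0%N); rewrite expr0 mulr1; apply: le_trans; exact: nm_ge0. Qed.

Lemma bnd_term a (rho M : R) z k : 0 < rho -> bnd a rho M ->
  nm (a k * z ^+ k) <= M * (nm z / rho) ^+ k.
Proof.
move=> r0 H; rewrite nmM nmX expr_div_n mulrA ler_pdivlMr ?exprn_gt0 //.
by rewrite mulrAC ler_wpM2r // exprn_ge0 // nm_ge0.
Qed.

(** Comparison with a geometric series of ratio at most 1/2. *)
Lemma psum_tail a (rho M : R) z (p N : nat) : 0 < rho -> bnd a rho M -> nm z <= rho / 2 -> (p <= N)%N ->
  nm (psum a z N - psum a z p) <= 2 * M * (nm z / rho) ^+ p.
Proof.
move=> r0 H zr pN; have M0 := bnd_ge0 r0 H.
set th := nm z / rho.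
have th0 : 0 <= th by rewrite divr_ge0 ?nm_ge0 // ltW.
have th2 : th <= 1 / 2 by rewrite ler_pdivrMr //; lra.
have K : nm (psum a z N - psum a z p) <= 2 * M * (th ^+ p - th ^+ N).
  elim: N pN => [|N IH].
    by rewrite leqn0 => /eqP ->; rewrite !subrr nm0 mulr0.
  rewrite leq_eqVlt => /predU1P[->|]; first by rewrite !subrr nm0 mulr0.
  rewrite ltnS => /IH {}IH; rewrite psumS addrAC.
  apply: le_trans (nmD _ _) _.
  have := bnd_term z N r0 H; rewrite -/th => T.
  have : M * th ^+ N * th <= M * th ^+ N * (1 / 2).
    by rewrite ler_wpM2l // mulr_ge0 // exprn_ge0.
  rewrite exprS; set A := th ^+ N in IH T *; set B := th ^+ p in IH *; nra.
apply: le_trans K _; rewrite ler_wpM2l ?mulr_ge0 //.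
by rewrite gerBl exprn_ge0.
Qed.

Lemma psum_tail_lim a (rho M : R) z p (l : C) : 0 < rho -> bnd a rho M -> nm z <= rho / 2 ->
  psum a z @ \oo --> l -> nm (l - psum a z p) <= 2 * M * (nm z / rho) ^+ p.
Proof.
move=> r0 H zr ul; apply: (cvgC_le (u := fun n => psum a z n - psum a z p) (N := p)).
  by move=> n pn; exact: psum_tail.
exact: (cvgC_sub ul (@cvgC_cst _ _)).
Qed.

(** The terms of a convergent series are bounded. *)
Lemma cvg_bnd a z (l : C) : z != 0 -> psum a z @ \oo --> l -> exists M, bnd a (nm z) M.
Proof.
move=> z0 /cvgCP /(_ 1 ltr01)[N HN].
exists (2 + \sum_(k < N) nm (a k * z ^+ k)) => n; rewrite -nmX -nmM.
have S0 : 0 <= \sum_(k < N) nm (a k * z ^+ k) by apply: sumr_ge0 => i _; exact: nm_ge0.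
case: (ltnP n N) => nN.
  rewrite (bigD1 (Ordinal nN)) //=.
  have : 0 <= \sum_(i < N | i != Ordinal nN) nm (a i * z ^+ i).
    by apply: sumr_ge0 => i _; exact: nm_ge0.
  lra.
have h1 := HN n nN; have h2 := HN n.+1 (leqW nN).
have : nm (a n * z ^+ n) <= nm (psum a z n.+1 - l) + nm (psum a z n - l).
  rewrite [in X in _ <= _ + X]nmB; apply: le_trans (nmD _ _); rewrite psumS.
  by rewrite (_ : _ + _ = a n * z ^+ n) //; ring.
lra.
Qed.

Definition cauchy_prod a b (n : nat) : C := \sum_(i < n.+1) a i * b (n - i)%N.

(** The product of two truncated series is a polynomial, and what its truncation
    leaves over has degrees from N to 2N - 1. *)
Lemma psum_mul a b z N : psum a z N * psum b z N - psum (cauchy_prod a b) z N =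
  \sum_(N <= k < N + N) (\sum_(i < k.+1 | (i < N)%N && (k - i < N)%N) a i * b (k - i)%N) * z ^+ k.
Proof.
pose A := \poly_(k < N) a k; pose B := \poly_(k < N) b k.
have AE : A.[z] = psum a z N by rewrite horner_poly.
have BE : B.[z] = psum b z N by rewrite horner_poly.
have cE k : (A * B)`_k = \sum_(i < k.+1 | (i < N)%N && (k - i < N)%N) a i * b (k - i)%N.
  rewrite coefM [RHS]big_mkcond; apply: eq_bigr => i _; rewrite !coef_poly.
  by case: (i < N)%N; case: (k - i < N)%N; rewrite ?mul0r ?mulr0.
have -> : psum a z N * psum b z N = \sum_(0 <= k < N + N) (A * B)`_k * z ^+ k.
  rewrite -AE -BE -hornerM (@horner_coef_wide _ (N + N)) ?big_mkord //.
  apply: leq_trans (size_polyMleq _ _) _; apply: leq_trans (leq_pred _) _.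
  by apply: leq_add; exact: size_poly.
have -> : psum (cauchy_prod a b) z N = \sum_(0 <= k < N) (A * B)`_k * z ^+ k.
  rewrite big_mkord; apply: eq_bigr => k _; congr (_ * _).
  rewrite cE /cauchy_prod [in RHS]big_mkcond; apply: eq_bigr => i _.
  have iN : (i < N)%N by apply: leq_ltn_trans (ltn_ord k); rewrite -ltnS ltn_ord.
  by rewrite iN (leq_ltn_trans (leq_subr _ _) (ltn_ord k)).
rewrite (big_cat_nat (leq0n N) (leq_addr N N)) /= addrAC subrr add0r.
by apply: eq_bigr => k _; rewrite cE.
Qed.

(** Here n^2 <= 4^n absorbs the number of terms left over in [psum_mul]. *)
Lemma geom_small (K : R) : (fun n => K * (n%:R * n%:R * (16^-1) ^+ n)) @ \oo --> (0 : R).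
Proof.
have /cvgrPdist_lt G : geometric `|K| (4^-1) @ \oo --> (0 : R).
  by apply: cvg_geometric; rewrite ger0_norm ?invr_ge0 // invf_lt1 // ltr1n.
apply/cvgrPdist_lt => e /G; apply: filterS => n; rewrite !sub0r !normrN => h.
apply: le_lt_trans h; rewrite /geometric /= !normrM normr_id ler_wpM2l //.
rewrite !ger0_norm ?exprn_ge0 ?invr_ge0 //.
have -> : (16^-1 : R) = 4^-1 * 4^-1 by rewrite -invfM -natrM.
rewrite exprMn mulrA ler_piMl ?exprn_ge0 ?invr_ge0 // exprVn ler_pdivrMr ?exprn_gt0 //.
rewrite mul1r -natrM -natrX ler_nat (_ : 4 = 2 * 2)%N // expnMn.
by apply: leq_mul; apply: ltnW; exact: ltn_expl.
Qed.

(** On the circle of radius rho/16 each term left over in [psum_mul] is at most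
    M^2 / 16^N, and there are at most 2 N^2 of them. *)
Lemma cauchy_prod_small a b (rho M : R) z : 0 < rho -> bnd a rho M -> bnd b rho M -> nm z <= rho / 16 ->
  (fun N => psum a z N * psum b z N - psum (cauchy_prod a b) z N) @ \oo --> (0 : C).
Proof.
move=> r0 Ha Hb zr; have M0 := bnd_ge0 r0 Ha.
set th := nm z / rho.
have th0 : 0 <= th by rewrite divr_ge0 ?nm_ge0 // ltW.
have th2 : th <= 16^-1 by rewrite ler_pdivrMr // mulrC.
have th1 : th <= 1 by lra.
apply: (cvgC_small _ (geom_small (2 * M ^+ 2))) => N; rewrite psum_mul.
apply: le_trans (nm_sum _ _ _) _.
have K k : (N <= k < N + N)%N ->
   nm ((\sum_(i < k.+1 | (i < N)%N && (k - i < N)%N) a i * b (k - i)%N) * z ^+ k) <=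
   2 * N%:R * M ^+ 2 * 16^-1 ^+ N.
  move=> /andP[Nk kN]; rewrite nmM.
  have H i : (i <= k)%N -> nm (a i * b (k - i)%N) * nm (z ^+ k) <= M ^+ 2 * 16^-1 ^+ N.
    move=> ik; rewrite -nmM -{2}(subnKC ik) exprD mulrACA nmM.
    apply: (@le_trans _ _ (M * th ^+ i * (M * th ^+ (k - i)))).
      by apply: ler_pM; rewrite ?nm_ge0 //; exact: bnd_term.
    rewrite mulrACA -exprD subnKC // -expr2 ler_wpM2l ?exprn_ge0 //.
    apply: (@le_trans _ _ (th ^+ N)); first by rewrite ler_wiXn2l.
    by rewrite lerXn2r // nnegrE invr_ge0.
  apply: (@le_trans _ _ (\sum_(i < k.+1) M ^+ 2 * 16^-1 ^+ N)).
    apply: (@le_trans _ _ (\sum_(i < k.+1 | (i < N)%N && (k - i < N)%N) M ^+ 2 * 16^-1 ^+ N)).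
      apply: (@le_trans _ _ ((\sum_(i < k.+1 | (i < N)%N && (k - i < N)%N)
         nm (a i * b (k - i)%N)) * nm (z ^+ k))).
        by rewrite ler_wpM2r ?nm_ge0 // nm_sum.
      by rewrite mulr_suml; apply: ler_sum => i _; apply: H; rewrite -ltnS.
    rewrite [X in _ <= X](bigID (fun i : 'I_k.+1 => (i < N)%N && (k - i < N)%N)) /= lerDl.
    by apply: sumr_ge0 => i _; rewrite mulr_ge0 ?exprn_ge0 // invr_ge0.
  have -> : \sum_(i < k.+1) M ^+ 2 * 16^-1 ^+ N = k.+1%:R * (M ^+ 2 * 16^-1 ^+ N).
    by rewrite sumr_const card_ord mulr_natl.
  rewrite -[X in _ <= X]mulrA; apply: ler_wpM2r.
    by rewrite mulr_ge0 ?exprn_ge0 // invr_ge0.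
  by rewrite -natrM ler_nat; lia.
rewrite big_nat; apply: le_trans (ler_sum _ K) _.
rewrite -big_nat sumr_const_nat addnK -[X in X <= _]mulr_natl.
by rewrite le_eqVlt; apply/orP; left; apply/eqP; ring.
Qed.

Lemma cvg_cauchy_prod a b (rho M : R) z (A B : C) :
  0 < rho -> bnd a rho M -> bnd b rho M -> nm z <= rho / 16 ->
  psum a z @ \oo --> A -> psum b z @ \oo --> B -> psum (cauchy_prod a b) z @ \oo --> A * B.
Proof.
move=> r0 Ha Hb zr cA cB; have := cvgC_sub (cvgC_mul cA cB) (cauchy_prod_small r0 Ha Hb zr).
rewrite subr0; apply: (@cvgC_near _ _ _ _ 0%N) => N _.
by rewrite opprB addrC subrK.
Qed.

Lemma bnd_le a (rho rho' M M' : R) : 0 <= rho' -> rho' <= rho -> M <= M' ->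
  bnd a rho M -> bnd a rho' M'.
Proof.
move=> r0 rr MM H n; apply: le_trans (le_trans (H n) MM).
by rewrite ler_wpM2l ?nm_ge0 // lerXn2r // nnegrE // (le_trans r0).
Qed.

Lemma bnd_cauchy_prod a b (rho M : R) : 0 < rho -> bnd a rho M -> bnd b rho M ->
  bnd (cauchy_prod a b) (rho / 2) (M ^+ 2).
Proof.
move=> r0 Ha Hb n; have M0 := bnd_ge0 r0 Ha.
apply: (@le_trans _ _ ((\sum_(i < n.+1) nm (a i * b (n - i)%N)) * (rho / 2) ^+ n)).
  by rewrite ler_wpM2r ?nm_sum // exprn_ge0 // divr_ge0 // ltW.
apply: (@le_trans _ _ (\sum_(i < n.+1) M ^+ 2 * (2^-1) ^+ n)).
  rewrite mulr_suml; apply: ler_sum => i _; rewrite nmM expr_div_n exprVn mulrA.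
  rewrite ler_wpM2r ?invr_ge0 ?exprn_ge0 //.
  have ik : (i <= n)%N by rewrite -ltnS.
  have -> : rho ^+ n = rho ^+ i * rho ^+ (n - i) by rewrite -exprD subnKC.
  rewrite mulrACA expr2.
  by apply: ler_pM; rewrite ?mulr_ge0 ?nm_ge0 ?exprn_ge0 ?(ltW r0).
rewrite sumr_const card_ord -mulrnAr ler_piMr ?exprn_ge0 //.
rewrite -mulr_natl exprVn ler_pdivrMr ?exprn_gt0 // mul1r -natrX ler_nat.
exact: ltn_expl.
Qed.

(** The coefficients of the reciprocal series are defined by a recursion on all
    the previous ones, which are therefore kept in a list. *)
Fixpoint recip_seq a (n : nat) : seq C :=
  if n is n'.+1 then
    rcons (recip_seq a n') (if n' == 0%N then (a 0%N)^-1
      else - (a 0%N)^-1 * \sum_(i < n') (recip_seq a n')`_i * a (n' - i)%N)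
  else [::].
Definition recip a (n : nat) : C := (recip_seq a n.+1)`_n.

Lemma size_recip_seq a n : size (recip_seq a n) = n.
Proof. by elim: n => //= n IH; rewrite size_rcons IH. Qed.

Lemma nth_recip_seq a n i : (i < n)%N -> (recip_seq a n)`_i = recip a i.
Proof.
elim: n => // n IH; rewrite ltnS leq_eqVlt => /predU1P[->//|lt].
by rewrite /= nth_rcons size_recip_seq lt IH.
Qed.

Lemma recip0 a : recip a 0 = (a 0%N)^-1.
Proof. by []. Qed.

Lemma recipS a n : recip a n.+1 = - (a 0%N)^-1 * \sum_(i < n.+1) recip a i * a (n.+1 - i)%N.
Proof.
rewrite {1}/recip.
have -> : recip_seq a n.+2 = rcons (recip_seq a n.+1)
  (- (a 0%N)^-1 * \sum_(i < n.+1) (recip_seq a n.+1)`_i * a (n.+1 - i)%N) by [].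
rewrite nth_rcons size_recip_seq ltnn eqxx; congr (_ * _); apply: eq_bigr => i _.
by rewrite nth_recip_seq.
Qed.

Lemma cauchy_prod_recip a n : a 0%N != 0 -> cauchy_prod (recip a) a n = (n == 0%N)%:R.
Proof.
move=> a0; case: n => [|n]; first by rewrite /cauchy_prod big_ord_recr big_ord0 /= add0r recip0 mulVf.
rewrite /cauchy_prod big_ord_recr /= subnn recipS mulrAC mulNr mulVf // mulN1r.
by rewrite addrC addNr.
Qed.

(** With K = M / |a_0| the recursion yields |b_n| rho^n <= (1 + K)^n / |a_0| by
    induction, because K times the sum of (1 + K)^i over i < n is (1 + K)^n - 1. *)
Lemma recip_bnd a (rho M : R) : 0 < rho -> bnd a rho M -> a 0%N != 0 ->
  bnd (recip a) (rho / (1 + M / nm (a 0%N))) (nm (a 0%N))^-1.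
Proof.
move=> r0 H a0 n; have M0 := bnd_ge0 r0 H.
have al0 : 0 < nm (a 0%N) by rewrite nm_gt0.
set al := nm (a 0%N) in al0 *; set K := M / al.
have K0 : 0 <= K by rewrite divr_ge0 // ltW.
have t0 : 0 < 1 + K by lra.
rewrite expr_div_n mulrA ler_pdivrMr ?exprn_gt0 //.
elim/ltn_ind: n => -[|n] IH.
  by rewrite recip0 nmV !expr0.
rewrite recipS nmM nmN nmV -/al -!mulrA ler_wpM2l ?invr_ge0 ?(ltW al0) //.
apply: (@le_trans _ _ (K * \sum_(i < n.+1) (1 + K) ^+ i)); last first.
  have := subrX1 (1 + K) n.+1; rewrite addrAC subrr add0r => <-.
  by rewrite gerBl.
apply: (@le_trans _ _ ((\sum_(i < n.+1) nm (recip a i * a (n.+1 - i)%N)) * rho ^+ n.+1)).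
  by rewrite ler_wpM2r ?nm_sum // exprn_ge0 // ltW.
rewrite mulr_suml mulr_sumr; apply: ler_sum => i _.
have ik : (i <= n.+1)%N by apply: ltnW.
have -> : rho ^+ n.+1 = rho ^+ i * rho ^+ (n.+1 - i) by rewrite -exprD subnKC.
rewrite nmM mulrACA.
apply: (@le_trans _ _ (al^-1 * (1 + K) ^+ i * M)); last first.
  by rewrite /K le_eqVlt; apply/orP; left; apply/eqP; ring.
apply: ler_pM; rewrite ?mulr_ge0 ?nm_ge0 ?exprn_ge0 ?(ltW r0) //; exact: IH.
Qed.

(** The Cauchy product of a series and its reciprocal is 1, so that the partial sums
    of the reciprocal are those of 1 divided by those of a, up to an error that
    tends to 0. *)
Lemma cvg_recip a (rho M : R) z (A : C) : 0 < rho -> bnd a rho M -> bnd (recip a) rho M ->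
  a 0%N != 0 -> nm z <= rho / 16 -> psum a z @ \oo --> A -> A != 0 ->
  psum (recip a) z @ \oo --> A^-1.
Proof.
move=> r0 Ha Hb a0 zr cA A0.
have c1 : (fun N => psum (recip a) z N * psum a z N) @ \oo --> (1 : C).
  have := cvgC_add (cauchy_prod_small r0 Hb Ha zr) (@cvgC_cst _ (1 : C)); rewrite add0r.
  apply: (@cvgC_near _ _ _ _ 1%N) => -[//|N] _.
  have -> : psum (cauchy_prod (recip a) a) z N.+1 = 1.
    rewrite /psum big_ord_recl big1 => [|i _]; first by rewrite cauchy_prod_recip // mul1r addr0 expr0.
    by rewrite cauchy_prod_recip // mul0r.
  by rewrite subrK.
have := cvgC_mul c1 (cvgC_inv A0 cA); rewrite mul1r.
have A0' : 0 < nm A by rewrite nm_gt0.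
have [N HN] := (cvgCP _ _).1 cA _ A0'.
apply: (@cvgC_near _ _ _ _ N) => k /HN kA; rewrite mulfK //.
by apply: contraTneq kA => ->; rewrite sub0r nmN ltxx.
Qed.

End PowerSeries.

(** * The exponential series *)

Section Exponential.
Variable R : realType.
Local Notation C := (Cx R).
Implicit Types (z w al : C).

Definition ecoef al (k : nat) : C := al ^+ k / k`!%:R.

Lemma fact_neq0 k : (k`!%:R : C) != 0.
Proof. by rewrite pnatr_eq0 -lt0n fact_gt0. Qed.

Lemma bnd_ecoef al (rho : R) : 0 < rho -> bnd (ecoef al) rho (1 + expR (nm al * rho)).
Proof.
move=> r0 n; rewrite /ecoef nmM nmX nmV nm_nat mulrAC -exprMn.
have x0 : 0 <= nm al * rho by rewrite mulr_ge0 ?nm_ge0 // ltW.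
case: n => [|n].
  by rewrite expr0 fact0 divr1; have := expR_ge0 (nm al * rho); lra.
have := expR_ge1Dxn n x0; lra.
Qed.

(** The binomial theorem. *)
Lemma cauchy_prod_ecoef al be n : cauchy_prod (ecoef al) (ecoef be) n = ecoef (al + be) n.
Proof.
rewrite /cauchy_prod /ecoef addrC exprDn mulr_suml; apply: eq_bigr => i _.
have ik : (i <= n)%N by rewrite -ltnS.
rewrite -mulr_natr -(bin_fact ik) !natrM.
have b0 : ('C(n, i)%:R : C) != 0 by rewrite pnatr_eq0 -lt0n bin_gt0.
have := fact_neq0 i; have := fact_neq0 (n - i); move: b0.
set x := 'C(n, i)%:R; set y := (i`!)%:R; set t := ((n - i)`!)%:R => x0 t0 y0.
by field; rewrite x0 t0 y0.
Qed.

Lemma psum_ecoef al z N : psum (ecoef al) z N = psum (ecoef (al * z)) 1 N.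
Proof. by apply: eq_bigr => k _; rewrite /ecoef exprMn expr1n mulr1 mulrAC. Qed.

Lemma cvg_ecoef_real (x : R) : psum (ecoef x%:C%C) 1 @ \oo --> ((expR x)%:C%C : C).
Proof.
have := cvgC_real (is_cvg_series_exp_coeff x); apply: (@cvgC_near _ _ _ _ 0%N) => N _.
rewrite /series /= big_mkord rmorph_sum /psum /=; apply: eq_bigr => k _.
by rewrite expr1n mulr1 /ecoef /exp_coeff /= rmorphM rmorphXn fmorphV rmorph_nat.
Qed.

Lemma cvg_ecoef_imag (y : R) :
  psum (ecoef (0 +i* y)%C) 1 @ \oo --> ((cos y +i* sin y)%C : C).
Proof.
have c1 := cvgC_real (@is_cvg_series_cos_coeff _ y).
have c2 := cvgC_real (@is_cvg_series_sin_coeff _ y).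
have E : ((cos y +i* sin y)%C : C) =
  (lim (series (cos_coeff y) @ \oo))%:C%C + 'i%C * (lim (series (sin_coeff y) @ \oo))%:C%C.
  by rewrite [LHS]complexE /= unlock unlock.
rewrite E; have := cvgC_add c1 (cvgC_Zl ('i%C : C) c2).
apply: (@cvgC_near _ _ _ _ 0%N) => N _.
rewrite /series /= !big_mkord !rmorph_sum mulr_sumr -big_split /psum /=.
apply: eq_bigr => k _; rewrite expr1n mulr1 /ecoef.
have iy : ((0 +i* y)%C : C) = 'i%C * y%:C%C by rewrite [LHS]complexE /= rmorph0 add0r.
rewrite iy exprMn /cos_coeff /sin_coeff /= !(rmorphM, rmorphXn, fmorphV, rmorph_nat, rmorphN1).
have ik : ('i%C : C) ^+ k = (~~ odd k)%:R * (-1) ^+ k./2 + 'i%C * ((odd k)%:R * (-1) ^+ (k.-1)./2).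
  rewrite -{1}(odd_double_half k) -mul2n exprD exprM sqr_i.
  case: (boolP (odd k)) => ok.
    rewrite mul0r add0r mul1r expr1; congr (_ * _ ^+ _).
    by move: ok; lia.
  by rewrite expr0 !mul1r mul0r mulr0 addr0.
rewrite ik; ring.
Qed.

(** The real and the imaginary case are multiplied as power series; this uses
    that the bounds of [bnd_ecoef] hold for every radius. *)
Lemma cvg_ecoef al z : psum (ecoef al) z @ \oo --> cexp (al * z).
Proof.
have -> : psum (ecoef al) z = psum (ecoef (al * z)) 1 by apply/funext => N; exact: psum_ecoef.
case: (al * z) => x y {al z}.
have -> : cexp ((x +i* y)%C : C) = (expR x)%:C%C * (cos y +i* sin y)%C.
  rewrite /cexp /=; apply/eqP; rewrite eq_complex /=; apply/andP; split; apply/eqP; ring.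
have -> : ecoef ((x +i* y)%C : C) = cauchy_prod (ecoef x%:C%C) (ecoef (0 +i* y)%C).
  apply/funext => n; rewrite cauchy_prod_ecoef; congr ecoef.
  by apply/eqP; rewrite eq_complex /= addr0 add0r !eqxx.
pose M := (1 + expR (nm (x%:C%C : C) * 16)) + (1 + expR (nm ((0 +i* y)%C : C) * 16)).
have H w : 0 <= 1 + expR (nm w * 16) by have := expR_ge0 (nm w * 16); lra.
apply: (@cvg_cauchy_prod _ _ _ 16 M) => //.
- by apply: bnd_le (bnd_ecoef _ _) => //; rewrite lerDl.
- by apply: bnd_le (bnd_ecoef _ _) => //; rewrite lerDr.
- by rewrite nm1 divff.
- exact: cvg_ecoef_real.
- exact: cvg_ecoef_imag.
Qed.

End Exponential.

(** * Entire functions *)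

Section Holomorphic.
Variable R : realType.
Local Notation C := (Cx R).
Implicit Types (f g : C -> C).

Lemma cexp_taylor1 (al h : C) : nm h <= 1 / 2 ->
  nm (cexp (al * h) - 1 - al * h) <= 2 * (1 + expR (nm al)) * nm h ^+ 2.
Proof.
move=> h2.
have := psum_tail_lim 2 ltr01 (bnd_ecoef al ltr01) h2 (@cvg_ecoef _ al h).
rewrite mulr1 divr1 /psum !big_ord_recl big_ord0 /= addr0 /ecoef /=.
by rewrite !expr0 !fact0 !divr1 !expr1 mulr1 opprD addrA.
Qed.

Lemma hol_cexp (al be : C) : holomorphic (fun z : C => cexp (al * z + be)).
Proof.
move=> z; apply/cvg_ex; exists (al * cexp (al * z + be)).
apply/cvgrPdist_lt => e /Cx_pos[r r0 ->].
rewrite near_withinE; apply/nearCP.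
set K := nm (cexp (al * z + be)) * (2 * (1 + expR (nm al))).
have K0 : 0 <= K.
  by rewrite mulr_ge0 ?nm_ge0 // mulr_ge0 // addr_ge0 // expR_ge0.
exists (Num.min (1 / 2) (r / (K + 1))) => [|h]; first by rewrite lt_min !divr_gt0 //; lra.
rewrite subr0 lt_min => /andP[h2 hr] h0.
rewrite distrC normE ltcR.
have hn : 0 < nm h by rewrite nm_gt0.
have -> : h^-1 *: (cexp (al * (h *: 1 + z) + be) - cexp (al * z + be)) - al * cexp (al * z + be)
   = cexp (al * z + be) * (cexp (al * h) - 1 - al * h) / h.
  rewrite /GRing.scale /= mulr1.
  have -> : al * (h + z) + be = al * h + (al * z + be) by ring.
  rewrite cexpD; have h1 : h != 0 by []. field. exact: h1.
rewrite nmM nmM nmV ltr_pdivrMr //.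
apply: (@le_lt_trans _ _ (K * nm h ^+ 2)).
  by rewrite /K -mulrA ler_wpM2l ?nm_ge0 // cexp_taylor1 // ltW.
rewrite expr2 mulrA ltr_pM2r //.
move: hr; rewrite ltr_pdivlMr; last by lra.
by nra.
Qed.

Lemma hol_cst (c : C) : holomorphic (fun _ : C => c).
Proof. by move=> z; exact: derivable_cst. Qed.
Lemma hol_add f g : holomorphic f -> holomorphic g -> holomorphic (fun z => f z + g z).
Proof. by move=> hf hg z; exact: derivableD. Qed.
Lemma hol_mul f g : holomorphic f -> holomorphic g -> holomorphic (fun z => f z * g z).
Proof. by move=> hf hg z; exact: derivableM. Qed.
Lemma hol_scale (c : C) f : holomorphic f -> holomorphic (fun z => c * f z).
Proof. by move=> hf; exact: (@hol_mul (fun=> c) f (@hol_cst c) hf). Qed.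
Lemma hol_sum (I : Type) (r : seq I) (P : pred I) (F : I -> C -> C) :
  (forall i, holomorphic (F i)) -> holomorphic (fun z => \sum_(i <- r | P i) F i z).
Proof.
move=> hF; elim: r => [|i r IH].
  have -> : (fun z => \sum_(i <- [::] | P i) F i z) = fun=> 0 by apply/funext => z; rewrite big_nil.
  exact: hol_cst.
have -> : (fun z => \sum_(j <- i :: r | P j) F j z) =
  fun z => (if P i then F i z else 0) + \sum_(j <- r | P j) F j z.
  by apply/funext => z; rewrite big_cons; case: (P i); rewrite ?add0r.
have h1 : holomorphic (fun z => if P i then F i z else 0).
  by case: (P i); [exact (hF i)|exact (@hol_cst 0)].
exact (@hol_add _ _ h1 IH).
Qed.
Lemma hol_prod n (F : 'I_n -> C -> C) :
  (forall i, holomorphic (F i)) -> holomorphic (fun z => \prod_(i < n) F i z).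
Proof.
elim: n F => [|n IH] F hF.
  have -> : (fun z => \prod_(i < 0) F i z) = fun=> 1 by apply/funext => z; rewrite big_ord0.
  exact: hol_cst.
have -> : (fun z => \prod_(i < n.+1) F i z) =
  fun z => (\prod_(i < n) F (widen_ord (leqnSn n) i) z) * F ord_max z.
  by apply/funext => z; rewrite big_ord_recr.
exact (@hol_mul _ _ (IH _ (fun i => hF (widen_ord (leqnSn n) i))) (hF ord_max)).
Qed.
Lemma hol_shift f (c : C) : holomorphic f -> holomorphic (fun z => f (z + c)).
Proof.
move=> hf z; have := hf (z + c); rewrite /derivable.
rewrite [X in cvg (X @ _) -> _](_ : _ =
  (fun h : C => h^-1 *: (((fun z => f (z + c)) \o shift z) (h *: 1) - f (z + c)))) //.
by apply/funext => h /=; rewrite addrA.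
Qed.

End Holomorphic.

(** * Meromorphic functions and the identity theorem *)

Section Meromorphic.
Variable R : realType.
Local Notation C := (Cx R).
Implicit Types (f g h : C -> C) (a b : nat -> C).

(** Multiplying by (z - z0)^N removes the negative powers.  As in the definition
    of [meromorphic], the value at z0 is the constant Laurent coefficient. *)
Definition laurent f (z0 : C) (N : nat) a (r : R) : Prop :=
  [/\ 0 < r, f z0 = a N & forall z, nm (z - z0) < r -> z != z0 ->
    psum a (z - z0) @ \oo --> (z - z0) ^+ N * f z].

Lemma series_center a N :
  series (fun k => a k * (0 : C) ^ (k%:Z - N%:Z)) @ \oo --> a N.
Proof.
apply: (@cvgC_near _ (fun=> a N) _ _ N.+1); last exact: cvgC_cst.
move=> n Nn; rewrite /series /= big_mkord (bigD1 (Ordinal Nn)) //= subrr expr0z mulr1.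
rewrite big1 ?addr0 // => i /eqP iN; rewrite exp0rz.
rewrite (_ : (i%:Z - N%:Z == 0) = false) ?mulr0 //.
apply/negbTE; rewrite subr_eq0; apply/eqP => -[E]; apply: iN; exact: val_inj.
Qed.

Lemma series_off a N (w l : C) : w != 0 ->
  series (fun k => a k * w ^ (k%:Z - N%:Z)) @ \oo --> l <->
  psum a w @ \oo --> w ^+ N * l.
Proof.
move=> w0; have wN : w ^+ N != 0 by rewrite expf_neq0.
have E n : series (fun k => a k * w ^ (k%:Z - N%:Z)) n = (w ^+ N)^-1 * psum a w n.
  rewrite /series /= big_mkord /psum mulr_sumr; apply: eq_bigr => k _.
  by rewrite expfzDr // -exprnP -exprnN -exprVn; ring.
split=> H.
  apply: (@cvgC_near _ _ _ _ 0%N _ (cvgC_Zl (w ^+ N) H)) => n _.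
  by rewrite E mulrA divff // mul1r.
have H' := cvgC_Zl (w ^+ N)^-1 H.
have E2 : (w ^+ N)^-1 * (w ^+ N * l) = l by rewrite mulKf.
rewrite -E2; apply: (@cvgC_near _ _ _ _ 0%N _ H') => n _.
by rewrite E.
Qed.

Lemma meromorphicP f : meromorphic f <-> forall z0, exists N a r, laurent f z0 N a r.
Proof.
split=> H z0.
  have [N [a /nearCP[r r0 Hr]]] := H z0; exists N, a, r; split=> //.
    have := Hr z0; rewrite subrr nm0 => /(_ r0) c.
    exact: (cvgC_unique c (@series_center a N)).
  by move=> z zr zz0; apply/series_off; rewrite ?subr_eq0 //; exact: Hr.
have [N [a [r [r0 fz0 Hr]]]] := H z0; exists N, a; apply/nearCP; exists r => // z zr.
case: (eqVneq z z0) => [->|zz0]; first by rewrite subrr fz0; exact: series_center.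
by apply/series_off; rewrite ?subr_eq0 //; exact: Hr.
Qed.

Definition pshift (s : nat) a (k : nat) : C := if (k < s)%N then 0 else a (k - s)%N.

Lemma psum_shift s a w n : psum (pshift s a) w (n + s) = w ^+ s * psum a w n.
Proof.
rewrite /psum addnC big_split_ord /= big1 ?add0r => [|i _]; last first.
  by rewrite /pshift /= ltn_ord mul0r.
rewrite mulr_sumr; apply: eq_bigr => i _.
by rewrite /pshift ltnNge leq_addr /= addKn exprD; ring.
Qed.

Lemma cvg_pshift s a w (l : C) : psum a w @ \oo --> l ->
  psum (pshift s a) w @ \oo --> w ^+ s * l.
Proof.
move=> H; apply/(cvgC_shift _ _ s).
by apply: (@cvgC_near _ _ _ _ 0%N _ (cvgC_Zl (w ^+ s) H)) => n _; rewrite psum_shift.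
Qed.

Lemma meromorphic_lincomb (c d : C) f g : meromorphic f -> meromorphic g ->
  meromorphic (fun z => c * f z + d * g z).
Proof.
move=> /meromorphicP Hf /meromorphicP Hg; apply/meromorphicP => z0.
have [N [a [r [r0 fz0 Hr]]]] := Hf z0; have [N' [b [r' [r0' gz0 Hr']]]] := Hg z0.
exists (N + N')%N, (fun k => c * pshift N' a k + d * pshift N b k), (Num.min r r').
split; first by rewrite lt_min r0.
  by rewrite fz0 gz0 /pshift !ltnNge leq_addl leq_addr /= addnK addKn.
move=> z; rewrite lt_min => /andP[zr zr'] zz0; set w := z - z0.
have cf := @cvg_pshift N' _ _ _ (Hr z zr zz0).
have cg := @cvg_pshift N _ _ _ (Hr' z zr' zz0).
have cfg := cvgC_add (cvgC_Zl c cf) (cvgC_Zl d cg).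
have E : w ^+ (N + N') * (c * f z + d * g z) =
  c * ((z - z0) ^+ N' * ((z - z0) ^+ N * f z)) + d * ((z - z0) ^+ N * ((z - z0) ^+ N' * g z)).
  by rewrite exprD /w; ring.
rewrite E; apply: (@cvgC_near _ _ _ _ 0%N _ cfg) => n _.
rewrite /psum !mulr_sumr -big_split; apply: eq_bigr => k _ /=; ring.
Qed.

(** If some coefficient is nonzero, the first such term dominates the rest of the
    series near z0. *)
Lemma laurent_zeros h z0 N a (r : R) : laurent h z0 N a r ->
  (exists2 e : R, 0 < e & forall z, nm (z - z0) < e -> h z = 0) \/
  (exists2 e : R, 0 < e & forall z, nm (z - z0) < e -> z != z0 -> h z != 0).
Proof.
case=> r0 hz0 Hr.
case: (pselect (exists k, a k != 0)) => [ex|nex]; last first.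
  have a0 k : a k = 0 by apply/eqP; apply: contrapT => /negP ak; apply: nex; exists k.
  left; exists r => // z zr; case: (eqVneq z z0) => [->|zz0]; first by rewrite hz0 a0.
  have c0 : psum a (z - z0) @ \oo --> (0 : C).
    apply: (@cvgC_near _ (fun=> 0) _ _ 0%N); last exact: cvgC_cst.
    by move=> n _; rewrite /psum big1 // => i _; rewrite a0 mul0r.
  have /eqP := cvgC_unique c0 (Hr z zr zz0); rewrite eq_sym mulf_eq0 => /orP[|/eqP //].
  by rewrite expf_eq0 subr_eq0 (negbTE zz0) andbF.
right; case: (ex_minnP ex) => p ap pmin.
have psum0 w : psum a w p.+1 = a p * w ^+ p.
  rewrite psumS /psum big1 ?add0r // => i _.
  case: (eqVneq (a i) 0) => [->|/pmin]; first by rewrite mul0r.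
  by rewrite leqNgt ltn_ord.
(* convergence at one point of the disc, at distance r / 2 from the centre, yields
   the coefficient bound *)
pose w0 : C := (r / 2)%:C%C.
have w00 : nm w0 = r / 2 by rewrite nm_real ger0_norm // divr_ge0 // ltW.
have rho0 : 0 < r / 2 by rewrite divr_gt0.
have w0n : w0 != 0 by rewrite -nm_gt0 w00.
have [M HM] : exists M, bnd a (r / 2) M.
  rewrite -w00; apply: (@cvg_bnd _ a w0 (w0 ^+ N * h (w0 + z0))) => //.
  have := Hr (w0 + z0); rewrite addrK w00 => H; apply: H.
    by rewrite ltr_pdivrMr // ltr_pMr // ltr1n.
  by rewrite -subr_eq0 addrK.
set rho := r / 2 in rho0 HM.
have M0 := bnd_ge0 rho0 HM.
have ap0 : 0 < nm (a p) by rewrite nm_gt0.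
exists (Num.min (rho / 2) (nm (a p) * rho ^+ p.+1 / (2 * M + 1))).
  rewrite lt_min !divr_gt0 //; first by rewrite mulr_gt0 // exprn_gt0.
  by lra.
move=> z; rewrite lt_min => /andP[zr zs] zz0; apply/eqP => hz.
have w0' : z - z0 != 0 by rewrite subr_eq0.
have zr' : nm (z - z0) < r by rewrite /rho in zr; lra.
have := psum_tail_lim p.+1 rho0 HM (ltW zr) (Hr z zr' zz0).
rewrite hz mulr0 sub0r nmN psum0 nmM nmX expr_div_n exprS.
set t := nm (z - z0) in zs *.
have t0 : 0 < t by rewrite nm_gt0.
rewrite mulrA ler_pdivlMr ?exprn_gt0 // mulrAC.
have -> : 2 * M * (t * t ^+ p) = (2 * M * t) * t ^+ p by ring.
rewrite ler_pM2r ?exprn_gt0 // => le1.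
move: zs; rewrite ltr_pdivlMr; last by lra.
by nra.
Qed.

(** The set of points near which f and g agree is open, and closed because zeros of
    f - g accumulate only at points near which f - g vanishes.  Its
    intersection with the segment from u to any other point is therefore the whole
    segment. *)
Lemma identity_theorem f g (u : C) (e : R) : meromorphic f -> meromorphic g -> 0 < e ->
  (forall z, nm (z - u) < e -> f z = g z) -> f =1 g.
Proof.
move=> Hf Hg e0 fg.
have Hh := meromorphic_lincomb 1 (-1) Hf Hg.
set h := fun z => 1 * f z + -1 * g z in Hh.
have hE z : h z = 0 <-> f z = g z.
  by rewrite /h mul1r mulN1r; split=> [/eqP|->]; rewrite ?subrr // subr_eq0 => /eqP.
pose Z z := exists2 e : R, 0 < e & forall z', nm (z' - z) < e -> h z' = 0.
have Zopen z : Z z -> exists2 e : R, 0 < e & forall z', nm (z' - z) < e -> Z z'.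
  case=> d d0 Hd; exists (d / 2); first by rewrite divr_gt0.
  move=> z' zz'; exists (d / 2); first by rewrite divr_gt0.
  move=> z'' zz''; apply: Hd; rewrite -(subrK z' z'') -addrA.
  by apply: le_lt_trans (nmD _ _) _; lra.
have Zclosed z : ~ Z z -> exists2 e : R, 0 < e & forall z', nm (z' - z) < e -> ~ Z z'.
  move=> nZ; have [N [a [r Hl]]] := (meromorphicP h).1 Hh z.
  case: (laurent_zeros Hl) => [[d d0 Hd]|[d d0 Hd]]; first by case: nZ; exists d.
  exists d => // z' zz' [d' d0' Hd'].
  case: (eqVneq z' z) => [E|ne]; first by apply: nZ; exists d'; rewrite // -E.
  by have /eqP := Hd z' zz' ne; apply; apply: Hd'; rewrite subrr nm0.
move=> z1; apply/hE.
(* the segment from u to z1 *)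
pose ga (t : R) : C := u + t%:C%C * (z1 - u).
have gad t s : nm (ga t - ga s) = `|t - s| * nm (z1 - u).
  rewrite /ga -nm_real -nmM rmorphB /=; congr nm; ring.
have K0 : 0 < nm (z1 - u) + 1 by have := nm_ge0 (z1 - u); lra.
have near_ga t (d : R) : 0 < d -> \forall s \near t, nm (ga s - ga t) < d.
  move=> d0; near=> s; rewrite gad.
  have : `|t - s| < d / (nm (z1 - u) + 1).
    near: s; apply: (@cvgr_dist_lt _ _ _ _ _ id t) => //; by rewrite divr_gt0.
  rewrite distrC ltr_pdivlMr // => lt1; apply: le_lt_trans lt1.
  by rewrite ler_wpM2l // lerDl.
pose A : set R := [set t | Z (ga t)].
have AT : A = setT.
  have conn : connected (setT : set R) by apply/connected_intervalP => x y.
  apply: conn.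
  - exists 0; rewrite /A /= /ga rmorph0 mul0r addr0.
    by exists e => // z /fg /hE.
  - exists A; last by rewrite setTI.
    rewrite openE => t /= /Zopen[d d0 Hd]; rewrite /interior.
    by apply: filterS (near_ga t d d0) => s; exact: Hd.
  - exists A; last by rewrite setTI.
    rewrite -openC openE => t /= /Zclosed[d d0 Hd]; rewrite /interior.
    by apply: filterS (near_ga t d d0) => s; exact: Hd.
have : A 1 by rewrite AT.
rewrite /A /= /ga rmorph1 mul1r addrC subrK => -[d d0]; apply.
by rewrite subrr nm0.
Unshelve. all: by end_near.
Qed.

End Meromorphic.

(** * Meromorphic quotients of exponentials *)

Section Germs.
Variable R : realType.
Local Notation C := (Cx R).
Implicit Types (f g h F G : C -> C) (a b : nat -> C).

Lemma ecoef0 (al : C) : ecoef al 0 = 1.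
Proof. by rewrite /ecoef expr0 fact0 divr1. Qed.
Lemma ecoef1 (al : C) : ecoef al 1 = al.
Proof. by rewrite /ecoef expr1 factS fact0 divr1. Qed.

(** Convergence near 0 together with a coefficient bound, the form of analyticity that
    products and reciprocals preserve. *)
Definition pser a F : Prop := exists rho M : R,
  [/\ 0 < rho, bnd a rho M & forall t : C, nm t < rho -> psum a t @ \oo --> F t].

Lemma pser_shrink a F (d : R) : 0 < d -> pser a F -> exists rho M : R,
  [/\ 0 < rho, rho <= d, bnd a rho M & forall t : C, nm t < rho -> psum a t @ \oo --> F t].
Proof.
move=> d0 [rho [M [r0 H Hc]]]; exists (Num.min rho d), M; split.
- by rewrite lt_min r0.
- by rewrite ge_min lexx orbT.
- by apply: bnd_le H => //; rewrite ?ge_min ?lexx // le_min !ltW.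
by move=> t; rewrite lt_min => /andP[tr _]; exact: Hc.
Qed.

Lemma pser_mul a b F G : pser a F -> pser b G -> pser (cauchy_prod a b) (fun t => F t * G t).
Proof.
move=> [r1 [M1 [r10 H1 C1]]] [r2 [M2 [r20 H2 C2]]].
pose rho := Num.min r1 r2; pose M := Num.max M1 M2.
have r0 : 0 < rho by rewrite lt_min r10.
have rr1 : rho <= r1 by rewrite ge_min lexx.
have rr2 : rho <= r2 by rewrite ge_min lexx orbT.
have Ha : bnd a rho M by apply: bnd_le H1; rewrite ?le_max ?lexx ?(ltW r0).
have Hb : bnd b rho M by apply: bnd_le H2; rewrite ?le_max ?lexx ?orbT ?(ltW r0).
exists (rho / 16), (M ^+ 2); split; first by rewrite divr_gt0.
  apply: bnd_le (bnd_cauchy_prod r0 Ha Hb) => //; first by rewrite divr_ge0 // ltW.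
  by rewrite ler_pM2l // lef_pV2 ?posrE // ler_nat.
have r16 : rho / 16 <= rho by rewrite ler_pdivrMr // ler_pMr // ler1n.
move=> t tr; have tr' : nm t < rho by apply: lt_le_trans r16.
apply: (cvg_cauchy_prod r0 Ha Hb (ltW tr)); [apply: C1|apply: C2]; exact: lt_le_trans tr' _.
Qed.

Lemma pser0 a F : pser a F -> F 0 = a 0%N.
Proof.
move=> [r [M [r0 _ Hc]]]; have c0 := Hc 0; rewrite nm0 in c0.
have c1 : psum a 0 @ \oo --> a 0%N.
  apply: (@cvgC_near _ (fun=> a 0%N) _ _ 1%N); last exact: cvgC_cst.
  move=> [//|n] _; rewrite /psum big_ord_recl expr0 mulr1 big1 ?addr0 // => i _.
  by rewrite exprS mul0r mulr0.
exact: cvgC_unique (c0 r0) c1.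
Qed.

Lemma pser_neq0 a F : pser a F -> a 0%N != 0 ->
  exists2 e : R, 0 < e & forall t, nm t < e -> F t != 0.
Proof.
move=> [rho [M [r0 H Hc]]] a0; have M0 := bnd_ge0 r0 H.
have al0 : 0 < nm (a 0%N) by rewrite nm_gt0.
exists (Num.min (rho / 2) (nm (a 0%N) * rho / (2 * M + 1))).
  rewrite lt_min !divr_gt0 //; first by rewrite mulr_gt0.
  by lra.
move=> t; rewrite lt_min => /andP[tr ts]; apply/eqP => Ft.
have tr' : nm t < rho by lra.
have := psum_tail_lim 1 r0 H (ltW tr) (Hc t tr').
rewrite Ft sub0r nmN /psum big_ord_recl big_ord0 addr0 expr0 mulr1 expr1 mulrA.
rewrite ler_pdivlMr // => le1; move: ts; rewrite ltr_pdivlMr; last by lra.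
by have := nm_ge0 t; nra.
Qed.

Lemma pser_inv a F : pser a F -> a 0%N != 0 -> pser (recip a) (fun t => (F t)^-1).
Proof.
move=> HF a0; have [e e0 He] := pser_neq0 HF a0.
have [r1 [M1 [r10 r1e H1 C1]]] := pser_shrink e0 HF.
have H2 := recip_bnd r10 H1 a0; set r2 := r1 / _ in H2; set M2 := _^-1 in H2.
have al0 : 0 < nm (a 0%N) by rewrite nm_gt0.
have K0 : 0 <= M1 / nm (a 0%N) by rewrite divr_ge0 ?(bnd_ge0 r10 H1) // ltW.
have r20 : 0 < r2 by rewrite divr_gt0 //; lra.
have r2r1 : r2 <= r1 by rewrite ler_pdivrMr ?ler_pMr //; lra.
pose M := Num.max M1 M2.
have Ha : bnd a r2 M by apply: bnd_le H1; rewrite ?le_max ?lexx ?(ltW r20).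
have Hb : bnd (recip a) r2 M by apply: bnd_le H2; rewrite ?le_max ?lexx ?orbT ?(ltW r20).
have r16 : r2 / 16 <= r2 by rewrite ler_pdivrMr // ler_pMr // ler1n.
exists (r2 / 16), M; split; first by rewrite divr_gt0.
  by apply: bnd_le Hb => //; rewrite divr_ge0 // ltW.
move=> t tr; have tr' : nm t < r1 by apply: lt_le_trans tr (le_trans r16 r2r1).
apply: (cvg_recip r20 Ha Hb a0 (ltW tr) (C1 t tr')).
by apply: He; apply: lt_le_trans r1e.
Qed.

Lemma pser_exp (al : C) : pser (ecoef al) (fun t => cexp (al * t)).
Proof.
exists 1, (1 + expR (nm al * 1)); split=> //; first exact: bnd_ecoef.
by move=> t _; exact: cvg_ecoef.
Qed.

Lemma pser_scale (c : C) a F : pser a F -> pser (fun k => c * a k) (fun t => c * F t).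
Proof.
move=> [r [M [r0 H Hc]]]; exists r, (nm c * M); split; first exact: r0.
  by move=> n; rewrite nmM -mulrA ler_wpM2l ?nm_ge0.
move=> t tr; apply: (@cvgC_near _ _ _ _ 0%N _ (cvgC_Zl c (Hc t tr))) => n _.
by rewrite /psum mulr_sumr; apply: eq_bigr => k _; rewrite mulrA.
Qed.

Lemma pser_1sub a F : pser a F -> pser (fun k => (k == 0%N)%:R - a k) (fun t => 1 - F t).
Proof.
move=> [r [M [r0 H Hc]]]; exists r, (1 + M); split; first exact: r0.
  move=> n; apply: (@le_trans _ _ ((nm (n == 0%N)%:R + nm (a n)) * r ^+ n)).
    by rewrite ler_wpM2r ?exprn_ge0 ?(ltW r0) // -[nm (a n)]nmN nmD.
  rewrite mulrDl lerD //.
  by case: n => [|n]; rewrite ?nm1 ?mul1r // nm0 mul0r.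
move=> t tr; apply: (@cvgC_near _ _ _ _ 1%N _ (cvgC_sub (cvgC_cst 1) (Hc t tr))).
move=> [//|n] _; rewrite /psum; under [in RHS]eq_bigr => k _ do rewrite mulrBl.
rewrite sumrB; congr (_ - _).
by rewrite big_ord_recl big1 => [|i _]; rewrite ?mul1r ?expr0 ?addr0 // mul0r.
Qed.

(** The entire function (e^{be t} - 1) / t. *)
Definition expm1 (be t : C) : C := if t == 0 then be else (cexp (be * t) - 1) / t.

Lemma pser_expm1 (be : C) : pser (fun k => ecoef be k.+1) (expm1 be).
Proof.
have [r [M [r0 H Hc]]] := pser_exp be.
exists r, (M / r); split; first exact: r0.
  by move=> n; rewrite ler_pdivlMr // -mulrA -exprSr.
move=> t tr; rewrite /expm1; case: eqVneq => [->|t0].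
  apply: (@cvgC_near _ (fun=> be) _ _ 1%N); last exact: cvgC_cst.
  move=> [//|n] _; rewrite /psum big_ord_recl expr0 mulr1 big1 ?addr0 => [|i _].
    by rewrite [RHS]ecoef1.
  by rewrite lift0 exprS mul0r mulr0.
have c1 := (cvgC_shift _ _ 1).2 (Hc t tr).
have c2 := cvgC_Zl t^-1 (cvgC_sub c1 (cvgC_cst 1)).
rewrite [X in _ --> X]mulrC; apply: (@cvgC_near _ _ _ _ 0%N _ c2) => n _.
rewrite addn1 {1}/psum big_ord_recl [ecoef be ord0]ecoef0 expr0 mulr1 addrC addKr.
rewrite mulr_sumr; apply: eq_bigr => i _.
by rewrite lift0 [t ^+ i.+1]exprS mulrCA mulKf.
Qed.

Lemma meromorphic_cexp (al : C) : meromorphic (fun z => cexp (al * z)).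
Proof.
apply/meromorphicP => z0; exists 0%N, (fun k => cexp (al * z0) * ecoef al k), 1; split=> //.
  by rewrite ecoef0 mulr1.
move=> z _ _; have [r [M [r0 H Hc]]] := pser_scale (cexp (al * z0)) (pser_exp al).
have -> : (z - z0) ^+ 0 * cexp (al * z) = cexp (al * z0) * cexp (al * (z - z0)).
  by rewrite expr0 mul1r -cexpD; congr cexp; ring.
apply: (@cvgC_near _ _ _ _ 0%N _ (cvgC_Zl (cexp (al * z0)) (@cvg_ecoef _ al (z - z0)))) => n _.
by rewrite /psum mulr_sumr; apply: eq_bigr => k _; rewrite mulrA.
Qed.

(** At a zero z0 of the denominator, (z - z0) times the quotient is the product of
    an exponential and the reciprocal of [expm1].  The natural value at the pole is
    the constant Laurent coefficient, coefficient 1 of that product. *)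
Lemma meromorphic_cexp_div (al be ga : C) : be != 0 -> exists2 f : C -> C, meromorphic f &
  forall z, cexp (be * z + ga) != 1 -> f z = cexp (al * z) / (1 - cexp (be * z + ga)).
Proof.
move=> be0.
pose u k := ecoef be k.+1; pose D := cauchy_prod (fun k => -1 * ecoef al k) (recip u).
have u0 : u 0%N != 0 by rewrite /u ecoef1.
pose f z := if cexp (be * z + ga) == 1 then cexp (al * z) * D 1%N
  else cexp (al * z) / (1 - cexp (be * z + ga)).
exists f; last by move=> z /negbTE ne; rewrite /f ne.
apply/meromorphicP => z0.
have split_al z : cexp (al * z) = cexp (al * z0) * cexp (al * (z - z0)).
  by rewrite -cexpD; congr cexp; ring.
have split_be z : cexp (be * z + ga) = cexp (be * z0 + ga) * cexp (be * (z - z0)).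
  by rewrite -cexpD; congr cexp; ring.
set c0 := cexp (al * z0) in split_al; set ka := cexp (be * z0 + ga) in split_be.
case: (eqVneq ka 1) => [ka1|ka1].
- have PD := pser_scale c0 (pser_mul (pser_scale (-1) (pser_exp al)) (pser_inv (pser_expm1 be) u0)).
  have [e e0 He] := pser_neq0 (pser_expm1 be) u0.
  have [r [M [r0 re _ Hc]]] := pser_shrink e0 PD.
  exists 1%N, (fun k => c0 * D k), r; split=> //; first by rewrite /f -/ka ka1 eqxx.
  move=> z zr zz0; have t0 : z - z0 != 0 by rewrite subr_eq0.
  have ut : expm1 be (z - z0) != 0 by apply: He; apply: lt_le_trans re.
  have E : 1 - cexp (be * z + ga) = - (z - z0) * expm1 be (z - z0).
    rewrite split_be ka1 mul1r /expm1 (negbTE t0) mulrCA mulNr divff // mulrN1 opprB //.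
  have ne : 1 - cexp (be * z + ga) != 0 by rewrite E mulf_neq0 // oppr_eq0.
  have -> : (z - z0) ^+ 1 * f z =
      c0 * (-1 * cexp (al * (z - z0)) * (expm1 be (z - z0))^-1).
    rewrite expr1 /f eq_sym -subr_eq0 (negbTE ne) E split_al.
    by field; rewrite ut t0.
  exact: Hc.
have a0 : (0%N == 0%N)%:R - ka * ecoef be 0 != 0.
  by rewrite ecoef0 mulr1 subr_eq0 eq_sym.
have PD := pser_scale c0 (pser_mul (pser_exp al)
  (pser_inv (pser_1sub (pser_scale ka (pser_exp be))) a0)).
have [e e0 He] := pser_neq0 (pser_1sub (pser_scale ka (pser_exp be))) a0.
have P0 := pser0 PD.
have [r [M [r0 re _ Hc]]] := pser_shrink e0 PD.
have fE z : nm (z - z0) < e -> f z = c0 * (cexp (al * (z - z0)) *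
    (1 - ka * cexp (be * (z - z0)))^-1).
  move=> /He /= ne; rewrite /f split_be eq_sym -subr_eq0 (negbTE ne) split_al.
  by rewrite mulrA.
exists 0%N, (fun k => c0 * cauchy_prod (ecoef al)
  (recip (fun k => (k == 0%N)%:R - ka * ecoef be k)) k), r; split=> //.
  by rewrite -P0 fE ?subrr // nm0.
move=> z zr zz0; rewrite expr0 mul1r fE; first exact: Hc.
by apply: lt_le_trans re.
Qed.

End Germs.

(** * Exponential polynomials *)

Section ExponentialPolynomials.
Variables (R : realType) (eta : Cx R).
Hypothesis eta_gt0 : 0 < 'Im eta.
Local Notation C := (Cx R).
Local Notation qpow := (qpow eta).
Local Notation qnum := (qnum eta).
Local Notation qpoch := (qpoch eta).

(** The class of functions to which the diagonal matrix elements belong.  The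
    exponents be i do not depend on lam, and this is why the poles in x of the trace
    do not depend on lam either.  The formula is required for large k only because
    matrix elements with small k may violate it. *)
Definition exp_poly (F : C -> nat -> C) : Prop :=
  (forall k, holomorphic (fun lam => F lam k)) /\
  exists (K : nat) (I : finType) (be : I -> C) (a : I -> C -> C),
    (forall i, holomorphic (a i)) /\
    forall lam k, (K <= k)%N -> F lam k = \sum_(i : I) a i lam * qpow (be i * k%:R).

Lemma exp_poly_hol (a : C -> C) : holomorphic a -> exp_poly (fun lam _ => a lam).
Proof.
move=> ha; split=> [_|]; first exact: ha.
exists 0%N, unit, (fun=> 0), (fun=> a); split=> [_|lam k _]; first exact: ha.
by rewrite (big_pred1 tt) => [|[]] //; rewrite mul0r qpow0 mulr1.
Qed.

Lemma exp_poly_cst (c : C) : exp_poly (fun _ _ => c).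
Proof. exact: (exp_poly_hol (@hol_cst R c)). Qed.

Lemma exp_poly_qpow (be : C) : exp_poly (fun _ k => qpow (be * k%:R)).
Proof.
split=> [k|]; first exact: hol_cst.
exists 0%N, unit, (fun=> be), (fun _ _ => 1); split=> [_|lam k _]; first exact: hol_cst.
by rewrite (big_pred1 tt) => [|[]] //; rewrite mul1r.
Qed.

Lemma exp_poly_add F G : exp_poly F -> exp_poly G -> exp_poly (fun lam k => F lam k + G lam k).
Proof.
move=> [hF [K [I [be [a [ha EF]]]]]] [hG [K' [J [be' [a' [ha' EG]]]]]].
split=> [k|]; first exact (@hol_add _ _ _ (hF k) (hG k)).
exists (maxn K K'), (I + J)%type, (fun s => match s with inl i => be i | inr j => be' j end),
  (fun s => match s with inl i => a i | inr j => a' j end); split=> [[i|j]|lam k].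
- exact: ha.
- exact: ha'.
by rewrite geq_max => /andP[Kk K'k]; rewrite EF // EG // big_sumType.
Qed.

Lemma exp_poly_mul F G : exp_poly F -> exp_poly G -> exp_poly (fun lam k => F lam k * G lam k).
Proof.
move=> [hF [K [I [be [a [ha EF]]]]]] [hG [K' [J [be' [a' [ha' EG]]]]]].
split=> [k|]; first exact (@hol_mul _ _ _ (hF k) (hG k)).
exists (maxn K K'), (I * J)%type, (fun s => be s.1 + be' s.2),
  (fun s lam => a s.1 lam * a' s.2 lam); split=> [[i j]|lam k].
  exact (@hol_mul _ _ _ (ha i) (ha' j)).
rewrite geq_max => /andP[Kk K'k]; rewrite EF // EG // big_distrlr /= pair_bigA /=.
by apply: eq_bigr => -[i j] _ /=; rewrite mulrDl qpowD; ring.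
Qed.

Lemma exp_poly_addn F (d : nat) : exp_poly F -> exp_poly (fun lam k => F lam (k + d)%N).
Proof.
move=> [hF [K [I [be [a [ha EF]]]]]]; split=> [k|]; first exact: hF.
exists K, I, be, (fun i lam => qpow (be i * d%:R) * a i lam); split=> [i|lam k Kk].
  exact (@hol_scale _ _ _ (ha i)).
rewrite EF ?(leq_trans Kk) ?leq_addr //; apply: eq_bigr => i _.
by rewrite natrD mulrDr qpowD; ring.
Qed.

(** A formula for large k is insensitive to finitely many values. *)
Lemma exp_poly_subn F (d : nat) : (forall k, holomorphic (fun lam => F lam k)) ->
  exp_poly (fun lam k => F lam (k + d)%N) -> exp_poly F.
Proof.
move=> hF [_ [K [I [be [a [ha EF]]]]]]; split; first exact: hF.
exists (K + d)%N, I, be, (fun i lam => qpow (- (be i * d%:R)) * a i lam); split=> [i|lam k Kk].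
  exact (@hol_scale _ _ _ (ha i)).
have dk : (d <= k)%N by apply: leq_trans Kk; rewrite leq_addl.
have := EF lam (k - d)%N; rewrite subnK // => -> ; last by rewrite leq_subRL // addnC.
apply: eq_bigr => i _; rewrite natrB // mulrBr qpowB qpowN.
by rewrite mulrA mulrC mulrA.
Qed.

Lemma exp_poly_shift F (c : C) : exp_poly F -> exp_poly (fun lam k => F (lam + c) k).
Proof.
move=> [hF [K [I [be [a [ha EF]]]]]]; split=> [k|]; first exact (@hol_shift _ _ c (hF k)).
exists K, I, be, (fun i lam => a i (lam + c)); split=> [i|lam k Kk].
  exact (@hol_shift _ _ c (ha i)).
by rewrite EF.
Qed.

Lemma exp_poly_sum (n : nat) (F : 'I_n -> C -> nat -> C) : (forall i, exp_poly (F i)) ->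
  exp_poly (fun lam k => \sum_(i < n) F i lam k).
Proof.
elim: n F => [|n IH] F hF.
  have -> : (fun lam k => \sum_(i < 0) F i lam k) = fun _ _ => 0.
    by apply/funext => lam; apply/funext => k; rewrite big_ord0.
  exact: exp_poly_cst.
have -> : (fun lam k => \sum_(i < n.+1) F i lam k) =
  fun lam k => (\sum_(i < n) F (widen_ord (leqnSn n) i) lam k) + F ord_max lam k.
  by apply/funext => lam; apply/funext => k; rewrite big_ord_recr.
exact (exp_poly_add (IH _ (fun i => hF (widen_ord (leqnSn n) i))) (hF ord_max)).
Qed.

Lemma exp_poly_qnum (c : C) : exp_poly (fun _ k => qnum (k%:R + c)).
Proof.
have -> : (fun (_ : C) k => qnum (k%:R + c)) = fun _ k =>
   (qpow 1 - qpow (- 1))^-1 * qpow c * qpow (1 * k%:R)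
   + (- ((qpow 1 - qpow (- 1))^-1 * qpow (- c))) * qpow ((-1) * k%:R).
  apply/funext => _; apply/funext => k; rewrite /Defs.qnum mul1r mulN1r opprD !qpowD.
  by ring.
exact (exp_poly_add (exp_poly_mul (exp_poly_cst ((qpow 1 - qpow (- 1))^-1 * qpow c)) (exp_poly_qpow 1))
  (exp_poly_mul (exp_poly_cst (- ((qpow 1 - qpow (- 1))^-1 * qpow (- c)))) (exp_poly_qpow (-1)))).
Qed.

Lemma exp_poly_qpoch (c : C) (j : nat) : exp_poly (fun _ k => qpoch (k%:R + c) j).
Proof.
elim: j => [|j IH].
  have -> : (fun (_ : C) k => qpoch (k%:R + c) 0) = fun _ _ => 1.
    by apply/funext => _; apply/funext => k; rewrite qpoch0.
  exact: exp_poly_cst.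
have -> : (fun (_ : C) k => qpoch (k%:R + c) j.+1) =
  fun _ k => qpoch (k%:R + c) j * qnum (k%:R + (c + j%:R)).
  by apply/funext => _; apply/funext => k; rewrite -addn1 qpochD qpoch1 addrA.
exact: exp_poly_mul IH (exp_poly_qnum _).
Qed.

Lemma hol_qpow (al be : C) : holomorphic (fun lam => qpow (al * lam + be)).
Proof.
have -> : (fun lam => qpow (al * lam + be)) =
  fun lam => cexp (cpi R * 'i * eta * al * lam + cpi R * 'i * eta * be).
  by apply/funext => lam; rewrite /Defs.qpow mulrDr mulrA.
exact: hol_cexp.
Qed.

Lemma hol_qnum (c : C) : holomorphic (fun lam => qnum (- lam + c)).
Proof.
have -> : (fun lam => qnum (- lam + c)) = fun lam =>
    (qpow 1 - qpow (- 1))^-1 * (qpow ((-1) * lam + c) + -1 * qpow (1 * lam + - c)).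
  by apply/funext => lam; rewrite /Defs.qnum opprD opprK mul1r mulN1r mulN1r mulrC.
exact (@hol_scale _ _ _ (@hol_add _ _ _ (@hol_qpow (-1) c) (@hol_scale _ (-1) _ (@hol_qpow 1 (-c))))).
Qed.

Lemma hol_hwc (m i p : nat) : holomorphic (fun kap => hw_coef eta kap m i p).
Proof.
have -> : (fun kap => hw_coef eta kap m i p) = fun kap =>
   ((i + p == m)%N%:R * \prod_(t < i) qnum (m%:R - t%:R)) *
   (qpow (i%:R * kap + - (i%:R * i%:R)) * \prod_(t < p) qnum (- kap + (i%:R + 1 + t%:R))).
  apply/funext => kap; rewrite /hw_coef /Defs.qpoch mulrBr.
  have -> : \prod_(i0 < p) qnum (- kap + i%:R + 1 + i0%:R) =
     \prod_(t < p) qnum (- kap + (i%:R + 1 + t%:R)).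
    by apply: eq_bigr => t _; rewrite !addrA.
  by ring.
exact (@hol_scale _ _ _ (@hol_mul _ _ _ (@hol_qpow _ _) (@hol_prod _ _ _ (fun t => @hol_qnum _)))).
Qed.

End ExponentialPolynomials.

(** * Powers of F on the tensor product *)

Section MatrixElements.
Variables (R : realType) (eta : Cx R).
Hypothesis eta_gt0 : 0 < 'Im eta.
Local Notation C := (Cx R).
Local Notation qpow := (qpow eta).
Local Notation qnum := (qnum eta).
Local Notation qpoch := (qpoch eta).
Local Notation qfact := (qfact eta).
Local Notation cF := (tensF_coef eta).

Lemma cFE L t (i p : nat) : cF L t i p =
  (if i is i'.+1 then qnum i%:R * qpow (- (L - (2 * p)%:R)) * t i' p else 0)
  + (if p is p'.+1 then qnum (L - p'%:R) * t i p' else 0).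
Proof. by []. Qed.

(** F^k/[k]! (v^{(i0)} (x) u_{p0}) is the sum of Fpow_coef k b v^{(i0+k-b)} (x) u_{p0+b} over
    b <= k: the q-binomial theorem for F (x) q^{-h} + 1 (x) F, whose summands commute
    up to a power of q.  The form chosen makes the dependence on k for fixed b
    visibly an exponential polynomial. *)
Definition Fpow_coef (L : C) (i0 p0 k b : nat) : C :=
  qpoch (k%:R + (1 - b%:R)) i0 * ((qfact i0)^-1 * (\prod_(t < b) qnum (L - p0%:R - t%:R) / qfact b)
    * qpow (b%:R * (L - (2 * p0)%:R - b%:R))) * qpow (- (L - (2 * p0)%:R - b%:R) * k%:R).

Lemma Fpow_coef00 L i0 p0 : Fpow_coef L i0 p0 0 0 = 1.
Proof.
have q0 : qfact 0 = 1 by exact: big_ord0.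
have E : qpoch (0%:R + 1) i0 = qfact i0.
  by have := qfactD eta 0 i0; rewrite add0n q0 mul1r.
rewrite /Fpow_coef subr0 E big_ord0 q0 divr1 mul0r mulr0 qpow0 !mulr1 divff //.
exact: qfact_neq0.
Qed.

Lemma Fpow_coef_rec0 L i0 p0 k : qnum k.+1%:R * Fpow_coef L i0 p0 k.+1 0 =
  qnum (i0 + k).+1%:R * qpow (- (L - (2 * p0)%:R)) * Fpow_coef L i0 p0 k 0.
Proof.
rewrite /Fpow_coef !subr0 mul0r qpow0.
have E : qnum k.+1%:R * qpoch (k.+1%:R + 1) i0 = qnum (i0 + k).+1%:R * qpoch (k%:R + 1) i0.
  have := qpochD eta (k%:R + 1) i0 1; rewrite addn1 qpochS natr1 qpoch1 => ->.
  by rewrite mulrC; congr (qnum _ * _); rewrite -!natr1 natrD; ring.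
have -> : qpow (- (L - (2 * p0)%:R) * k.+1%:R) =
    qpow (- (L - (2 * p0)%:R)) * qpow (- (L - (2 * p0)%:R) * k%:R).
  by rewrite -qpowD -natr1; congr qpow; ring.
set A := qpoch (k.+1%:R + 1) i0 in E *; set B := qpoch (k%:R + 1) i0 in E *.
set x := _^-1 * _ * 1; set q1 := qpow _; set q2 := qpow _.
transitivity ((qnum k.+1%:R * A) * x * q1 * q2); first by ring.
by rewrite E; ring.
Qed.

(** One more application of F.  Once the powers of q are collected, this is
    [k+1] = q^{-(k-b)} [b+1] + q^{b+1} [k-b]. *)
Lemma Fpow_coef_rec L i0 p0 k b : qnum k.+1%:R * Fpow_coef L i0 p0 k.+1 b.+1 =
  qnum (i0%:R + (k%:R - b%:R)) * qpow (- (L - (2 * (p0 + b.+1))%:R)) * Fpow_coef L i0 p0 k b.+1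
  + qnum (L - (p0 + b)%:R) * Fpow_coef L i0 p0 k b.
Proof.
rewrite /Fpow_coef.
have -> : k.+1%:R + (1 - b.+1%:R) = k%:R - b%:R + 1 :> C by rewrite -!natr1; ring.
have -> : k%:R + (1 - b.+1%:R) = k%:R - b%:R :> C by rewrite -!natr1; ring.
have -> : k%:R + (1 - b%:R) = k%:R - b%:R + 1 :> C by ring.
have E : qnum (i0%:R + (k%:R - b%:R)) * qpoch (k%:R - b%:R) i0 =
    qnum (k%:R - b%:R) * qpoch (k%:R - b%:R + 1) i0.
  have := qpochD eta (k%:R - b%:R) i0 1; rewrite addn1 qpochS qpoch1 => ->.
  by rewrite [RHS]mulrC; congr (qnum _ * _); ring.
set A := qpoch (k%:R - b%:R + 1) i0 in E *; set B := qpoch (k%:R - b%:R) i0 in E *.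
rewrite big_ord_recr /= qfactS.
have -> : L - p0%:R - b%:R = L - (p0 + b)%:R by rewrite natrD; ring.
set D := \prod_(t < b) _; set d := qnum (L - (p0 + b)%:R).
have b0 : qnum b.+1%:R != 0 := qnum_nat_neq0 eta_gt0 b.
have f0 : qfact b != 0 := qfact_neq0 eta_gt0 b.
have i0f : qfact i0 != 0 := qfact_neq0 eta_gt0 i0.
pose X := qpow (- ((k%:R - b%:R) * (L - (2 * p0)%:R - b.+1%:R))).
have E1 : qpow (b.+1%:R * (L - (2 * p0)%:R - b.+1%:R)) *
    qpow (- (L - (2 * p0)%:R - b.+1%:R) * k.+1%:R) = X.
  by rewrite -qpowD /X; congr qpow; rewrite -!natr1; ring.
have E2 : qpow (- (L - (2 * (p0 + b.+1))%:R)) * (qpow (b.+1%:R * (L - (2 * p0)%:R - b.+1%:R)) *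
    qpow (- (L - (2 * p0)%:R - b.+1%:R) * k%:R)) = X * qpow b.+1%:R.
  by rewrite -!qpowD /X; congr qpow; rewrite !natrM natrD -!natr1; ring.
have E3 : qpow (b%:R * (L - (2 * p0)%:R - b%:R)) *
    qpow (- (L - (2 * p0)%:R - b%:R) * k%:R) = X * qpow (- (k%:R - b%:R)).
  by rewrite -!qpowD /X; congr qpow; rewrite -!natr1; ring.
have E4 : qnum k.+1%:R = qpow (- (k%:R - b%:R)) * qnum b.+1%:R + qpow b.+1%:R * qnum (k%:R - b%:R).
  by rewrite qnum_split; congr qnum; rewrite -!natr1; ring.
move: E1 E2 E3 E4 E.
set y1 := qpow (b.+1%:R * _); set y2 := qpow (_ * k.+1%:R); set y3 := qpow (- (L - _)).
set y4 := qpow (- (L - (2 * p0)%:R - b.+1%:R) * k%:R); set y5 := qpow (b%:R * _).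
set y6 := qpow (- (L - (2 * p0)%:R - b%:R) * k%:R).
set z1 := qpow b.+1%:R; set z2 := qpow (- (k%:R - b%:R)).
set n1 := qnum k.+1%:R; set n2 := qnum (i0%:R + _); set n3 := qnum (k%:R - b%:R).
rewrite -/(qnum b.+1%:R) in b0 *; set nb := qnum b.+1%:R in b0 *.
move=> E1 E2 E3 E4 E.
transitivity (n1 * (A / qfact i0 * (D * d / (qfact b * nb))) * (y1 * y2)); first by ring.
transitivity ((n2 * B) / qfact i0 * (D * d / (qfact b * nb)) * (y3 * (y1 * y4))
  + d * A / qfact i0 * (D / qfact b) * (y5 * y6)); last by ring.
rewrite E1 E2 E3 E E4; field.
by rewrite b0 f0 i0f.
Qed.

Definition delta (i0 p0 i p : nat) : C := ((i == i0) && (p == p0))%:R.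

Lemma iter_cF_lowi L i0 p0 k i p : (i < i0)%N -> iter k (cF L) (delta i0 p0) i p = 0.
Proof.
elim: k i p => [|k IH] i p ii0; first by rewrite /= /delta ltn_eqF.
rewrite iterS cFE; have -> : (if i is i'.+1 then qnum i%:R * qpow (- (L - (2 * p)%:R)) *
   iter k (cF L) (delta i0 p0) i' p else 0) = 0.
  by case: i ii0 => // i ii0; rewrite IH ?mulr0 // ltnW.
by case: p => [|p]; rewrite add0r // IH // mulr0.
Qed.

Lemma iter_cF_lowp L i0 p0 k i p : (p < p0)%N -> iter k (cF L) (delta i0 p0) i p = 0.
Proof.
elim: k i p => [|k IH] i p pp0; first by rewrite /= /delta (ltn_eqF pp0) andbF.
rewrite iterS cFE; have -> : (if p is p'.+1 then qnum (L - p'%:R) *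
   iter k (cF L) (delta i0 p0) i p' else 0) = 0.
  by case: p pp0 => // p pp0; rewrite IH ?mulr0 // ltnW.
by case: i => [|i]; rewrite addr0 // IH // mulr0.
Qed.

Lemma iter_cF_delta L i0 p0 k b : (b <= k)%N ->
  iter k (cF L) (delta i0 p0) (i0 + (k - b))%N (p0 + b)%N = qfact k * Fpow_coef L i0 p0 k b.
Proof.
elim: k b => [|k IH] b.
  by rewrite leqn0 => /eqP ->; rewrite Fpow_coef00 /= /delta !addn0 !eqxx mulr1 /Defs.qfact big_ord0.
move=> bk; rewrite iterS qfactS -mulrA; case: b bk => [_|b bk].
  rewrite Fpow_coef_rec0 subn0 addn0 addnS cFE.
  have -> : (if p0 is p'.+1 then qnum (L - p'%:R) *
    iter k (cF L) (delta i0 p0) (i0 + k).+1 p' else 0) = 0.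
    by case: (p0) => // p'; rewrite iter_cF_lowp // mulr0.
  have := IH 0%N (leq0n k); rewrite subn0 addn0 => ->.
  by ring.
rewrite Fpow_coef_rec mulrDr subSS addnS cFE; congr (_ + _); last first.
  by rewrite IH //; ring.
case: (ltnP b k) => bk'.
  have -> : (i0 + (k - b) = (i0 + (k - b.+1)).+1)%N by lia.
  rewrite -(addnS p0 b) IH //.
  have -> : (i0 + (k - b.+1)).+1%:R = i0%:R + (k%:R - b%:R) :> C.
    by rewrite -natr1 natrD natrB // -natr1; ring.
  by ring.
have -> : b = k by apply/eqP; rewrite eqn_leq bk' andbT -ltnS.
rewrite subnn addn0 subrr addr0.
rewrite (_ : match i0 with 0%N => _ | _.+1 => _ end = 0); last first.
  by case: (i0) => // i'; rewrite iter_cF_lowi // mulr0.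
rewrite /Fpow_coef; case: i0 {IH} => [|i0]; first by rewrite qnum0 !(mul0r, mulr0).
have -> : k%:R + (1 - k.+1%:R) = 0 :> C by rewrite -natr1; ring.
by rewrite qpochS qnum0 !(mul0r, mulr0).
Qed.

(** Expansion of a vector of weight m in the basis, by linearity of F. *)
Lemma iter_cF_decomp L (m k : nat) t i p : (forall i p, (i + p)%N != m -> t i p = 0) ->
  iter k (cF L) t i p =
  \sum_(j < m.+1) t j (m - j)%N * iter k (cF L) (delta j (m - j)) i p.
Proof.
move=> tm; elim: k i p => [|k IH] i p.
  case: (eqVneq (i + p)%N m) => [ipm|ne].
    have im : (i < m.+1)%N by lia.
    rewrite (bigD1 (Ordinal im)) //= big1 ?addr0 => [|j ji].
      have -> : (m - i = p)%N by lia.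
      by rewrite /delta !eqxx mulr1.
    rewrite /delta (_ : (i == j) = false) ?mulr0 //; apply/negbTE.
    by apply: contraNneq ji => ij; apply/eqP/val_inj.
  rewrite /= tm // big1 // => j _.
  rewrite /delta (_ : (i == j :> nat) && (p == m - j)%N = false) ?mulr0 //.
  apply/negbTE/negP => /andP[/eqP ij /eqP pj]; have := ltn_ord j; move/eqP: ne; lia.
rewrite iterS (eq_cF eta L IH) cFE.
rewrite [RHS](_ : _ = \sum_(j < m.+1) (
  (if i is i'.+1 then qnum i%:R * qpow (- (L - (2 * p)%:R)) *
     (t j (m - j)%N * iter k (cF L) (delta j (m - j)) i' p) else 0) +
  (if p is p'.+1 then qnum (L - p'%:R) *
     (t j (m - j)%N * iter k (cF L) (delta j (m - j)) i p') else 0))); last first.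
  apply: eq_bigr => j _; rewrite iterS cFE.
  by case: i => [|i]; case: p => [|p]; ring.
rewrite big_split /=; congr (_ + _).
  by case: i => [|i]; [rewrite big1|rewrite mulr_sumr].
by case: p => [|p]; [rewrite big1|rewrite mulr_sumr].
Qed.

End MatrixElements.

(** * Diagonal matrix elements as exponential polynomials *)

Section TraceTerms.
Variables (R : realType) (eta : Cx R).
Hypothesis eta_gt0 : 0 < 'Im eta.
Local Notation C := (Cx R).
Local Notation qfact := (qfact eta).
Local Notation cF := (tensF_coef eta).
Local Notation hwc := (hw_coef eta).
Local Notation phic := (Phi_coef eta).
Local Notation cPhi := (mPhi_coef eta).
Local Notation exp_poly := (exp_poly eta).

Lemma phic_decomp L kap m k i p : phic L kap m k i p =
  (qfact k)^-1 * \sum_(j < m.+1) hwc kap m j (m - j) * iter k (cF L) (delta R j (m - j)) i p.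
Proof.
rewrite /Phi_coef (@iter_cF_decomp _ _ eta_gt0 L m) // => i' p'; exact: hwc_wt.
Qed.

(** In Phi_coef only the highest weight coefficients depend on kap. *)
Lemma hol_phic L m k i p : holomorphic (fun kap => phic L kap m k i p).
Proof.
have -> : (fun kap => phic L kap m k i p) = fun kap => (qfact k)^-1 *
    \sum_(j < m.+1) hwc kap m j (m - j) * iter k (cF L) (delta R j (m - j)) i p.
  by apply/funext => kap; exact: phic_decomp.
exact (@hol_scale _ _ _ (@hol_sum _ _ _ _ _ (fun j : 'I_m.+1 =>
  @hol_mul _ _ _ (@hol_hwc _ eta m j (m - j)) (@hol_cst _ _)))).
Qed.

Lemma exp_poly_Fpow_coef L i0 p0 b : exp_poly (fun _ k => Fpow_coef eta L i0 p0 k b).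
Proof.
exact (exp_poly_mul (exp_poly_mul (exp_poly_qpoch eta (1 - b%:R) i0) (exp_poly_cst eta _)) (exp_poly_qpow eta _)).
Qed.

(** For a fixed p the weight fixes the difference of the other two indices.  Shifting
    k by p ensures that the index b of [Fpow_coef], at most p, does not exceed k. *)
Lemma exp_poly_phic L m p : exp_poly (fun kap k => phic L kap m (k + p) (k + m) p).
Proof.
have -> : (fun kap k => phic L kap m (k + p) (k + m) p) = fun kap k =>
   \sum_(j < m.+1) hwc kap m j (m - j) *
     (if (m - j <= p)%N then Fpow_coef eta L j (m - j) (k + p) (p - (m - j)) else 0).
  apply/funext => kap; apply/funext => k; rewrite phic_decomp mulr_sumr.
  apply: eq_bigr => j _; rewrite mulrCA; congr (_ * _).
  have jm : (j <= m)%N by rewrite -ltnS.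
  case: leqP => mjp; last by rewrite iter_cF_lowp ?mulr0.
  have := @iter_cF_delta _ _ eta_gt0 L j (m - j) (k + p) (p - (m - j)) ltac:(lia).
  have -> : (j + (k + p - (p - (m - j))) = k + m)%N by lia.
  have -> : (m - j + (p - (m - j)) = p)%N by lia.
  by move=> ->; rewrite mulKf // qfact_neq0.
apply: exp_poly_sum => j; apply: (@exp_poly_mul _ _ (fun kap _ => hwc kap m j (m - j))).
  exact: (exp_poly_hol eta (@hol_hwc _ eta m j (m - j))).
case: leqP => _; last exact: exp_poly_cst.
exact: (exp_poly_addn p (exp_poly_Fpow_coef L j (m - j) (p - (m - j)))).
Qed.

Lemma hol_cPhi n (L : n.-tuple C) m k k' w : holomorphic (fun lam => cPhi L m lam k k' w).
Proof.
elim: n L m k k' w => [|n IH] L m k k' w; first exact: (@hol_cst _ _).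
have -> : (fun lam => cPhi L m lam k k' w) = fun lam =>
  if (tnth w ord_max <= k + tnth m ord_max)%N then
    phic (tnth L ord_max) (lam + (- tnth L ord_max + (2 * tnth m ord_max)%:R)) (tnth m ord_max) k
      (k + tnth m ord_max - tnth w ord_max) (tnth w ord_max)
    * cPhi (tinit L) (tinit m) (lam + (- tnth L ord_max + (2 * tnth m ord_max)%:R))
      (k + tnth m ord_max - tnth w ord_max) k' (tinit w)
  else 0.
  by apply/funext => lam; rewrite cPhiS /= !addrA.
case: leqP => _; last exact: (@hol_cst _ _).
exact (@hol_mul _ _ _ (@hol_shift _ _ _ (@hol_phic _ _ _ _ _)) (@hol_shift _ _ _ (@IH _ _ _ _ _))).
Qed.

(** The intermediate index k + a + m_n - w_n is again k plus a constant, so that the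
    induction needs independent offsets of the two indices.  The shift of k by
    p = w_n keeps this index from being truncated at 0. *)
Lemma exp_poly_cPhi n (L : n.-tuple C) m (a b : nat) w :
  exp_poly (fun lam k => cPhi L m lam (k + a) (k + b) w).
Proof.
elim: n L m a b w => [|n IH] L m a b w.
  have -> : (fun lam k => cPhi L m lam (k + a) (k + b) w) = fun _ _ => (a == b)%:R.
    by apply/funext => lam; apply/funext => k; rewrite cPhi0 eqn_add2l.
  exact: exp_poly_cst.
set p := tnth w ord_max; set mn := tnth m ord_max; set Ln := tnth L ord_max.
apply: (@exp_poly_subn _ _ _ p) => [k|]; first exact: (@hol_cPhi _ _ _ _ _ _).
have -> : (fun lam k => cPhi L m lam (k + p + a) (k + p + b) w) = fun lam k =>
   phic Ln (lam + (- Ln + (2 * mn)%:R)) mn ((k + a) + p) ((k + a) + mn) p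
   * cPhi (tinit L) (tinit m) (lam + (- Ln + (2 * mn)%:R)) (k + (a + mn)) (k + (p + b)) (tinit w).
  apply/funext => lam; apply/funext => k; rewrite cPhiS /= -/p -/mn -/Ln !addrA.
  have -> : (p <= k + p + a + mn)%N by lia.
  have -> : (k + p + a + mn - p = k + a + mn)%N by lia.
  have -> : (k + p + a = k + a + p)%N by lia.
  by rewrite (addnA k a mn) (addnA k p b).
exact (exp_poly_mul (exp_poly_shift (- Ln + (2 * mn)%:R) (exp_poly_addn a (exp_poly_phic Ln mn p)))
  (exp_poly_shift (- Ln + (2 * mn)%:R) (IH _ _ (a + mn)%N (p + b)%N _))).
Qed.

Lemma exp_poly_diag n (L : n.-tuple C) m w : exp_poly (fun lam k => cPhi L m lam k k w).
Proof.
have := exp_poly_cPhi L m 0 0 w.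
have -> : (fun lam k => cPhi L m lam (k + 0) (k + 0) w) = fun lam k => cPhi L m lam k k w.
  by apply/funext => lam; apply/funext => k; rewrite !addn0.
exact.
Qed.

End TraceTerms.

(** * Summation of the trace *)

Section TraceFunction.
Variables (R : realType) (eta : Cx R).
Hypothesis eta_gt0 : 0 < 'Im eta.
Local Notation C := (Cx R).
Local Notation qpow := (qpow eta).
Local Notation cPhi := (mPhi_coef eta).

Lemma qpowMn (z : C) n : qpow (z * n%:R) = qpow z ^+ n.
Proof.
elim: n => [|n IH]; first by rewrite mulr0 qpow0 expr0.
by rewrite -natr1 mulrDr mulr1 qpowD IH exprSr.
Qed.

Lemma cvgC_sum (I : Type) (r : seq I) (u : I -> nat -> C) (l : I -> C) :
  (forall i, u i @ \oo --> l i) ->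
  (fun n => \sum_(i <- r) u i n) @ \oo --> \sum_(i <- r) l i.
Proof.
move=> ul; elim: r => [|i r IH].
  rewrite big_nil; apply: (@cvgC_near _ (fun=> 0) _ _ 0%N); last exact: cvgC_cst.
  by move=> n _; rewrite big_nil.
rewrite big_cons; apply: (@cvgC_near _ _ _ _ 0%N _ (cvgC_add (ul i) IH)) => n _.
by rewrite big_cons.
Qed.

Lemma cvgC_geom (y : C) : nm y < 1 -> (fun n => \sum_(k < n) y ^+ k) @ \oo --> (1 - y)^-1.
Proof.
move=> y1; have ny : 1 - y != 0.
  by rewrite subr_eq0; apply: contraTneq y1 => <-; rewrite nm1 ltxx.
have yn : (fun n => y ^+ n) @ \oo --> (0 : C).
  apply: (@cvgC_small _ _ (fun n => nm y ^+ n)) => [n|]; first by rewrite nmX.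
  by apply: cvg_expr; rewrite ger0_norm // nm_ge0.
have H := cvgC_Zl (1 - y)^-1 (cvgC_sub (cvgC_cst 1) yn).
rewrite subr0 mulr1 in H; apply: (@cvgC_near _ _ _ _ 0%N _ H) => n _.
have := subrX1 y n; set S := \sum_(k < n) _ => E.
have -> : 1 - y ^+ n = (1 - y) * S by rewrite -[LHS]opprB E; ring.
by rewrite mulKf.
Qed.

(** The value of the trace at lam of the operator with diagonal elements F lam k that
    satisfy the formula of [exp_poly] for k >= K: the geometric series summed from
    k = 0, corrected in the terms k < K. *)
Definition trace_val (K : nat) (I : finType) (be : I -> C) (a : I -> C -> C) (F : C -> nat -> C)
    (lam x : C) : C :=
  \sum_(k < K) (F lam k - \sum_(i : I) a i lam * qpow (be i * k%:R))
     * qpow (x * lam + - ((1 + (2 * k)%:R) * x))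
  + \sum_(i : I) a i lam * (qpow (x * lam + - x) / (1 - qpow (be i - 2 * x))).

Lemma cvg_trace_val K (I : finType) (be : I -> C) a (F : C -> nat -> C) (lam x : C) :
  (forall k, (K <= k)%N -> F lam k = \sum_(i : I) a i lam * qpow (be i * k%:R)) ->
  (forall i, nm (qpow (be i - 2 * x)) < 1) ->
  series (fun k => F lam k * qpow ((lam - 1 - (2 * k)%:R) * x)) @ \oo --> trace_val K be a F lam x.
Proof.
move=> EF be1.
have qE k : qpow ((lam - 1 - (2 * k)%:R) * x) = qpow (x * lam + - ((1 + (2 * k)%:R) * x)).
  by congr qpow; ring.
pose c := \sum_(k < K) (F lam k - \sum_(i : I) a i lam * qpow (be i * k%:R))
     * qpow (x * lam + - ((1 + (2 * k)%:R) * x)).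
have H1 : (fun n => \sum_(i : I) a i lam * (qpow (x * lam + - x) *
    \sum_(k < n) qpow (be i - 2 * x) ^+ k)) @ \oo -->
    \sum_(i : I) a i lam * (qpow (x * lam + - x) / (1 - qpow (be i - 2 * x))).
  apply: cvgC_sum => i; apply: cvgC_Zl; apply: cvgC_Zl; exact: cvgC_geom.
apply: (@cvgC_near _ _ _ _ K _ (cvgC_add (cvgC_cst c) H1)) => n Kn.
rewrite /series /= (big_cat_nat (leq0n K) Kn) /= big_mkord.
have E2 : \sum_(K <= k < n) F lam k * qpow ((lam - 1 - (2 * k)%:R) * x) =
   \sum_(K <= k < n) (\sum_(i : I) a i lam * qpow (be i * k%:R)) *
      qpow (x * lam + - ((1 + (2 * k)%:R) * x)).
  by rewrite !big_nat; apply: eq_bigr => k /andP[Kk _]; rewrite EF // qE.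
rewrite E2.
have E3 : \sum_(i : I) a i lam * (qpow (x * lam + - x) * \sum_(k < n) qpow (be i - 2 * x) ^+ k)
  = \sum_(0 <= k < n) (\sum_(i : I) a i lam * qpow (be i * k%:R)) *
      qpow (x * lam + - ((1 + (2 * k)%:R) * x)).
  transitivity (\sum_(i : I) \sum_(0 <= k < n) a i lam * qpow (be i * k%:R) *
      qpow (x * lam + - ((1 + (2 * k)%:R) * x))).
    apply: eq_bigr => i _; rewrite big_mkord !mulr_sumr; apply: eq_bigr => k _.
    rewrite -mulrA -qpowMn -!qpowD; congr (_ * qpow _); rewrite natrM; ring.
  by rewrite exchange_big; apply: eq_bigr => k _; rewrite mulr_suml.
rewrite E3 (big_cat_nat (leq0n K) Kn) /= addrA; congr (_ + _).
rewrite /c big_mkord -big_split /=; apply: eq_bigr => k _; rewrite qE; ring.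
Qed.

Lemma hol_trace_val K (I : finType) (be : I -> C) a (F : C -> nat -> C) (x : C) :
  (forall k, holomorphic (fun lam => F lam k)) -> (forall i, holomorphic (a i)) ->
  holomorphic (fun lam => trace_val K be a F lam x).
Proof.
move=> hF ha.
have h1 k : holomorphic (fun lam => F lam k - \sum_(i : I) a i lam * qpow (be i * k%:R)).
  have -> : (fun lam => F lam k - \sum_(i : I) a i lam * qpow (be i * k%:R)) =
    fun lam => F lam k + -1 * \sum_(i : I) a i lam * qpow (be i * k%:R).
    by apply/funext => lam; rewrite mulN1r.
  exact (@hol_add _ _ _ (hF k) (@hol_scale _ _ _ (@hol_sum _ _ _ _ _
    (fun i => @hol_mul _ _ _ (ha i) (@hol_cst _ _))))).
exact (@hol_add _ _ _ (@hol_sum _ _ _ _ _ (fun k : 'I_K => @hol_mul _ _ _ (h1 k) (@hol_qpow _ eta x _)))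
  (@hol_sum _ _ _ _ _ (fun i => @hol_mul _ _ _ (ha i)
     (@hol_mul _ _ _ (@hol_qpow _ eta x _) (@hol_cst _ _))))).
Qed.

(** Meromorphic continuation of a formula T that may divide by 0: its values at the
    points that are not good are meaningless. *)
Definition mero_ext (good : C -> Prop) (T : C -> C) : Prop :=
  exists2 g : C -> C, meromorphic g & forall x, good x -> g x = T x.

Lemma mero_ext_lincomb good (c d : C) T T' : mero_ext good T -> mero_ext good T' ->
  mero_ext good (fun x => c * T x + d * T' x).
Proof.
move=> [g mg Hg] [g' mg' Hg']; exists (fun x => c * g x + d * g' x).
  exact: meromorphic_lincomb.
by move=> x gx; rewrite Hg // Hg'.
Qed.

Lemma mero_ext_eq good T T' : (forall x, good x -> T x = T' x) -> mero_ext good T -> mero_ext good T'.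
Proof. by move=> TT' [g mg Hg]; exists g => // x gx; rewrite Hg // TT'. Qed.

Lemma qpow_cexp (z : C) : qpow z = cexp (cpi R * 'i * eta * z).
Proof. by []. Qed.

Lemma mero_ext_qpow good (al : C) : mero_ext good (fun x => qpow (al * x)).
Proof.
exists (fun x => cexp ((cpi R * 'i * eta * al) * x)); first exact: meromorphic_cexp.
by move=> x _; rewrite qpow_cexp mulrA.
Qed.

Lemma mero_ext_sum good (I : Type) (r : seq I) (c : I -> C) (T : I -> C -> C) :
  (forall i, mero_ext good (T i)) -> mero_ext good (fun x => \sum_(i <- r) c i * T i x).
Proof.
move=> HT; elim: r => [|i r IH].
  apply: (@mero_ext_eq _ (fun x => 0 * qpow (0 * x) + 0 * qpow (0 * x))).
    by move=> x _; rewrite big_nil !mul0r addr0.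
  by apply: mero_ext_lincomb; exact: mero_ext_qpow.
apply: (mero_ext_eq _ (mero_ext_lincomb (c i) 1 (HT i) IH)) => x _.
by rewrite big_cons mul1r.
Qed.

Lemma pi_i_eta_neq0 : cpi R * 'i * eta != 0.
Proof.
rewrite !mulf_neq0 //.
- rewrite /cpi; apply/eqP => /(congr1 (@complex.Re R)) /= /eqP.
  by rewrite gt_eqF // pi_gt0.
- exact: neq0Ci.
by apply: contraTneq eta_gt0 => ->; rewrite raddf0 ltxx.
Qed.

Lemma mero_ext_qpow_div (good : C -> Prop) (al be : C) :
  (forall x, good x -> qpow (be - 2 * x) != 1) ->
  mero_ext good (fun x => qpow (al * x) / (1 - qpow (be - 2 * x))).
Proof.
move=> gb; set e := cpi R * 'i * eta.
have e0 : -2 * e != 0 by rewrite mulf_neq0 ?pi_i_eta_neq0 // oppr_eq0 pnatr_eq0.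
have [g mg Hg] := meromorphic_cexp_div (e * al) (e * be) e0.
have E x : -2 * e * x + e * be = e * (be - 2 * x) by ring.
exists g => // x /gb; rewrite qpow_cexp -/e -E => ne.
by rewrite Hg // E !qpow_cexp -/e mulrA.
Qed.

(** [trace_val] with the prefactor in the definition of the trace functions. *)
Definition norm_trace_val (M K : nat) (I : finType) (be : I -> C) (a : I -> C -> C) (F : C -> nat -> C)
    (lam x : C) : C :=
  qpow (- ((M * M.+1)%:R / 2)) * (qpow 1 - qpow (- 1)) ^+ M * (qpow x - qpow (- x))
    * trace_val K be a F lam x.

(** The product with q^x - q^{-x} is expanded into exponentials, so that only closure
    under linear combinations is needed, and no product of meromorphic functions. *)
Lemma mero_ext_norm_trace_val M K (I : finType) (be : I -> C) a F lam :
  mero_ext (fun x => forall i, qpow (be i - 2 * x) != 1) (norm_trace_val M K be a F lam).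
Proof.
set good := fun x => _.
set c0 := qpow (- ((M * M.+1)%:R / 2)) * (qpow 1 - qpow (- 1)) ^+ M.
pose T1 x := \sum_(k < K) (F lam k - \sum_(i : I) a i lam * qpow (be i * k%:R))
   * (1 * qpow ((lam - (2 * k)%:R) * x) + (-1) * qpow ((lam - 2 - (2 * k)%:R) * x)).
pose T2 x := \sum_(i : I) a i lam * (1 * (qpow (lam * x) / (1 - qpow (be i - 2 * x)))
   + (-1) * (qpow ((lam - 2) * x) / (1 - qpow (be i - 2 * x)))).
have H1 : mero_ext good T1.
  by apply: mero_ext_sum => k; apply: mero_ext_lincomb; exact: mero_ext_qpow.
have H2 : mero_ext good T2.
  apply: mero_ext_sum => i; apply: mero_ext_lincomb; apply: mero_ext_qpow_div => x; exact.
apply: (mero_ext_eq _ (mero_ext_lincomb c0 c0 H1 H2)) => x _.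
rewrite /norm_trace_val -/c0 /trace_val -mulrDr -[in RHS]mulrA; congr (_ * _); rewrite mulrDr; congr (_ + _).
  rewrite mulr_sumr; apply: eq_bigr => k _; rewrite mulrCA; congr (_ * _).
  by rewrite mul1r mulN1r [RHS]mulrBl -!qpowD; congr (qpow _ - qpow _); ring.
rewrite mulr_sumr; apply: eq_bigr => i _.
have E : (qpow x - qpow (- x)) * qpow (x * lam + - x) = qpow (lam * x) - qpow ((lam - 2) * x).
  by rewrite mulrBl -!qpowD; congr (qpow _ - qpow _); ring.
by rewrite [RHS]mulrCA [in RHS](mulrA (qpow x - _)) E; ring.
Qed.

Lemma lin_ext_bas (I : choiceType) (J : choiceType) (f : I -> {malg C[J]}) i :
  lin_ext f (bas R i) = f i.
Proof. by apply/malgP => j; rewrite !lcoefE lcoef_lin_ext_bas. Qed.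

(** v^{(k)} has weight lam - 1 - 2k in M_{lam-1}. *)
Lemma has_traceE n (L : n.-tuple C) m w lam x t :
  has_trace (mPhi eta L m lam \o actK (verma eta (lam - 1)) x) w t <->
  series (fun k => cPhi L m lam k k w * qpow ((lam - 1 - (2 * k)%:R) * x)) @ \oo --> t.
Proof.
rewrite /has_trace.
have -> : (fun k => ((mPhi eta L m lam \o actK (verma eta (lam - 1)) x) (bas R k))@_(k, w)) =
  (fun k => cPhi L m lam k k w * qpow ((lam - 1 - (2 * k)%:R) * x)) => //.
apply/funext => k; apply: etrans (lcoefE _ _) _.
have -> : (mPhi eta L m lam \o actK (verma eta (lam - 1)) x) (bas R k) =
  mPhi eta L m lam (qpow ((lam - 1 - (2 * k)%:R) * x) *: bas R k).
  by rewrite /comp; congr (mPhi _ _ _ _ _); exact: lin_ext_bas.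
by rewrite lcoef_mPhiZ // mulrC.
Qed.

End TraceFunction.

(** * The trace function *)

Section Continuation.
Variables (R : realType) (eta : Cx R).
Hypothesis eta_gt0 : 0 < 'Im eta.
Local Notation C := (Cx R).
Local Notation qpow := (qpow eta).
Local Notation cPhi := (mPhi_coef eta).

(** The region |q^{2z}| > r contains a disc, from which the identity theorem can
    start. *)
Lemma qpow_large (r : R) : exists (u : C) (e : R), 0 < e /\
  forall z, nm (z - u) < e -> r < nm (qpow (2 * z)).
Proof.
pose w : C := cpi R * 'i * eta * 2.
have w0 : w != 0 by rewrite mulf_neq0 ?(pi_i_eta_neq0 eta_gt0) // pnatr_eq0.
(* on this disc the exponent w z has real part greater than |r|, since
   |w (z - u)| < 1 *)
exists ((1 + `|r|)%:C%C / w), (nm w)^-1; split; first by rewrite invr_gt0 nm_gt0.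
move=> z zu; set y := z - _ in zu.
have E : cpi R * 'i * eta * (2 * z) = (1 + `|r|)%:C%C + w * y.
  by rewrite mulrA -/w /y mulrBr mulrC [w * (_ / w)]mulrC divfK // mulrC; ring.
have -> : nm (qpow (2 * z)) = expR (1 + `|r| + complex.Re (w * y)).
  apply: complexI; rewrite -normE /Defs.qpow E norm_cexp.
  by congr ((expR _)%:C%C); case: (w * y).
have y1 : nm (w * y) < 1.
  by rewrite nmM -ltr_pdivlMl ?nm_gt0 // mulr1.
have Rey : `|complex.Re (w * y)| <= nm (w * y).
  by rewrite -lecR -normE normc_ge_Re.
have := expR_ge1Dx (1 + `|r| + complex.Re (w * y)).
have := ler_norm r; have := ler_norm (- complex.Re (w * y)); rewrite normrN; lra.
Qed.

Lemma is_trace_fun_unique n (L : n.-tuple C) M m m' (lam : C) f g :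
  is_trace_fun eta L M m m' lam f -> is_trace_fun eta L M m m' lam g -> f =1 g.
Proof.
move=> [mf [r Hf]] [mg [r' Hg]].
have [u [e [e0 He]]] := qpow_large (Num.max r r').
apply: (identity_theorem mf mg e0) => z /He; rewrite gt_max => /andP[rz r'z].
have [|t Ht ->] := Hf z; first by rewrite normE ltcR.
have [|t' Ht' ->] := Hg z; first by rewrite normE ltcR.
by rewrite (cvgC_unique Ht Ht').
Qed.

Lemma trace_funE n (L : n.-tuple C) M m m' (lam : C) f :
  is_trace_fun eta L M m m' lam f -> trace_fun eta L M m m' lam =1 f.
Proof.
move=> Hf; apply: (@is_trace_fun_unique _ L M m m' lam) => //.
exact: (@xgetPex _ (fun=> 0) [set g | is_trace_fun eta L M m m' lam g] (ex_intro _ f Hf)).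
Qed.

Lemma is_trace_fun_imp n (L : n.-tuple C) M m1 m2 m' (lam1 lam2 : C) f :
  (forall x t, has_trace (mPhi eta L m1 lam1 \o actK (verma eta (lam1 - 1)) x) m' t ->
     has_trace (mPhi eta L m2 lam2 \o actK (verma eta (lam2 - 1)) x) m' t) ->
  is_trace_fun eta L M m1 m' lam1 f -> is_trace_fun eta L M m2 m' lam2 f.
Proof.
move=> H [mf [r Hr]]; split; first exact: mf.
exists r => x rx; have [t Ht fx] := Hr x rx.
exists t; [exact: H Ht | exact: fx].
Qed.

(** The trace function is chosen by its defining property, which involves the
    operator only through its trace. *)
Lemma eq_trace_fun n (L : n.-tuple C) M m1 m2 m' (lam1 lam2 : C) :
  (forall x t, has_trace (mPhi eta L m1 lam1 \o actK (verma eta (lam1 - 1)) x) m' t <->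
     has_trace (mPhi eta L m2 lam2 \o actK (verma eta (lam2 - 1)) x) m' t) ->
  trace_fun eta L M m1 m' lam1 = trace_fun eta L M m2 m' lam2.
Proof.
move=> H.
have E : [set f | is_trace_fun eta L M m1 m' lam1 f] = [set f | is_trace_fun eta L M m2 m' lam2 f].
  apply/seteqP; split=> f Hf; apply: is_trace_fun_imp Hf => x t Ht.
    by have [H1 _] := H x t; exact: H1 Ht.
  by have [_ H1] := H x t; exact: H1 Ht.
exact (f_equal (fun S : set (C -> C) => xget (fun=> 0) S) E).
Qed.

Lemma nm_qpow_lt1 (b x : C) : nm (qpow b) < nm (qpow (2 * x)) -> nm (qpow (b - 2 * x)) < 1.
Proof.
move=> H; rewrite qpowB nmM nmV ltr_pdivrMr ?mul1r //.
by rewrite nm_gt0 qpow_neq0.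
Qed.

(** If |q^{2x}| exceeds every |q^{be i}|, the geometric series of the trace converge,
    and the formula continues their sum. *)
Lemma trace_fun_norm_trace_val n (L : n.-tuple C) M m m' : exists (K : nat) (I : finType) (be : I -> C) a,
  (forall i, holomorphic (a i)) /\
  forall x, (forall i, qpow (be i - 2 * x) != 1) -> forall lam,
    trace_fun eta L M m m' lam x = norm_trace_val eta M K be a (fun lam k => cPhi L m lam k k m') lam x.
Proof.
have [_ [K [I [be [a [ha Ha]]]]]] := exp_poly_diag eta_gt0 L m m'.
exists K, I, be, a; split=> // x gx lam.
have [g mg Hg] := mero_ext_norm_trace_val eta_gt0 M K be a (fun lam k => cPhi L m lam k k m') lam.
rewrite -(Hg x gx); apply: trace_funE; split=> //.
exists (\sum_(i : I) nm (qpow (be i))) => z; rewrite normE ltcR => Hz.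
have be1 i : nm (qpow (be i - 2 * z)) < 1.
  apply: nm_qpow_lt1; apply: le_lt_trans Hz.
  by rewrite (bigD1 i) //= lerDl sumr_ge0 // => j _; exact: nm_ge0.
exists (trace_val eta K be a (fun lam k => cPhi L m lam k k m') lam z).
  apply/(has_traceE eta_gt0); apply: cvg_trace_val => // k Kk; exact: Ha.
apply: Hg => i; apply: contraTneq (be1 i) => ->; by rewrite nm1 ltxx.
Qed.

End Continuation.

(** * Resonance relations for the trace function *)

Section TraceResonance.
Variables (R : realType) (eta : Cx R).
Hypothesis eta_gt0 : 0 < 'Im eta.
Local Notation C := (Cx R).
Local Notation qpow := (qpow eta).
Local Notation cPhi := (mPhi_coef eta).

Lemma sumn_tnth n (m : n.-tuple nat) : sumn m = (\sum_(i < n) tnth m i)%N.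
Proof. by rewrite sumnE big_tuple. Qed.

Lemma sum_single n (d : nat) (j : 'I_n) : (\sum_(i < n) d * (i == j) = d)%N.
Proof.
rewrite (bigD1 j) //= eqxx muln1 big1 ?addn0 // => i /negbTE ->.
by rewrite muln0.
Qed.

(** The truncated subtraction is exact, since d <= m_j. *)
Lemma sum_lower n (m : n.-tuple nat) (j : 'I_n) (d : nat) : (d <= tnth m j)%N ->
  (\sum_(i < n) (tnth m i - d * (i == j)) + d = sumn m)%N.
Proof.
move=> dm; rewrite -[X in (_ + X)%N](sum_single d j) -big_split sumn_tnth /=.
apply: eq_bigr => i _; case: eqP => [->|_]; first by rewrite muln1 subnK.
by rewrite muln0 subn0 addn0.
Qed.

Lemma sumn_tau n (m : n.-tuple nat) (j : 'I_n) (d : nat) : (d <= tnth m j)%N ->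
  sumn (tau j d m) = sumn m.
Proof.
move=> dm; rewrite -(sum_lower dm) sumn_tnth -[X in (_ + X)%N](sum_single d (ordS j)) -big_split.
by apply: eq_bigr => i _; rewrite tnth_mktuple.
Qed.

Lemma cvg_series_shift (u v : nat -> C) (d : nat) (l : C) :
  (forall k, (k < d)%N -> u k = 0) -> (forall k, u (k + d)%N = v k) ->
  series u @ \oo --> l <-> series v @ \oo --> l.
Proof.
move=> u0 uv.
have E : (fun n => series u (n + d)%N) = series v.
  apply/funext => n; rewrite /series /= (big_cat_nat (leq0n d) (leq_addl n d)) /=.
  rewrite big_nat big1 ?add0r => [|k /andP[_ /u0]//].
  rewrite -{1}[d]add0n big_addn addnK; apply: eq_bigr => k _; exact: uv.
have := cvgC_shift (series u) l d; rewrite E => H; split=> G.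
  by have [_ H1] := H; exact: H1 G.
by have [H1 _] := H; exact: H1 G.
Qed.

Lemma trace_fun_exchange n (L : n.-tuple C) M (m m' : n.-tuple nat) (j : 'I_n) (d : nat) :
  (j.+1 < n)%N -> (d <= tnth m j)%N ->
  let lam := - d%:R + \sum_(i < n | (j < i)%N) (tnth L i - (2 * tnth m i)%:R) in
  trace_fun eta L M m m' lam = trace_fun eta L M (tau j d m) m' lam.
Proof.
move=> jn dm lam; apply: eq_trace_fun => x t.
have E : (fun k => cPhi L m lam k k m' * qpow ((lam - 1 - (2 * k)%:R) * x)) =
         (fun k => cPhi L (tau j d m) lam k k m' * qpow ((lam - 1 - (2 * k)%:R) * x)).
  apply/funext => k; congr (_ * _); symmetry; apply: (@cPhi_exchange _ _ eta_gt0 _ _ _ _ j d) => //.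
    move=> i; rewrite tnth_mktuple; congr (_ + d * (_ : bool))%N.
    by rewrite -val_eqE /= modn_small.
  by move=> i ij; rewrite (_ : i = j) //; exact: val_inj.
have H1 := has_traceE eta_gt0 L m m' lam x t.
have H2 := has_traceE eta_gt0 L (tau j d m) m' lam x t.
rewrite E in H1.
exact: (iff_trans H1 (iff_sym H2)).
Qed.

(** Cyclicity of the trace: by [cPhi_shift] the diagonal elements for tau_n^d(m) at
    lam = d vanish for k < d, and by [cPhi_lower] the (k+d)-th one is the k-th one
    for m at lam = -d.  The weights agree: d - 1 - 2(k + d) = -d - 1 - 2k. *)
Lemma trace_fun_reflect n (L : n.+1.-tuple C) M (m m' : n.+1.-tuple nat) (d : nat) :
  \sum_(i < n.+1) tnth L i = (2 * M)%:R -> sumn m = M -> (d <= tnth m ord_max)%N ->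
  trace_fun eta L M m m' (- d%:R) = trace_fun eta L M (tau ord_max d m) m' d%:R.
Proof.
move=> sL sm dm; apply: eq_trace_fun => x t.
(* m with its last entry lowered: the step from m to mo is [cPhi_lower], the step
   from mo to tau_n^d(m) is [cPhi_shift] *)
pose mo := [tuple (tnth m i - d * (i == ord_max))%N | i < n.+1].
have tauE i : tnth (tau ord_max d m) i = (tnth mo i + d * (i == ord0))%N.
  rewrite !tnth_mktuple; congr (_ + d * (i == _))%N.
  by apply: val_inj; rewrite /= modnn.
have lamE : d%:R - \sum_(i < n.+1) (tnth L i - (2 * tnth mo i)%:R) = - d%:R :> C.
  rewrite big_split /= sL sumrN -natr_sum -big_distrr /=.
  have := sum_lower dm; rewrite sm => smE.
  have -> : (\sum_(i < n.+1) tnth mo i = \sum_(i < n.+1) (tnth m i - d * (i == ord_max)))%N.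
    by apply: eq_bigr => i _; rewrite tnth_mktuple.
  by rewrite -smE !natrM natrD; ring.
have C0 k : (k < d)%N -> cPhi L (tau ord_max d m) d%:R k k m' = 0.
  by move=> kd; rewrite (cPhi_shift eta_gt0 _ _ _ tauE lamE) kd.
have C1 k : cPhi L (tau ord_max d m) d%:R (k + d) (k + d) m' = cPhi L m (- d%:R) k k m'.
  rewrite (cPhi_shift eta_gt0 _ _ _ tauE lamE) ltnNge leq_addl /= addnK.
  apply: (cPhi_lower eta_gt0) => //.
    by rewrite tnth_mktuple eqxx muln1.
  apply: eq_from_tnth => i; rewrite !tnth_tinit tnth_mktuple.
  by rewrite -val_eqE /= ltn_eqF ?muln0 ?subn0.
have H1 := has_traceE eta_gt0 L m m' (- d%:R) x t.
have H2 := has_traceE eta_gt0 L (tau ord_max d m) m' d%:R x t.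
apply: (iff_trans H1); apply: (iff_trans _ (iff_sym H2)); apply: iff_sym.
apply: (@cvg_series_shift _ _ d) => k.
  by move=> kd; rewrite C0 ?mul0r.
by rewrite C1; congr (_ * qpow _); rewrite !natrM natrD; ring.
Qed.

Lemma trace_fun_cyclic n (L : n.-tuple C) M (m m' : n.-tuple nat) (j : 'I_n) (d : nat) :
  \sum_(i < n) tnth L i = (2 * M)%:R -> sumn m = M -> j.+1 = n -> (d <= tnth m j)%N ->
  trace_fun eta L M m m' (- d%:R) = trace_fun eta L M (tau j d m) m' d%:R.
Proof.
case: n L m m' j => [|n] L m m' j sL sm jn; first by exfalso; case: j jn.
have jE : j = ord_max by apply: val_inj; case: jn.
by subst j => dm; exact (@trace_fun_reflect _ L M m m' d sL sm dm).
Qed.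

End TraceResonance.

(** * Holomorphy for generic x and the theorem *)

Section Genericity.
Variables (R : realType) (eta : Cx R).
Hypothesis eta_gt0 : 0 < 'Im eta.
Local Notation C := (Cx R).
Local Notation qpow := (qpow eta).

Lemma lcoef_trace_vec n (L : n.-tuple C) M (m m' : n.-tuple nat) (lam x : C) :
  lcoef (trace_vec eta L M m' lam x) m =
  if sumn m == M then trace_fun eta L M m m' lam x else 0.
Proof.
pose ev (t : n.-tuple 'I_M.+1) : n.-tuple nat := [tuple of map val t].
have E : lcoef (trace_vec eta L M m' lam x) m =
    \sum_(t : n.-tuple 'I_M.+1 | sumn (ev t) == M)
      trace_fun eta L M (ev t) m' lam x * (ev t == m)%:R.
  rewrite -lcoefE /trace_vec raddf_sum; apply: eq_bigr => t _.
  by apply: etrans (lcoefE _ _) _; rewrite lcoefZ lcoef_bas.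
rewrite E; case: eqP => [sm|nsm]; last first.
  by apply: big1 => t /eqP st; case: eqP => [tm|_]; [rewrite -tm in nsm | rewrite mulr0].
have mi i : (tnth m i < M.+1)%N.
  by rewrite ltnS -sm sumn_tnth (bigD1 i) //= leq_addr.
pose t0 : n.-tuple 'I_M.+1 := [tuple Ordinal (mi i) | i < n].
have t0E : ev t0 = m by apply: eq_from_tnth => i; rewrite tnth_map tnth_mktuple.
rewrite (bigD1 t0); last by rewrite t0E sm.
rewrite t0E eqxx mulr1 big1; first exact: addr0.
move=> t /andP[_ ne].
case: eqP => [tm|_]; last by rewrite mulr0.
case/eqP: ne; apply: eq_from_tnth => i; apply: val_inj.
by rewrite -(tnth_map val t i) -(tnth_map val t0 i); congr tnth; rewrite -/(ev t) tm.
Qed.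

(** The exponents of the exponential polynomial, listed as a sequence; the default
    value 0 only excludes some further x. *)
Lemma hol_trace_fun n (L : n.-tuple C) M m m' : exists B : nat -> C,
  forall x, (forall j, qpow (B j - 2 * x) != 1) ->
    holomorphic (fun lam => trace_fun eta L M m m' lam x).
Proof.
have [K [I [be [a [ha Ha]]]]] := trace_fun_norm_trace_val eta_gt0 L M m m'.
exists (fun j => if insub j is Some o then be (enum_val (o : 'I_#|I|)) else 0) => x gx.
have -> : (fun lam => trace_fun eta L M m m' lam x) =
    fun lam => norm_trace_val eta M K be a (fun lam k => mPhi_coef eta L m lam k k m') lam x.
  apply/funext => lam; apply: Ha => i; have := gx (enum_rank i).
  by rewrite (valK (enum_rank i)) enum_rankK.
exact (@hol_scale _ _ _ (@hol_trace_val _ _ _ _ _ _ _ _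
  (fun k => @hol_cPhi _ _ eta_gt0 _ _ _ _ _ _) ha)).
Qed.

(** Each function 1 - q^{B - 2x} of x is entire, and it does not vanish at
    x = (B - 1)/2, because q is not 1. *)
Lemma generic_qpow (J : countType) (B : J -> C) (P : C -> Prop) :
  (forall x, (forall j, qpow (B j - 2 * x) != 1) -> P x) -> generic P.
Proof.
move=> BP.
exists (fun k x => if @choice.unpickle J k is Some j then 1 - qpow (B j - 2 * x) else 1); split=> [k|x gx].
  case: (@choice.unpickle J k) => [j|]; last first.
    by split; [exact: (@hol_cst _ _) | exists 0; exact: oner_neq0].
  split.
    have -> : (fun x => 1 - qpow (B j - 2 * x)) = fun x => 1 + -1 * qpow (-2 * x + B j).
      by apply/funext => x; rewrite mulN1r; congr (1 - qpow _); ring.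
    exact (@hol_add _ _ _ (@hol_cst _ _) (@hol_scale _ _ _ (@hol_qpow _ eta _ _))).
  exists ((B j - 1) / 2); rewrite subr_eq0 eq_sym.
  have -> : B j - 2 * ((B j - 1) / 2) = 1%:R by field.
  exact: (qpow_nat_neq1 eta_gt0).
apply: BP => j; have := gx (choice.pickle j).
by rewrite choice.pickleK subr_eq0 eq_sym.
Qed.

End Genericity.

Theorem theorem3p4 (R : realType) (eta : Cx R) (eta_gt0 : 0 < 'Im eta)
    (M n : nat) (n_ge1 : (1 <= n)%N)
    (L : n.-tuple (Cx R)) (sum_L : \sum_(i < n) tnth L i = (2 * M)%:R) :
  generic (fun x : Cx R =>
    forall m' : n.-tuple nat, sumn m' = M ->
      resonance L M (fun lam => trace_vec eta L M m' lam x)).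
Proof.
have [B HB] := choice (fun mm : n.-tuple nat * n.-tuple nat =>
  hol_trace_fun eta_gt0 L M mm.1 mm.2).
apply: (@generic_qpow _ _ eta_gt0 _ (fun j : (n.-tuple nat * n.-tuple nat) * nat => B j.1 j.2)).
move=> x gx m' _.
have vecE (lam : Cx R) (m : n.-tuple nat) : sumn m = M ->
    (trace_vec eta L M m' lam x)@_m = trace_fun eta L M m m' lam x.
  by move=> sm; apply: etrans (lcoefE _ _) _; rewrite lcoef_trace_vec sm eqxx.
have vec0 (lam : Cx R) (m : n.-tuple nat) : sumn m <> M -> (trace_vec eta L M m' lam x)@_m = 0.
  by move=> /eqP/negbTE sm; apply: etrans (lcoefE _ _) _; rewrite lcoef_trace_vec sm.
split.
- move=> m; case: (eqVneq (sumn m) M) => [sm|/eqP sm].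
    have -> : (fun lam => (trace_vec eta L M m' lam x)@_m) =
        fun lam => trace_fun eta L M m m' lam x by apply/funext => lam; exact: vecE.
    exact: (HB (m, m') x (fun j => gx ((m, m'), j))).
  have -> : (fun lam => (trace_vec eta L M m' lam x)@_m) = fun=> 0.
    by apply/funext => lam; exact: vec0.
  exact: (@hol_cst _ _).
- by move=> lam m sm; exact: vec0.
- move=> m sm j jn d /andP[_ dm] lam.
  have st : sumn (tau j d m) = M by rewrite sumn_tau.
  apply: etrans (vecE _ _ sm) _; apply: etrans _ (esym (vecE _ _ st)).
  by rewrite /lam (trace_fun_exchange eta_gt0 _ _ _ jn dm).
- move=> m sm j jn d /andP[_ dm].
  have st : sumn (tau j d m) = M by rewrite sumn_tau.
  apply: etrans (vecE _ _ sm) _; apply: etrans _ (esym (vecE _ _ st)).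
  by rewrite (trace_fun_cyclic eta_gt0 _ sum_L sm jn dm).
Qed.
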